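(* Let $\Gamma$ be a name for a class well-order given by a first-order formula without parameters such that $\mathsf{GB}$ proves this formula defines a well-order, such that $\mathsf{GB}$ proves $\Gamma\ge\omega^\omega$, and such that $\Gamma$ is absolute to $L$ (i.e. $\Gamma^M=\Gamma^{L^M}$ for the relevant models $M$). If there is a $\beta$-model of $\mathsf{GB}+\mathsf{ETR}_\Gamma$, then there is a minimum $\beta$-model of $\mathsf{GB}+\mathsf{ETR}_\Gamma$ (a $\beta$-model $(M,\mathcal X)\models\mathsf{GB}+\mathsf{ETR}_\Gamma$ with $M\subseteq N$ and $\mathcal X\subseteq\mathcal Y$ for every $\beta$-model $(N,\mathcal Y)\models\mathsf{GB}+\mathsf{ETR}_\Gamma$), and this minimum $\beta$-model satisfies Global Choice.
   Context: Models of second-order set theory are pairs $(M,\mathcal X)$ with $\mathcal X\subseteq\mathcal P(M)$. $\mathsf{GB}$ consists of $\mathsf{ZF}$, Extensionality for classes, Class Replacement, Elementary Comprehension (comprehension for formulas without class quantifiers, with set and class parameters). Global Choice: there is a class bijection between $V$ and $\mathrm{Ord}$. Elementary Transfinite Recursion along a well-founded class relation $R$ for a first-order $\varphi(x,Y,A)$ (class parameter $A$) asserts there is a class $S\subseteq\mathrm{dom}R\times V$ with $S_r=\{x:\varphi(x,S\restriction r,A)\}$ for all $r\in\mathrm{dom}R$, where $S_r=\{x:(r,x)\in S\}$, $S\restriction r=S\cap(\{r':r'<_Rr\}\times V)$, $<_R$ the transitive closure of $R$. $\mathsf{ETR}_\Gamma$ is this schema restricted to well-founded relations $R$ of rank $\le\Gamma$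 (interpreted in each model via the defining formula). A $\beta$-model is an $(M,\mathcal X)$ with $M$ transitive (true $\in$) such that every $R\in\mathcal X$ that $(M,\mathcal X)$ thinks is well-founded is truly well-founded. *)

(* Defs.v *)
From Stdlib Require Import List Bool PeanoNat.

(** * The ambient universe of sets *)

(* Well-founded trees up to bisimilarity: with the classical axioms (excluded
   middle, choice) this is a universe of true sets satisfying ZFC, with [eqV]
   as its extensional equality. *)
Inductive V : Type := sup (A : Type) (f : A -> V).

Definition idx (x : V) : Type := let (A, _) := x in A.
Definition elt (x : V) : idx x -> V :=
  match x return idx x -> V with sup _ f => f end.

Fixpoint eqV (x y : V) : Prop :=
  match x, y with
  | sup A f, sup B g =>
      (forall a, exists b, eqV (f a) (g b)) /\
      (forall b, exists a, eqV (f a) (g b))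
  end.

Definition memV (x y : V) : Prop := exists b : idx y, eqV x (elt y b).
Definition subV (x y : V) : Prop := forall z, memV z x -> memV z y.
Definition nonempty (x : V) : Prop := exists z, memV z x.
Definition transV (x : V) : Prop := forall y, memV y x -> subV y x.
Definition ordV (x : V) : Prop :=
  transV x /\ forall y, memV y x -> transV y.

Definition emptyV : V := sup Empty_set (fun a => match a with end).
Definition upairV (a b : V) : V := sup bool (fun t => if t then a else b).
Definition opairV (a b : V) : V := upairV (upairV a a) (upairV a b).
Definition sepV (x : V) (P : V -> Prop) : V :=
  sup {a : idx x | P (elt x a)} (fun a => elt x (proj1_sig a)).
Definition powV (x : V) : V :=
  sup (idx x -> Prop) (fun P => sup {a : idx x | P a}
                                    (fun a => elt x (proj1_sig a))).
Definition bigcupV (A : Type) (g : A -> V) : V :=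
  sup {a : A & idx (g a)} (fun p => elt (g (projT1 p)) (projT2 p)).

(** * The two-sorted language of second-order set theory *)

(* De Bruijn indices, with independent numberings for set variables and class
   variables: [fAll], [fEx] bind set variable 0 and [fCAll], [fCEx] bind class
   variable 0. *)
Inductive form : Type :=
| fEq (x y : nat)
| fMem (x y : nat)
| fCEq (X Y : nat)
| fCMem (x X : nat)
| fBot
| fAnd (p q : form)
| fOr (p q : form)
| fImp (p q : form)
| fAll (p : form)
| fEx (p : form)
| fCAll (p : form)
| fCEx (p : form).

Declare Scope form_scope.
Delimit Scope form_scope with form.
Bind Scope form_scope with form.
Notation "p ∧' q" := (fAnd p q) (at level 52, right associativity) : form_scope.
Notation "p ∨' q" := (fOr p q) (at level 53, right associativity) : form_scope.
Notation "p →' q" := (fImp p q) (at level 55, right associativity) : form_scope.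
Notation "p ↔' q" := (fAnd (fImp p q) (fImp q p)) (at level 56) : form_scope.
Notation fNot p := (fImp p fBot).
Local Open Scope form_scope.

(* no class quantifiers *)
Fixpoint elementary (p : form) : bool :=
  match p with
  | fAnd p q | fOr p q | fImp p q => elementary p && elementary q
  | fAll p | fEx p => elementary p
  | fCAll _ | fCEx _ => false
  | _ => true
  end.

(* free set variables are < n and free class variables are < m *)
Fixpoint bounded (n m : nat) (p : form) : bool :=
  match p with
  | fEq x y | fMem x y => (x <? n) && (y <? n)
  | fCEq X Y => (X <? m) && (Y <? m)
  | fCMem x X => (x <? n) && (X <? m)
  | fBot => true
  | fAnd p q | fOr p q | fImp p q => bounded n m p && bounded n m q
  | fAll p | fEx p => bounded (S n) m p
  | fCAll p | fCEx p => bounded n (S m) p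
  end.

Definition scons {T : Type} (t : T) (e : nat -> T) (k : nat) : T :=
  match k with 0 => t | S k => e k end.
Definition idn (k : nat) : nat := k.
Definition up (s : nat -> nat) : nat -> nat := scons 0 (fun k => S (s k)).

Fixpoint ren (s c : nat -> nat) (p : form) : form :=
  match p with
  | fEq x y => fEq (s x) (s y)
  | fMem x y => fMem (s x) (s y)
  | fCEq X Y => fCEq (c X) (c Y)
  | fCMem x X => fCMem (s x) (c X)
  | fBot => fBot
  | fAnd p q => fAnd (ren s c p) (ren s c q)
  | fOr p q => fOr (ren s c p) (ren s c q)
  | fImp p q => fImp (ren s c p) (ren s c q)
  | fAll p => fAll (ren (up s) c p)
  | fEx p => fEx (ren (up s) c p)
  | fCAll p => fCAll (ren s (up c) p)
  | fCEx p => fCEx (ren s (up c) p)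
  end.

Definition shift : form -> form := ren S idn.
Definition cshift : form -> form := ren idn S.
Definition inst (x : nat) : form -> form := ren (scons x idn) idn.
Definition cinst (X : nat) : form -> form := ren idn (scons X idn).

(** * Provability *)

(* Classical natural deduction with equality on both sorts. Axioms of [T] may
   have free variables and are understood as universally closed, hence [p_ax]
   is not subject to any eigenvariable condition. *)
Inductive proves (T : form -> Prop) : list form -> form -> Prop :=
| p_ax G p : T p -> proves T G p
| p_hyp G p : In p G -> proves T G p
| p_contra G p : proves T (fNot p :: G) fBot -> proves T G p
| p_andI G p q : proves T G p -> proves T G q -> proves T G (fAnd p q)
| p_andE1 G p q : proves T G (fAnd p q) -> proves T G p
| p_andE2 G p q : proves T G (fAnd p q) -> proves T G q
| p_orI1 G p q : proves T G p -> proves T G (fOr p q)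
| p_orI2 G p q : proves T G q -> proves T G (fOr p q)
| p_orE G p q r : proves T G (fOr p q) ->
    proves T (p :: G) r -> proves T (q :: G) r -> proves T G r
| p_impI G p q : proves T (p :: G) q -> proves T G (fImp p q)
| p_impE G p q : proves T G (fImp p q) -> proves T G p -> proves T G q
| p_allI G p : proves T (map shift G) p -> proves T G (fAll p)
| p_allE G p x : proves T G (fAll p) -> proves T G (inst x p)
| p_exI G p x : proves T G (inst x p) -> proves T G (fEx p)
| p_exE G p q : proves T G (fEx p) ->
    proves T (p :: map shift G) (shift q) -> proves T G q
| p_callI G p : proves T (map cshift G) p -> proves T G (fCAll p)
| p_callE G p X : proves T G (fCAll p) -> proves T G (cinst X p)
| p_cexI G p X : proves T G (cinst X p) -> proves T G (fCEx p)
| p_cexE G p q : proves T G (fCEx p) ->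
    proves T (p :: map cshift G) (cshift q) -> proves T G q
| p_eqR G x : proves T G (fEq x x)
| p_eqS G p x y : proves T G (fEq x y) ->
    proves T G (inst x p) -> proves T G (inst y p)
| p_ceqR G X : proves T G (fCEq X X)
| p_ceqS G p X Y : proves T G (fCEq X Y) ->
    proves T G (cinst X p) -> proves T G (cinst Y p).

(** * Set-theoretic formulas *)

(* Each abbreviation takes the indices of its arguments in the context where
   it is used, so arguments are shifted under the binders it introduces. *)

Definition fSub (x y : nat) : form := fAll (fMem 0 (S x) →' fMem 0 (S y)).
Definition fEmpty (x : nat) : form := fAll (fNot (fMem 0 (S x))).
(* p = {a, b} *)
Definition fUpair (p a b : nat) : form :=
  fAll (fMem 0 (S p) ↔' (fEq 0 (S a) ∨' fEq 0 (S b))).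
(* p = (a, b), Kuratowski *)
Definition fOpair (p a b : nat) : form :=
  fEx (fEx (fUpair 1 (S (S a)) (S (S a)) ∧'
            fUpair 0 (S (S a)) (S (S b)) ∧' fUpair (S (S p)) 1 0)).
(* (a, b) belongs to the set f *)
Definition fPairMem (a b f : nat) : form :=
  fEx (fOpair 0 (S a) (S b) ∧' fMem 0 (S f)).
(* (a, b) belongs to the class F *)
Definition fPairIn (a b F : nat) : form :=
  fEx (fOpair 0 (S a) (S b) ∧' fCMem 0 F).
(* y = x ∪ {x} *)
Definition fSucc (y x : nat) : form :=
  fAll (fMem 0 (S y) ↔' (fMem 0 (S x) ∨' fEq 0 (S x))).
Definition fInductive (w : nat) : form :=
  fEx (fEmpty 0 ∧' fMem 0 (S w)) ∧'
  fAll (fMem 0 (S w) →' fEx (fSucc 0 1 ∧' fMem 0 (S (S w)))).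
(* x ∈ ω *)
Definition fNat (x : nat) : form := fAll (fInductive 0 →' fMem (S x) 0).
Definition fTrans (x : nat) : form := fAll (fMem 0 (S x) →' fSub 0 (S x)).
Definition fOrd (x : nat) : form :=
  fTrans x ∧' fAll (fMem 0 (S x) →' fTrans 0).
Definition fFunctional (F : nat) : form :=
  fAll (fAll (fAll (fPairIn 2 1 F →' fPairIn 2 0 F →' fEq 1 0))).

(** * The theory GB *)

Definition ax_ext : form :=
  fAll (fAll (fAll (fMem 0 2 ↔' fMem 0 1) →' fEq 1 0)).
Definition ax_foundation : form :=
  fAll (fEx (fMem 0 1) →'
        fEx (fMem 0 1 ∧' fNot (fEx (fMem 0 2 ∧' fMem 0 1)))).
Definition ax_pairing : form := fAll (fAll (fEx (fUpair 0 2 1))).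
Definition ax_union : form :=
  fAll (fEx (fAll (fMem 0 1 ↔' fEx (fMem 0 3 ∧' fMem 1 0)))).
Definition ax_power : form := fAll (fEx (fAll (fMem 0 1 ↔' fSub 0 2))).
Definition ax_infinity : form := fEx (fInductive 0).

(* [p] with set variables 0, 1 replaced by x, y, and with its k-th parameter
   (set variable k + 2) moved to index k + d. *)
Definition inst2 (x y d : nat) (p : form) : form :=
  ren (fun k => match k with 0 => x | 1 => y | S (S k) => k + d end) idn p.

(* set variable 0 of [p] is the variable x in {x ∈ a : p}; the others are
   parameters *)
Definition ax_separation (p : form) : form :=
  fAll (fEx (fAll (fMem 0 1 ↔'
    (fMem 0 2 ∧' ren (scons 0 (fun k => k + 3)) idn p)))).

(* [p] defines y (set variable 1) from x (set variable 0) *)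
Definition ax_replacement (p : form) : form :=
  fAll (fAll (fAll (fAll
      (fMem 2 3 →' inst2 2 1 4 p →' inst2 2 0 4 p →' fEq 1 0))) →'
    fEx (fAll (fMem 0 1 ↔' fEx (fMem 0 3 ∧' inst2 0 1 4 p)))).

Definition ax_class_ext : form :=
  fCAll (fCAll (fAll (fCMem 0 1 ↔' fCMem 0 0) →' fCEq 1 0)).
Definition ax_class_replacement : form :=
  fCAll (fFunctional 0 →'
    fAll (fEx (fAll (fMem 0 1 ↔' fEx (fMem 0 3 ∧' fPairIn 0 1 0))))).
Definition ax_comprehension (p : form) : form :=
  fCEx (fAll (fCMem 0 0 ↔' cshift p)).

Inductive GB : form -> Prop :=
| GB_ext : GB ax_ext
| GB_foundation : GB ax_foundation
| GB_pairing : GB ax_pairing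
| GB_union : GB ax_union
| GB_power : GB ax_power
| GB_infinity : GB ax_infinity
| GB_separation n p : elementary p = true -> bounded n 0 p = true ->
    GB (ax_separation p)
| GB_replacement n p : elementary p = true -> bounded n 0 p = true ->
    GB (ax_replacement p)
| GB_class_ext : GB ax_class_ext
| GB_class_replacement : GB ax_class_replacement
| GB_comprehension p : elementary p = true -> GB (ax_comprehension p).

(* there is a class bijection from V onto Ord *)
Definition global_choice : form :=
  fCEx (fFunctional 0 ∧'
        fAll (fAll (fPairIn 1 0 0 →' fOrd 0)) ∧'
        fAll (fEx (fPairIn 1 0 0)) ∧'
        fAll (fAll (fAll (fPairIn 2 0 0 →' fPairIn 1 0 0 →' fEq 2 1))) ∧'
        fAll (fOrd 0 →' fEx (fPairIn 0 1 0))).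

(** * Class relations and named well-orders *)

(* A pair (a, b) in a class relation R is read as a R b, a below b. *)

Definition fWellFounded (R : nat) : form :=
  fCAll (fEx (fCMem 0 0) →'
         fEx (fCMem 0 0 ∧' fNot (fEx (fCMem 0 0 ∧' fPairIn 0 1 (S R))))).

(* x ∈ dom R: x is related to something, on either side *)
Definition fDom (x R : nat) : form :=
  fEx (fPairIn (S x) 0 R ∨' fPairIn 0 (S x) R).

(* a <_R b, the transitive closure: (a, b) is in every transitive class
   relation containing R *)
Definition fTransClos (a b R : nat) : form :=
  fCAll (fAll (fAll (fPairIn 1 0 (S R) →' fPairIn 1 0 0)) →'
         fAll (fAll (fAll (fPairIn 2 1 0 →' fPairIn 1 0 0 →' fPairIn 2 0 0))) →'
         fPairIn a b 0).

(* A name for a class well-order is a formula [g] with set variables 0 and 1,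
   read as the strict relation 0 <_Γ 1; the order lives on its field. *)
Definition gLt (g : form) (x y : nat) : form := inst2 x y 0 g.
Definition gFld (g : form) (x : nat) : form :=
  fEx (gLt g (S x) 0 ∨' gLt g 0 (S x)).

Definition well_order (g : form) : form :=
  fAll (fNot (gLt g 0 0)) ∧'
  fAll (fAll (fAll (gLt g 2 1 →' gLt g 1 0 →' gLt g 2 0))) ∧'
  fAll (fAll (gFld g 1 →' gFld g 0 →'
              (gLt g 1 0 ∨' fEq 1 0 ∨' gLt g 0 1))) ∧'
  fCAll (fEx (fCMem 0 0 ∧' gFld g 0) →'
         fEx (fCMem 0 0 ∧' gFld g 0 ∧'
              fNot (fEx (fCMem 0 0 ∧' gLt g 0 1)))).

(* Class variable 0 is a function from [dom] into the field of Γ carrying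
   [lt] to <_Γ. *)
Definition maps_into (g : form) (dom : nat -> form) (lt : nat -> nat -> form)
  : form :=
  fFunctional 0 ∧'
  fAll (dom 0 →' fEx (gFld g 0 ∧' fPairIn 1 0 0)) ∧'
  fAll (fAll (fAll (fAll (dom 3 →' dom 2 →' lt 3 2 →'
      fPairIn 3 1 0 →' fPairIn 2 0 0 →' gLt g 1 0)))).

(* The ordinal power ω^ω: functions ω -> ω of finite support, compared at the
   largest argument where they differ. *)
Definition fFinSupp (f : nat) : form :=
  fAll (fMem 0 (S f) →' fEx (fEx (fNat 1 ∧' fNat 0 ∧' fOpair 2 1 0))) ∧'
  fAll (fNat 0 →' fEx (fPairMem 1 0 (S (S f)))) ∧'
  fAll (fAll (fAll (fPairMem 2 1 (S (S (S f))) →'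
                    fPairMem 2 0 (S (S (S f))) →' fEq 1 0))) ∧'
  fEx (fNat 0 ∧' fAll (fAll (fPairMem 1 0 (S (S (S f))) →'
                              (fMem 2 1 ∨' fEq 2 1) →' fEmpty 0))).
Definition fLexLt (f h : nat) : form :=
  fEx (fEx (fEx (fPairMem 2 1 (S (S (S f))) ∧' fPairMem 2 0 (S (S (S h))) ∧'
                 fMem 1 0)) ∧'
       fAll (fMem 1 0 →' fAll (fPairMem 1 0 (S (S (S f))) ↔'
                                fPairMem 1 0 (S (S (S h)))))).

(* ω^ω <= Γ *)
Definition ge_omega_omega (g : form) : form :=
  fCEx (maps_into g fFinSupp fLexLt).

(* rank R <= Γ: R admits a class ranking function into Γ *)
Definition fRankLe (g : form) (R : nat) : form :=
  fCEx (maps_into g (fun x => fDom x (S R)) (fun x y => fPairIn x y (S R))).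

(** * Elementary transfinite recursion *)

(* Y = S ↾ r = S ∩ ({r' : r' <_R r} × V) *)
Definition fRestr (Y S0 r R : nat) : form :=
  fAll (fCMem 0 Y ↔'
        (fCMem 0 S0 ∧'
         fEx (fEx (fOpair 2 1 0 ∧' fTransClos 1 (S (S (S r))) R)))).

(* In φ = [p], set variable 0 is x, class variable 0 is Y and class variable 1
   is A. In the body, class variables are Y = 0, S = 1, A = 2, R = 3,
   so A moves from 1 to 2. *)
Definition ax_ETR (g p : form) : form :=
  fCAll (fCAll (fWellFounded 1 →' fRankLe g 1 →'
    fCEx
      (fAll (fCMem 0 0 →' fEx (fEx (fOpair 2 1 0 ∧' fDom 1 2))) ∧'
       fAll (fDom 0 2 →'
         fCEx (fRestr 0 1 0 3 ∧'
               fAll (fPairIn 1 0 1 ↔' ren idn (scons 0 (fun k => k + 2)) p)))))).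

Inductive GB_ETR (g : form) : form -> Prop :=
| GB_ETR_GB p : GB p -> GB_ETR g p
| GB_ETR_ETR p : elementary p = true -> bounded 1 2 p = true ->
    GB_ETR g (ax_ETR g p).

(** * Models *)

(* (M, X) is the structure with set domain M and class domain X; e and c
   assign values to set and class variables. *)
Fixpoint sat (M X : V) (e c : nat -> V) (p : form) : Prop :=
  match p with
  | fEq x y => eqV (e x) (e y)
  | fMem x y => memV (e x) (e y)
  | fCEq A B => eqV (c A) (c B)
  | fCMem x A => memV (e x) (c A)
  | fBot => False
  | fAnd p q => sat M X e c p /\ sat M X e c q
  | fOr p q => sat M X e c p \/ sat M X e c q
  | fImp p q => sat M X e c p -> sat M X e c q
  | fAll p => forall x, memV x M -> sat M X (scons x e) c p
  | fEx p => exists x, memV x M /\ sat M X (scons x e) c p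
  | fCAll p => forall A, memV A X -> sat M X e (scons A c) p
  | fCEx p => exists A, memV A X /\ sat M X e (scons A c) p
  end.

Definition so_structure (M X : V) : Prop :=
  nonempty M /\ nonempty X /\ forall A, memV A X -> subV A M.

Definition valid (M X : V) (p : form) : Prop :=
  forall e c, (forall i, memV (e i) M) -> (forall i, memV (c i) X) ->
  sat M X e c p.

Definition models (M X : V) (T : form -> Prop) : Prop :=
  forall p, T p -> valid M X p.

Definition thinks_well_founded (M X R : V) : Prop :=
  sat M X (fun _ => emptyV) (fun _ => R) (fWellFounded 0).

Definition truly_well_founded (R : V) : Prop :=
  well_founded (fun x y : V => memV (opairV x y) R).

Definition beta_model (T : form -> Prop) (M X : V) : Prop :=
  so_structure M X /\ models M X T /\ transV M /\
  forall R, memV R X -> thinks_well_founded M X R -> truly_well_founded R.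

Definition minimum_beta_model (T : form -> Prop) (M X : V) : Prop :=
  beta_model T M X /\
  forall N Y, beta_model T N Y -> subV M N /\ subV X Y.

(** * Constructible sets and absoluteness *)

(* x is first-order definable over (A, ∈) with parameters from A *)
Definition definable_over (A x : V) : Prop :=
  exists (n : nat) (p : form) (e : nat -> V),
    elementary p = true /\ bounded (S n) 0 p = true /\
    (forall i, i < n -> memV (e i) A) /\
    forall y, memV y A ->
      (memV y x <-> sat A emptyV (scons y e) (fun _ => emptyV) p).

Definition Def (A : V) : V := sepV (powV A) (definable_over A).

(* For an ordinal a, Lset a is L_a, the union of the Def (L_b) for b < a. *)
Fixpoint Lset (a : V) : V :=
  match a with sup A f => bigcupV A (fun i => Def (Lset (f i))) end.

(* For transitive M ⊨ ZF, the constructible universe of M is L_{M ∩ Ord}. *)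
Definition L_of (M : V) : V := Lset (sepV M ordV).

(* (x, y) ∈ Γ^M; [g] has no class variables, so the class part is immaterial *)
Definition named_rel (g : form) (M x y : V) : Prop :=
  memV x M /\ memV y M /\
  sat M emptyV (scons x (scons y (fun _ => emptyV))) (fun _ => emptyV) g.

Definition absolute_to_L (g : form) (M : V) : Prop :=
  forall x y, named_rel g M x y <-> named_rel g (L_of M) x y.

(* Main.v *)
Require Import Defs.
From Stdlib Require Import List Bool PeanoNat Lia.
From Stdlib Require Import Classical ClassicalEpsilon FunctionalExtensionality PropExtensionality.
From Stdlib Require Import Setoid.

(** The minimum model is [(L_α, X)], where [α] is the least height of a
    β-model of GB + ETR_Γ and [X] is the least family of subsets of [L_α] that
    is closed under elementary definability over [L_α] and under solutions of
    recursions along relations ranked into Γ by a member of [X].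

    Let [(N, Y)] be a β-model of height [α]. Since Γ is absolute to [L] and,
    by soundness, well-ordered in [(N, Y)], it is truly well-founded, hence so
    is every relation ranked into it; solutions are therefore unique, and
    relativizing recursions of [(N, Y)] to [L_α] gives [X ⊆ Y]. If the height
    of [N] exceeds [α], then [L_α ∈ N] and each solution belongs to [N] as the
    union of its set-sized partial solutions, so again [X ⊆ Y].

    That [(L_α, X)] satisfies Class Replacement comes down to amenability:
    [C ∩ L_γ ∈ L_α] for [C ∈ X]. By reflection in [(N, Y)] there are unboundedly
    many [γ] such that the definition (or the recursion) of [C] relativizes to
    [L_γ], and it can then be carried out inside [L_α], where set recursion is
    available. If [R ∈ X] is ill-founded, then so is some [R ∩ L_γ ∈ L_α], by
    reflection again, and [L_α] contains a witness. Global Choice is witnessed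
    by the definable well-order of [L]. *)

(** * Sets with Leibniz equality *)

(** Amenability looks circular: that a solution meets each level in an element of [L_α] needs
    recursion inside [L_α], hence Class Replacement there, hence amenability. The circle breaks
    because the family of all amenable classes of [N] is already closed under elementary
    definability and so models GB over [L_α]. The class parameter of a recursion changes from row to
    row, being the part of the solution already built; reflection is therefore proved uniformly in
    the row.

    No formula is coded inside a model. Definable power sets are generated from one-element lists by
    six operations on relations, a closure of length [ω] that also yields the well-order of each
    level. Absoluteness of the constructible hierarchy then amounts to definability of recursion on
    ordinals. Likewise [DfP] and [DfF] treat definability through closure properties, so that
    formulas are rarely written out.

    Absoluteness of Γ also turns a ranking over [L_α] into a ranking over [N], so that ETR in
    [(N, Y)] applies to it. *)

Lemma eqV_refl x : eqV x x.
Proof. induction x as [A f IH]; simpl; split; intro a; exists a; apply IH. Qed.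

Lemma eqV_sym x y : eqV x y -> eqV y x.
Proof.
  revert y; induction x as [A f IH]; intros [B g] [H1 H2]; simpl; split.
  - intro b; destruct (H2 b) as [a Ha]; exists a; auto.
  - intro a; destruct (H1 a) as [b Hb]; exists b; auto.
Qed.

Lemma eqV_trans x y z : eqV x y -> eqV y z -> eqV x z.
Proof.
  revert y z; induction x as [A f IH]; intros [B g] [C h] [H1 H2] [H3 H4]; simpl; split.
  - intro a; destruct (H1 a) as [b Hb]; destruct (H3 b) as [c Hc]; exists c; eauto.
  - intro c; destruct (H4 c) as [b Hb]; destruct (H2 b) as [a Ha]; exists a; eauto.
Qed.

(** Bisimilar trees have the same predicate [eqV x], by extensionality of functions and
    propositions, so the choice operator returns one representative for all of them. The fixed
    points of [canon] thus form the quotient of [V] by [eqV], with Leibniz equality. *)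
Definition canon (x : V) : V := epsilon (inhabits emptyV) (eqV x).

Lemma canon_eqV x : eqV x (canon x).
Proof. apply (epsilon_spec (inhabits emptyV) (eqV x)); exists x; apply eqV_refl. Qed.

Lemma canon_eq x y : eqV x y -> canon x = canon y.
Proof.
  intro H; unfold canon; f_equal; apply functional_extensionality; intro z.
  apply propositional_extensionality; split; intro K.
  - eapply eqV_trans; [apply eqV_sym|]; eauto.
  - eapply eqV_trans; eauto.
Qed.

Definition set : Type := {x : V | canon x = x}.
Definition val (x : set) : V := proj1_sig x.
Definition mk (x : V) : set :=
  exist _ (canon x) (eq_sym (canon_eq x (canon x) (canon_eqV x))).

Lemma val_inj x y : val x = val y -> x = y.
Proof.
  destruct x as [x Hx], y as [y Hy]; simpl; intro E; subst y; f_equal; apply proof_irrelevance.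
Qed.

Lemma val_mk x : eqV (val (mk x)) x.
Proof. apply eqV_sym, canon_eqV. Qed.

Lemma mk_eq x y : mk x = mk y <-> eqV x y.
Proof.
  split; intro H.
  - apply eqV_trans with (val (mk x)); [apply canon_eqV|]; rewrite H; apply val_mk.
  - apply val_inj, canon_eq, H.
Qed.

Lemma mk_val x : mk (val x) = x.
Proof. apply val_inj; apply (proj2_sig x). Qed.

Definition mem (x y : set) : Prop := memV (val x) (val y).
Declare Scope set_scope.
Delimit Scope set_scope with zf.
Open Scope set_scope.
Notation "x ∈ y" := (mem x y) (at level 70) : set_scope.

Definition El (x : set) : Type := idx (val x).
Definition el (x : set) (a : El x) : set := mk (elt (val x) a).

Lemma mem_el z x : z ∈ x <-> exists a : El x, z = el x a.
Proof.
  unfold mem, memV, El, el; split; intros [a Ha]; exists a.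
  - rewrite <- (mk_val z); apply mk_eq; exact Ha.
  - rewrite Ha; apply val_mk.
Qed.

Lemma memV_compat x x' y y' : eqV x x' -> eqV y y' -> memV x y -> memV x' y'.
Proof.
  intros Hx Hy [b Hb]. destruct y as [B g], y' as [B' g']; simpl in *.
  destruct Hy as [H1 _]; destruct (H1 b) as [b' Hb']; exists b'; simpl.
  eapply eqV_trans; [apply eqV_sym; eauto|]; eapply eqV_trans; eauto.
Qed.

Lemma mem_mk x y : mk x ∈ mk y <-> memV x y.
Proof.
  split; apply memV_compat; auto using val_mk, eqV_sym.
Qed.

Lemma mem_mkr x y : x ∈ mk y <-> memV (val x) y.
Proof. rewrite <- (mk_val x) at 1; apply mem_mk. Qed.

Lemma mem_mk_ex z x : z ∈ mk x <-> exists y, memV y x /\ z = mk y.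
Proof.
  split.
  - intro H; exists (val z); rewrite mk_val; split; auto; apply mem_mkr; auto.
  - intros (y & H & ->); apply mem_mk; auto.
Qed.

Lemma set_ext x y : (forall z, z ∈ x <-> z ∈ y) -> x = y.
Proof.
  intro H; rewrite <- (mk_val x), <- (mk_val y); apply mk_eq.
  assert (K : forall z, memV z (val x) <-> memV z (val y)).
  { intro z; rewrite <- !mem_mk, !mk_val; apply H. }
  destruct (val x) as [A f], (val y) as [B g]; simpl; split.
  - intro a; apply (K (f a)); exists a; apply eqV_refl.
  - intro b; destruct (proj2 (K (g b))) as [a Ha]; [exists b; apply eqV_refl|].
    exists a; apply eqV_sym; auto.
Qed.

(** Ambient replacement: a family indexed by any type has a set of values. The other set
    constructions are instances of it. *)
Definition setof (A : Type) (f : A -> set) : set := mk (sup A (fun a => val (f a))).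

Lemma mem_setof A f z : z ∈ setof A f <-> exists a, z = f a.
Proof.
  unfold setof; rewrite mem_mkr; split; intros [a Ha]; exists a; simpl in *.
  - rewrite <- (mk_val z), <- (mk_val (f a)); apply mk_eq; auto.
  - rewrite Ha; apply eqV_refl.
Qed.

Definition emp : set := setof Empty_set (fun a => match a with end).
Definition upair (a b : set) : set := setof bool (fun t => if t then a else b).
Definition opair (a b : set) : set := upair (upair a a) (upair a b).
Definition sep (x : set) (P : set -> Prop) : set :=
  setof {a : El x | P (el x a)} (fun a => el x (proj1_sig a)).
Definition img (x : set) (f : set -> set) : set := setof (El x) (fun a => f (el x a)).
Definition union (x : set) : set :=
  setof {a : El x & El (el x a)} (fun p => el _ (projT2 p)).
Definition pow (x : set) : set :=
  setof (El x -> Prop) (fun P => setof {a : El x | P a} (fun a => el x (proj1_sig a))).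
Definition sub (x y : set) : Prop := forall z, z ∈ x -> z ∈ y.

Lemma mem_emp z : ~ z ∈ emp.
Proof. unfold emp; rewrite mem_setof; intros [[] _]. Qed.

Lemma mem_upair z a b : z ∈ upair a b <-> z = a \/ z = b.
Proof.
  unfold upair; rewrite mem_setof; split.
  - intros [[|] H]; auto.
  - intros [H|H]; [exists true|exists false]; auto.
Qed.

Lemma mem_sep z x P : z ∈ sep x P <-> z ∈ x /\ P z.
Proof.
  unfold sep; rewrite mem_setof, mem_el; split.
  - intros [[a Ha] ->]; simpl; eauto.
  - intros [[a ->] Ha]; exists (exist _ a Ha); auto.
Qed.

Lemma mem_img z x f : z ∈ img x f <-> exists y, y ∈ x /\ z = f y.
Proof.
  unfold img; rewrite mem_setof; split.
  - intros [a ->]; exists (el x a); split; auto; apply mem_el; eauto.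
  - intros (y & H & ->); apply mem_el in H; destruct H as [a ->]; eauto.
Qed.

Lemma mem_union z x : z ∈ union x <-> exists y, y ∈ x /\ z ∈ y.
Proof.
  unfold union; rewrite mem_setof; split.
  - intros [[a b] ->]; simpl; exists (el x a); split; apply mem_el; eauto.
  - intros (y & H & Hz); apply mem_el in H; destruct H as [a ->].
    apply mem_el in Hz; destruct Hz as [b ->]; exists (existT _ a b); auto.
Qed.

Lemma mem_pow z x : z ∈ pow x <-> sub z x.
Proof.
  unfold pow; rewrite mem_setof; split.
  - intros [P ->] w Hw; apply mem_setof in Hw; destruct Hw as [[a Ha] ->]; apply mem_el; simpl; eauto.
  - intro H; exists (fun a => el x a ∈ z); apply set_ext; intro w; rewrite mem_setof; split.
    + intro Hw; destruct (proj1 (mem_el _ _) (H _ Hw)) as [a Ha]; subst w; exists (exist _ a Hw); auto.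
    + intros [[a Ha] ->]; auto.
Qed.

Lemma mem_wf : well_founded mem.
Proof.
  assert (H : forall x, Acc mem (mk x)).
  { induction x as [A f IH]; constructor; intros z Hz.
    apply mem_mk_ex in Hz; destruct Hz as (y & [a Ha] & ->); simpl in Ha.
    replace (mk y) with (mk (f a)); auto; apply mk_eq, eqV_sym; auto. }
  intro x; rewrite <- (mk_val x); apply H.
Qed.

Lemma mem_ind (P : set -> Prop) : (forall x, (forall y, y ∈ x -> P y) -> P x) -> forall x, P x.
Proof. intros H x; induction (mem_wf x); auto. Qed.

Lemma mem_irrefl x : ~ x ∈ x.
Proof. induction x using mem_ind; intro K; eapply H; eauto. Qed.

Lemma upair_inj a b c d : upair a b = upair c d -> (a = c /\ b = d) \/ (a = d /\ b = c).
Proof.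
  intro E.
  assert (H : forall z, (z = a \/ z = b) <-> (z = c \/ z = d)).
  { intro z; rewrite <- !mem_upair, E; tauto. }
  pose proof (proj1 (H a)); pose proof (proj1 (H b)); pose proof (proj2 (H c)); pose proof (proj2 (H d)).
  intuition congruence.
Qed.

Lemma opair_inj a b c d : opair a b = opair c d -> a = c /\ b = d.
Proof.
  unfold opair; intro E; apply upair_inj in E; destruct E as [[E1 E2]|[E1 E2]];
    apply upair_inj in E1; apply upair_inj in E2; intuition congruence.
Qed.

(** * Derived set operations, projections and functions *)

Definition sing (a : set) : set := upair a a.
Definition cup (a b : set) : set := union (upair a b).
Definition succ (a : set) : set := cup a (sing a).
Definition bigU (a : set) (f : set -> set) : set := union (img a f).
Definition isect (a b : set) : set := sep a (fun x => x ∈ b).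
Definition prod (a b : set) : set := bigU a (fun x => img b (fun y => opair x y)).

Lemma mem_sing z a : z ∈ sing a <-> z = a.
Proof. unfold sing; rewrite mem_upair; tauto. Qed.

Lemma mem_cup z a b : z ∈ cup a b <-> z ∈ a \/ z ∈ b.
Proof.
  unfold cup; rewrite mem_union; split.
  - intros (y & H & K); apply mem_upair in H; destruct H; subst; auto.
  - intros [H|H]; [exists a|exists b]; rewrite mem_upair; auto.
Qed.

Lemma mem_succ z a : z ∈ succ a <-> z ∈ a \/ z = a.
Proof. unfold succ; rewrite mem_cup, mem_sing; tauto. Qed.

Lemma mem_bigU z a f : z ∈ bigU a f <-> exists x, x ∈ a /\ z ∈ f x.
Proof.
  unfold bigU; rewrite mem_union; split.
  - intros (y & H & K); apply mem_img in H; destruct H as (x & H & ->); eauto.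
  - intros (x & H & K); exists (f x); split; auto; apply mem_img; eauto.
Qed.

Lemma mem_isect z a b : z ∈ isect a b <-> z ∈ a /\ z ∈ b.
Proof. exact (mem_sep z a (fun x => x ∈ b)). Qed.

Lemma mem_prod z a b : z ∈ prod a b <-> exists x y, x ∈ a /\ y ∈ b /\ z = opair x y.
Proof.
  unfold prod; rewrite mem_bigU; split.
  - intros (x & H & K); apply mem_img in K; destruct K as (y & K & ->); eauto 6.
  - intros (x & y & H & K & ->); exists x; split; auto; apply mem_img; eauto.
Qed.

Lemma mem_prod_opair a b x y : opair x y ∈ prod a b <-> x ∈ a /\ y ∈ b.
Proof.
  rewrite mem_prod; split.
  - intros (x' & y' & H & K & E); apply opair_inj in E; destruct E; subst; auto.
  - intros []; eauto 6.
Qed.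

Lemma sep_ext a P Q : (forall x, x ∈ a -> (P x <-> Q x)) -> sep a P = sep a Q.
Proof. intro H; apply set_ext; intro z; rewrite !mem_sep; firstorder. Qed.

Lemma img_ext a f g : (forall x, x ∈ a -> f x = g x) -> img a f = img a g.
Proof.
  intro H; apply set_ext; intro z; rewrite !mem_img; split; intros (y & Hy & ->); exists y;
    split; auto; rewrite H; auto.
Qed.

Lemma sub_antisym x y : sub x y -> sub y x -> x = y.
Proof. intros H K; apply set_ext; split; auto. Qed.

Lemma isect_eq a b : sub a b -> isect a b = a.
Proof. intro H; apply set_ext; intro z; rewrite mem_isect; firstorder. Qed.

(* [fst w] and [snd w] are [emp] when [w] is not a pair. *)
Definition fst (w : set) : set :=
  union (sep (union w) (fun x => exists y, y ∈ union w /\ w = opair x y)).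
Definition snd (w : set) : set :=
  union (sep (union w) (fun y => exists x, x ∈ union w /\ w = opair x y)).

Lemma union_opair x y : union (opair x y) = upair x y.
Proof.
  apply set_ext; intro z; unfold opair; rewrite mem_union, mem_upair; split.
  - intros (u & Hu & Hz); apply mem_upair in Hu; destruct Hu; subst; apply mem_upair in Hz; tauto.
  - intro H; exists (upair x y); rewrite !mem_upair; auto.
Qed.

Lemma fst_opair x y : fst (opair x y) = x.
Proof.
  unfold fst; apply set_ext; intro z; rewrite mem_union; split.
  - intros (u & Hu & Hz); apply mem_sep in Hu; destruct Hu as (_ & v & _ & E).
    apply opair_inj in E; destruct E; subst; auto.
  - intro Hz; exists x; split; auto; rewrite union_opair; apply mem_sep; rewrite mem_upair.
    split; auto; exists y; rewrite mem_upair; auto.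
Qed.

Lemma snd_opair x y : snd (opair x y) = y.
Proof.
  unfold snd; apply set_ext; intro z; rewrite mem_union; split.
  - intros (u & Hu & Hz); apply mem_sep in Hu; destruct Hu as (_ & v & _ & E).
    apply opair_inj in E; destruct E; subst; auto.
  - intro Hz; exists y; split; auto; rewrite union_opair; apply mem_sep; rewrite mem_upair.
    split; auto; exists x; rewrite mem_upair; auto.
Qed.

(** The union of all values of [f] at [x]: the value itself where [f] is single-valued, [emp] where
    it has none. Being total, it needs no side condition in definability proofs. *)
Definition app (f x : set) : set :=
  union (sep (union (union f)) (fun v => opair x v ∈ f)).

Lemma mem_UU_l x y f : opair x y ∈ f -> x ∈ union (union f).
Proof.
  intro H; apply mem_union; exists (upair x y); rewrite mem_upair; split; auto.
  apply mem_union; exists (opair x y); split; auto; apply mem_upair; auto.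
Qed.

Lemma mem_UU_r x y f : opair x y ∈ f -> y ∈ union (union f).
Proof.
  intro H; apply mem_union; exists (upair x y); rewrite mem_upair; split; auto.
  apply mem_union; exists (opair x y); split; auto; apply mem_upair; auto.
Qed.

Lemma app_fun f x v :
  opair x v ∈ f -> (forall w, opair x w ∈ f -> w = v) -> app f x = v.
Proof.
  intros H K; unfold app; apply set_ext; intro z; rewrite mem_union; split.
  - intros (u & Hu & Hz); apply mem_sep in Hu; destruct Hu as [_ Hu]; rewrite <- (K _ Hu); auto.
  - intro Hz; exists v; split; auto; apply mem_sep; split; auto; eapply mem_UU_r; eauto.
Qed.

Definition graph (a : set) (f : set -> set) : set := img a (fun x => opair x (f x)).

Lemma mem_graph a f x y : opair x y ∈ graph a f <-> x ∈ a /\ y = f x.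
Proof.
  unfold graph; rewrite mem_img; split.
  - intros (u & Hu & E); apply opair_inj in E; destruct E; subst; auto.
  - intros [H ->]; eauto.
Qed.

Lemma app_graph a f x : x ∈ a -> app (graph a f) x = f x.
Proof.
  intro H; apply app_fun; [apply mem_graph; auto|]; intros w Hw; apply mem_graph in Hw; tauto.
Qed.

(** * Ordinals *)

Definition trans (x : set) : Prop := forall y, y ∈ x -> forall z, z ∈ y -> z ∈ x.
Definition ord (x : set) : Prop := trans x /\ forall y, y ∈ x -> trans y.

Lemma ord_mem x y : ord x -> y ∈ x -> ord y.
Proof.
  intros [H K] Hy; split; auto; intros z Hz; apply K; eapply H; eauto.
Qed.

Lemma ord_trans a x y : ord a -> x ∈ y -> y ∈ a -> x ∈ a.
Proof. intros [H _] Hx Hy; eapply H; eauto. Qed.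

(** Nested induction: if [a] is not included in [b], some [c] in [a] lies outside [b], and comparing
    [c] with [b] leaves only cases that put [b] in [a]. *)
Lemma ord_total a b : ord a -> ord b -> a ∈ b \/ a = b \/ b ∈ a.
Proof.
  revert b; induction a as [a IHa] using mem_ind.
  induction b as [b IHb] using mem_ind; intros Ha Hb.
  destruct (classic (sub a b)) as [S1|S1].
  - destruct (classic (sub b a)) as [S2|S2]; [right; left; apply sub_antisym; auto|].
    apply not_all_ex_not in S2; destruct S2 as [c Hc]; apply imply_to_and in Hc; destruct Hc as [Hc Nc].
    left; destruct (IHb c Hc Ha (ord_mem _ _ Hb Hc)) as [H|[H|H]].
    + eapply ord_trans; eauto.
    + subst; auto.
    + tauto.
  - apply not_all_ex_not in S1; destruct S1 as [c Hc]; apply imply_to_and in Hc; destruct Hc as [Hc Nc].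
    right; right; destruct (IHa c Hc b (ord_mem _ _ Ha Hc) Hb) as [H|[H|H]].
    + tauto.
    + subst; auto.
    + eapply ord_trans; eauto.
Qed.

Lemma wf_min {T : Type} (R : T -> T -> Prop) (P : T -> Prop) x :
  Acc R x -> P x -> exists m, P m /\ forall y, R y m -> ~ P y.
Proof.
  induction 1 as [x _ IH]; intro Hx.
  destruct (classic (exists y, R y x /\ P y)) as [(y & Hy & Py)|K]; [eauto|].
  exists x; split; auto; intros y Hy Py; apply K; eauto.
Qed.

Lemma ord_least (P : set -> Prop) x : ord x -> P x ->
  exists m, ord m /\ P m /\ (m = x \/ m ∈ x) /\ forall y, y ∈ m -> ~ P y.
Proof.
  intros Hx Px.
  destruct (wf_min mem (fun m => P m /\ (m = x \/ m ∈ x)) x (mem_wf x)) as (m & [Pm Hm] & K); auto.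
  exists m; split; [destruct Hm; subst; auto; eapply ord_mem; eauto|]; repeat split; auto.
  intros y Hy Py; apply (K y Hy); split; auto; right.
  destruct Hm as [->|Hm]; auto; eapply ord_trans; eauto.
Qed.

Lemma ord_succ a : ord a -> ord (succ a).
Proof.
  intros [H K]; split.
  - intros y Hy z Hz; rewrite mem_succ in *; destruct Hy as [Hy|Hy]; subst; left; auto; eapply H; eauto.
  - intros y Hy; apply mem_succ in Hy; destruct Hy; subst; auto.
Qed.

Lemma ord_union a : (forall x, x ∈ a -> ord x) -> ord (union a).
Proof.
  intro H; split.
  - intros y Hy z Hz; apply mem_union in Hy; destruct Hy as (x & Hx & Hy); apply mem_union.
    exists x; split; auto; exact (proj1 (H x Hx) y Hy z Hz).
  - intros y Hy; apply mem_union in Hy; destruct Hy as (x & Hx & Hy); exact (proj2 (H x Hx) y Hy).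
Qed.

Lemma ord_bigU a f : (forall x, x ∈ a -> ord (f x)) -> ord (bigU a f).
Proof.
  intro H; apply ord_union; intros x Hx; apply mem_img in Hx; destruct Hx as (y & Hy & ->); auto.
Qed.

Lemma ord_cup a b : ord a -> ord b -> ord (cup a b).
Proof. intros; apply ord_union; intros x Hx; apply mem_upair in Hx; destruct Hx; subst; auto. Qed.

Lemma ord_emp : ord emp.
Proof. split; intros y Hy; destruct (mem_emp _ Hy). Qed.

Lemma ord_sub a b : ord a -> ord b -> sub a b -> a = b \/ a ∈ b.
Proof.
  intros Ha Hb S; destruct (ord_total a b Ha Hb) as [H|[H|H]]; auto.
  destruct (mem_irrefl _ (S _ H)).
Qed.

Fixpoint num (n : nat) : set := match n with 0 => emp | S n => succ (num n) end.
Definition omega : set := setof nat num.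

Lemma mem_omega z : z ∈ omega <-> exists n, z = num n.
Proof. apply mem_setof. Qed.

Lemma num_omega n : num n ∈ omega.
Proof. apply mem_omega; eauto. Qed.

Lemma ord_num n : ord (num n).
Proof. induction n; simpl; auto using ord_emp, ord_succ. Qed.

Lemma num_mem n m : n < m -> num n ∈ num m.
Proof. induction 1; simpl; apply mem_succ; auto. Qed.

Lemma mem_num z m : z ∈ num m -> exists n, n < m /\ z = num n.
Proof.
  induction m; simpl; intro H; [destruct (mem_emp _ H)|].
  apply mem_succ in H; destruct H as [H| ->]; [destruct (IHm H) as (n & ? & ?)|]; eauto.
Qed.

Lemma num_inj n m : num n = num m -> n = m.
Proof.
  intro E; destruct (Nat.lt_trichotomy n m) as [H|[H|H]]; auto; apply num_mem in H; rewrite E in H;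
    destruct (mem_irrefl _ H).
Qed.

Lemma ord_omega : ord omega.
Proof.
  split.
  - intros y Hy z Hz; apply mem_omega in Hy; destruct Hy as [n ->]; apply mem_num in Hz.
    destruct Hz as (m & _ & ->); apply num_omega.
  - intros y Hy; apply mem_omega in Hy; destruct Hy as [n ->]; apply ord_num.
Qed.

(** An ordinal that is, together with all its elements, zero or a successor. Its quantifiers are
    bounded, so a transitive model evaluates it correctly and can separate [omega] from an inductive
    set. *)
Definition isnat (z : set) : Prop :=
  ord z /\ forall u, u ∈ succ z -> u = emp \/ exists v, v ∈ u /\ u = succ v.

Lemma isnat_omega z : isnat z <-> z ∈ omega.
Proof.
  split.
  - induction z as [z IH] using mem_ind; intros [Oz H].
    destruct (H z) as [-> | (v & Hv & E)]; [apply mem_succ; auto|apply (num_omega 0)|].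
    assert (K : v ∈ omega).
    { apply IH; auto; split; [eapply ord_mem; eauto|]; intros u Hu; apply H.
      rewrite E; apply mem_succ; auto. }
    apply mem_omega in K; destruct K as [n ->]; rewrite E; apply (num_omega (S n)).
  - intro H; apply mem_omega in H; destruct H as [n ->]; split; [apply ord_num|].
    intros u Hu; apply (mem_num u (S n)) in Hu; destruct Hu as ([|m] & _ & ->); auto; right.
    exists (num m); split; auto; apply num_mem; lia.
Qed.

Lemma succ_omega z : z ∈ omega -> succ z ∈ omega.
Proof. intro H; apply mem_omega in H; destruct H as [n ->]; apply (num_omega (S n)). Qed.

Definition ite (P : Prop) (a b : set) : set := if excluded_middle_informative P then a else b.

Lemma ite_T (P : Prop) a b : P -> ite P a b = a.
Proof. unfold ite; destruct excluded_middle_informative; tauto. Qed.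
Lemma ite_F (P : Prop) a b : ~ P -> ite P a b = b.
Proof. unfold ite; destruct excluded_middle_informative; tauto. Qed.

(* The unique [H] with [H x = G x {(y, H y) : y ∈ x}]. *)
Definition mrec (G : set -> set -> set) : set -> set :=
  Fix mem_wf (fun _ => set) (fun x rec =>
    G x (graph x (fun y => match excluded_middle_informative (y ∈ x) with
                           | left h => rec y h | right _ => emp end))).

Lemma mrec_eq G x : mrec G x = G x (graph x (mrec G)).
Proof.
  unfold mrec at 1; rewrite Fix_eq.
  - f_equal; apply img_ext; intros y Hy; destruct excluded_middle_informative; tauto.
  - intros y f g E; f_equal; apply img_ext; intros z Hz; destruct excluded_middle_informative; auto.
    rewrite E; auto.
Qed.


(** * Satisfaction *)

Definition env : Type := nat -> set.

Fixpoint Sat (M X : set) (e c : env) (p : form) : Prop :=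
  match p with
  | fEq x y => e x = e y
  | fMem x y => e x ∈ e y
  | fCEq A B => c A = c B
  | fCMem x A => e x ∈ c A
  | fBot => False
  | fAnd p q => Sat M X e c p /\ Sat M X e c q
  | fOr p q => Sat M X e c p \/ Sat M X e c q
  | fImp p q => Sat M X e c p -> Sat M X e c q
  | fAll p => forall x, x ∈ M -> Sat M X (scons x e) c p
  | fEx p => exists x, x ∈ M /\ Sat M X (scons x e) c p
  | fCAll p => forall A, A ∈ X -> Sat M X e (scons A c) p
  | fCEx p => exists A, A ∈ X /\ Sat M X e (scons A c) p
  end.

Lemma scons_map {A B : Type} (f : A -> B) x e :
  (fun i => f (scons x e i)) = scons (f x) (fun i => f (e i)).
Proof. apply functional_extensionality; intros [|i]; reflexivity. Qed.

Lemma scons_eta {A : Type} (e : nat -> A) : scons (e 0) (fun i => e (S i)) = e.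
Proof. apply functional_extensionality; intros [|i]; reflexivity. Qed.

Lemma sat_Sat M X p : forall e c,
  sat M X e c p <-> Sat (mk M) (mk X) (fun i => mk (e i)) (fun i => mk (c i)) p.
Proof.
  induction p; intros e c; simpl.
  - rewrite mk_eq; tauto.
  - rewrite mem_mk; tauto.
  - rewrite mk_eq; tauto.
  - rewrite mem_mk; tauto.
  - tauto.
  - rewrite IHp1, IHp2; tauto.
  - rewrite IHp1, IHp2; tauto.
  - rewrite IHp1, IHp2; tauto.
  - split; intros H x Hx.
    + apply mem_mk_ex in Hx; destruct Hx as (y & Hy & ->).
      specialize (H y Hy); apply IHp in H; rewrite scons_map in H; exact H.
    + apply IHp; rewrite scons_map; apply H, mem_mk, Hx.
  - split; intros (x & Hx & H).
    + exists (mk x); split; [apply mem_mk; auto|]; apply IHp in H; rewrite scons_map in H; exact H.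
    + apply mem_mk_ex in Hx; destruct Hx as (y & Hy & ->); exists y; split; auto.
      apply IHp; rewrite scons_map; exact H.
  - split; intros H x Hx.
    + apply mem_mk_ex in Hx; destruct Hx as (y & Hy & ->).
      specialize (H y Hy); apply IHp in H; rewrite scons_map in H; exact H.
    + apply IHp; rewrite scons_map; apply H, mem_mk, Hx.
  - split; intros (x & Hx & H).
    + exists (mk x); split; [apply mem_mk; auto|]; apply IHp in H; rewrite scons_map in H; exact H.
    + apply mem_mk_ex in Hx; destruct Hx as (y & Hy & ->); exists y; split; auto.
      apply IHp; rewrite scons_map; exact H.
Qed.

Lemma up_scons (x : set) e s : (fun i => scons x e (up s i)) = scons x (fun i => e (s i)).
Proof. apply functional_extensionality; intros [|i]; reflexivity. Qed.

Lemma Sat_ren M X p : forall s k e c,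
  Sat M X e c (ren s k p) <-> Sat M X (fun i => e (s i)) (fun i => c (k i)) p.
Proof.
  induction p; intros s k e c; simpl; try tauto;
    try (rewrite IHp1, IHp2; tauto).
  - assert (E : forall x, Sat M X (scons x e) c (ren (up s) k p) <->
      Sat M X (scons x (fun i => e (s i))) (fun i => c (k i)) p) by (intro; rewrite IHp, up_scons; tauto).
    split; intros H x Hx; apply E; auto.
  - assert (E : forall x, Sat M X (scons x e) c (ren (up s) k p) <->
      Sat M X (scons x (fun i => e (s i))) (fun i => c (k i)) p) by (intro; rewrite IHp, up_scons; tauto).
    split; intros (x & Hx & H); exists x; split; auto; apply E; auto.
  - assert (E : forall x, Sat M X e (scons x c) (ren s (up k) p) <->
      Sat M X (fun i => e (s i)) (scons x (fun i => c (k i))) p) by (intro; rewrite IHp, up_scons; tauto).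
    split; intros H x Hx; apply E; auto.
  - assert (E : forall x, Sat M X e (scons x c) (ren s (up k) p) <->
      Sat M X (fun i => e (s i)) (scons x (fun i => c (k i))) p) by (intro; rewrite IHp, up_scons; tauto).
    split; intros (x & Hx & H); exists x; split; auto; apply E; auto.
Qed.

Lemma elementary_ren p : forall s k, elementary (ren s k p) = elementary p.
Proof. induction p; intros; simpl; congruence. Qed.

Lemma Sat_elem M X X' p : elementary p = true -> forall e c,
  Sat M X e c p <-> Sat M X' e c p.
Proof.
  induction p; simpl; intros E e c; try tauto; try discriminate;
    try (apply andb_prop in E; destruct E; rewrite IHp1, IHp2 by auto; tauto).
  - split; intros H x Hx; apply IHp; auto.
  - split; intros (x & Hx & H); exists x; split; auto; apply IHp; auto.
Qed.

Definition esat (D : set) (e c : env) (p : form) : Prop := Sat D emp e c p.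

Lemma Sat_esat M X p e c : elementary p = true -> (Sat M X e c p <-> esat M e c p).
Proof. intro; apply Sat_elem; auto. Qed.

Lemma Sat_bounded M X p : forall n m e e' c c', bounded n m p = true ->
  (forall i, i < n -> e i = e' i) -> (forall i, i < m -> c i = c' i) ->
  (Sat M X e c p <-> Sat M X e' c' p).
Proof.
  induction p; intros n m e e' c c' B He Hc; simpl in *;
    try (apply andb_prop in B; destruct B as [B1 B2]);
    try (apply Nat.ltb_lt in B1); try (apply Nat.ltb_lt in B2);
    try (rewrite He, He by auto; tauto); try (rewrite Hc, Hc by auto; tauto);
    try (rewrite He, Hc by auto; tauto); try tauto;
    try (rewrite (IHp1 n m e e' c c'), (IHp2 n m e e' c c') by auto; tauto).
  - assert (Q : forall x, Sat M X (scons x e) c p <-> Sat M X (scons x e') c' p)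
      by (intro; apply (IHp (S n) m); auto; intros [|i]; simpl; auto; intro; apply He; lia).
    split; intros H x Hx; apply Q; auto.
  - assert (Q : forall x, Sat M X (scons x e) c p <-> Sat M X (scons x e') c' p)
      by (intro; apply (IHp (S n) m); auto; intros [|i]; simpl; auto; intro; apply He; lia).
    split; intros (x & Hx & H); exists x; split; auto; apply Q; auto.
  - assert (Q : forall x, Sat M X e (scons x c) p <-> Sat M X e' (scons x c') p)
      by (intro; apply (IHp n (S m)); auto; intros [|i]; simpl; auto; intro; apply Hc; lia).
    split; intros H x Hx; apply Q; auto.
  - assert (Q : forall x, Sat M X e (scons x c) p <-> Sat M X e' (scons x c') p)
      by (intro; apply (IHp n (S m)); auto; intros [|i]; simpl; auto; intro; apply Hc; lia).
    split; intros (x & Hx & H); exists x; split; auto; apply Q; auto.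
Qed.

Lemma bounded_mono p : forall n m n' m', n <= n' -> m <= m' ->
  bounded n m p = true -> bounded n' m' p = true.
Proof.
  induction p; intros n m n' m' Hn Hm B; simpl in *;
    try (apply andb_prop in B; destruct B as [B1 B2]; apply andb_true_intro; split);
    try (apply Nat.ltb_lt in B1; apply Nat.ltb_lt; lia);
    try (apply Nat.ltb_lt in B2; apply Nat.ltb_lt; lia); eauto;
    eapply IHp; try exact B; lia.
Qed.

Lemma bounded_ex p : exists n m, bounded n m p = true.
Proof.
  induction p; simpl;
    try (destruct IHp1 as (n1 & m1 & H1), IHp2 as (n2 & m2 & H2); exists (n1 + n2), (m1 + m2);
         apply andb_true_intro; split;
         [apply (bounded_mono _ n1 m1)|apply (bounded_mono _ n2 m2)]; auto; lia).
  - exists (S (x + y)), 0; apply andb_true_intro; split; apply Nat.ltb_lt; lia.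
  - exists (S (x + y)), 0; apply andb_true_intro; split; apply Nat.ltb_lt; lia.
  - exists 0, (S (X + Y)); apply andb_true_intro; split; apply Nat.ltb_lt; lia.
  - exists (S x), (S X); apply andb_true_intro; split; apply Nat.ltb_lt; lia.
  - exists 0, 0; auto.
  - destruct IHp as (n & m & H); exists n, m; apply (bounded_mono p n m); auto.
  - destruct IHp as (n & m & H); exists n, m; apply (bounded_mono p n m); auto.
  - destruct IHp as (n & m & H); exists n, m; apply (bounded_mono p n m); auto.
  - destruct IHp as (n & m & H); exists n, m; apply (bounded_mono p n m); auto.
Qed.

Lemma bounded_ren p : forall n m n' m' s k, bounded n m p = true ->
  (forall i, i < n -> s i < n') -> (forall i, i < m -> k i < m') ->
  bounded n' m' (ren s k p) = true.
Proof.
  assert (U : forall (s : nat -> nat) n n', (forall i, i < n -> s i < n') ->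
    forall i, i < S n -> up s i < S n').
  { intros s n n' H [|i] Hi; simpl; [lia|]; specialize (H i); lia. }
  induction p; intros n m n' m' s k Bd Hs Hk; simpl in *;
    try (apply andb_prop in Bd; destruct Bd as [B1 B2]; apply andb_true_intro; split);
    try (apply Nat.ltb_lt; apply Nat.ltb_lt in B1; auto; fail);
    try (apply Nat.ltb_lt; apply Nat.ltb_lt in B2; auto; fail); eauto.
Qed.

(* Eliminating equality of classes makes satisfaction over [D] depend only on
   the traces of the classes on [D]. *)
Fixpoint noceq (p : form) : form :=
  match p with
  | fCEq X Y => fAll (fAnd (fImp (fCMem 0 X) (fCMem 0 Y)) (fImp (fCMem 0 Y) (fCMem 0 X)))
  | fAnd p q => fAnd (noceq p) (noceq q)
  | fOr p q => fOr (noceq p) (noceq q)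
  | fImp p q => fImp (noceq p) (noceq q)
  | fAll p => fAll (noceq p)
  | fEx p => fEx (noceq p)
  | _ => p
  end.

Lemma elementary_noceq p : elementary p = true -> elementary (noceq p) = true.
Proof.
  induction p; simpl; auto; intro E; try (apply andb_prop in E; destruct E; apply andb_true_intro; auto).
Qed.

Lemma bounded_noceq p : forall n m, bounded n m p = true -> bounded n m (noceq p) = true.
Proof.
  induction p; simpl; auto; intros n m E; try (apply andb_prop in E; destruct E; apply andb_true_intro; auto).
  rewrite H, H0; auto.
Qed.

Lemma esat_noceq D p : elementary p = true -> forall e c, (forall i, sub (c i) D) ->
  (esat D e c (noceq p) <-> esat D e c p).
Proof.
  unfold esat; induction p; simpl; intros E e c Hc; try tauto; try discriminate;
    try (apply andb_prop in E; destruct E; rewrite IHp1, IHp2 by auto; tauto).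
  - split.
    + intro H; apply sub_antisym; intros z Hz; apply (H z); eauto; eapply Hc; eauto.
    + intros -> x Hx; tauto.
  - split; intros H x Hx; apply IHp; auto.
  - split; intros (x & Hx & H); exists x; split; auto; apply IHp; auto.
Qed.

Lemma esat_trace D p : elementary p = true -> forall e c c', (forall i, e i ∈ D) ->
  (forall i x, x ∈ D -> (x ∈ c i <-> x ∈ c' i)) ->
  (esat D e c (noceq p) <-> esat D e c' (noceq p)).
Proof.
  unfold esat; induction p; simpl; intros E e c c' He Hc; try tauto; try discriminate;
    try (apply andb_prop in E; destruct E; rewrite (IHp1 H e c c'), (IHp2 H0 e c c') by auto; tauto).
  - split; intros H x Hx; specialize (H x Hx); rewrite ?Hc in *; auto; rewrite <- ?Hc in *; auto.
  - apply Hc; auto.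
  - split; intros H x Hx; eapply IHp; try exact (H x Hx); auto; try (intros [|i]; simpl; auto);
      intros; symmetry; auto.
  - split; intros (x & Hx & H); exists x; split; auto; eapply IHp; try exact H; auto;
      try (intros [|i]; simpl; auto); intros; symmetry; auto.
Qed.

(** Class parameters that are elements of the structure can be read as set parameters: class
    variable [j] becomes set variable [k j]. Only elementary formulas matter, so class quantifiers
    may go to [fBot]. *)
Fixpoint setvars (s k : nat -> nat) (p : form) : form :=
  match p with
  | fEq x y => fEq (s x) (s y)
  | fMem x y => fMem (s x) (s y)
  | fCEq X Y => fEq (k X) (k Y)
  | fCMem x X => fMem (s x) (k X)
  | fAnd p q => fAnd (setvars s k p) (setvars s k q)
  | fOr p q => fOr (setvars s k p) (setvars s k q)
  | fImp p q => fImp (setvars s k p) (setvars s k q)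
  | fAll p => fAll (setvars (up s) (fun i => S (k i)) p)
  | fEx p => fEx (setvars (up s) (fun i => S (k i)) p)
  | _ => fBot
  end.

Lemma esat_setvars D p : elementary p = true -> forall s k e c,
  esat D e c (setvars s k p) <-> esat D (fun i => e (s i)) (fun i => e (k i)) p.
Proof.
  unfold esat; induction p; simpl; intros E s k e c; try tauto; try discriminate;
    try (apply andb_prop in E; destruct E; rewrite IHp1, IHp2 by auto; tauto).
  - assert (Q : forall x, Sat D emp (scons x e) c (setvars (up s) (fun i => S (k i)) p) <->
      Sat D emp (scons x (fun i => e (s i))) (fun i => e (k i)) p)
      by (intro; rewrite IHp, up_scons by auto; tauto).
    split; intros H x Hx; apply Q; auto.
  - assert (Q : forall x, Sat D emp (scons x e) c (setvars (up s) (fun i => S (k i)) p) <->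
      Sat D emp (scons x (fun i => e (s i))) (fun i => e (k i)) p)
      by (intro; rewrite IHp, up_scons by auto; tauto).
    split; intros (x & Hx & H); exists x; split; auto; apply Q; auto.
Qed.

Lemma elementary_setvars p : forall s k, elementary (setvars s k p) = true.
Proof. induction p; simpl; intros; auto; apply andb_true_intro; auto. Qed.

Lemma bounded_setvars p : forall s k, exists n, bounded n 0 (setvars s k p) = true.
Proof.
  induction p; simpl; intros s k;
    try (destruct (IHp1 s k) as (n1 & H1), (IHp2 s k) as (n2 & H2); exists (n1 + n2);
         apply andb_true_intro; split;
         [apply (bounded_mono _ n1 0)|apply (bounded_mono _ n2 0)]; auto; lia);
    try (destruct (IHp (up s) (fun i => S (k i))) as (n & H); exists n; apply (bounded_mono _ n 0); auto);
    try (exists 0; reflexivity).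
  - exists (S (s x + s y)); apply andb_true_intro; split; apply Nat.ltb_lt; lia.
  - exists (S (s x + s y)); apply andb_true_intro; split; apply Nat.ltb_lt; lia.
  - exists (S (k X + k Y)); apply andb_true_intro; split; apply Nat.ltb_lt; lia.
  - exists (S (s x + k X)); apply andb_true_intro; split; apply Nat.ltb_lt; lia.
Qed.

(** * Soundness *)

Definition holds (M X : set) (p : form) : Prop :=
  forall e c, (forall i, e i ∈ M) -> (forall i, c i ∈ X) -> Sat M X e c p.

Lemma scons_in (M x : set) (e : env) : x ∈ M -> (forall i, e i ∈ M) -> forall i, scons x e i ∈ M.
Proof. intros Hx He [|i]; simpl; auto. Qed.

Lemma Sat_shift M X e c x p : Sat M X (scons x e) c (shift p) <-> Sat M X e c p.
Proof. unfold shift; rewrite Sat_ren; reflexivity. Qed.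
Lemma Sat_cshift M X e c x p : Sat M X e (scons x c) (cshift p) <-> Sat M X e c p.
Proof. unfold cshift; rewrite Sat_ren; reflexivity. Qed.
Lemma Sat_inst M X e c x p : Sat M X e c (inst x p) <-> Sat M X (scons (e x) e) c p.
Proof. unfold inst; rewrite Sat_ren, scons_map; reflexivity. Qed.
Lemma Sat_cinst M X e c x p : Sat M X e c (cinst x p) <-> Sat M X e (scons (c x) c) p.
Proof. unfold cinst; rewrite Sat_ren, scons_map; reflexivity. Qed.

(** Provability enters the semantic argument here: what GB proves of Γ becomes true in each model.
    Axioms are valid under all assignments, in accordance with their reading as universal
    closures. *)
Lemma soundness M X T G p : proves T G p -> (forall q, T q -> holds M X q) ->
  forall e c, (forall i, e i ∈ M) -> (forall i, c i ∈ X) ->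
  (forall q, In q G -> Sat M X e c q) -> Sat M X e c p.
Proof.
  intros H HT; induction H; intros e c He Hc HG.
  - apply HT; auto.
  - auto.
  - apply NNPP; intro K; apply (IHproves e c He Hc); intros q [<-|Hq]; auto.
  - split; auto.
  - apply (IHproves e c He Hc HG).
  - apply (IHproves e c He Hc HG).
  - left; auto.
  - right; auto.
  - destruct (IHproves1 e c He Hc HG) as [K|K]; [apply IHproves2|apply IHproves3]; auto;
      intros s [<-|Hs]; auto.
  - intro K; apply IHproves; auto; intros s [<-|Hs]; auto.
  - specialize (IHproves1 e c He Hc HG); specialize (IHproves2 e c He Hc HG); simpl in *; auto.
  - intros x Hx; apply IHproves; auto using scons_in; intros q Hq.
    apply in_map_iff in Hq; destruct Hq as (q' & <- & Hq); apply Sat_shift; auto.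
  - apply Sat_inst; apply (IHproves e c He Hc HG); auto.
  - exists (e x); split; auto; apply Sat_inst; auto.
  - destruct (IHproves1 e c He Hc HG) as (x & Hx & K).
    apply (Sat_shift M X e c x); apply IHproves2; auto using scons_in; intros r [<-|Hr]; auto.
    apply in_map_iff in Hr; destruct Hr as (r' & <- & Hr); apply Sat_shift; auto.
  - intros x Hx; apply IHproves; auto using scons_in; intros q Hq.
    apply in_map_iff in Hq; destruct Hq as (q' & <- & Hq); apply Sat_cshift; auto.
  - apply Sat_cinst; apply (IHproves e c He Hc HG); auto.
  - exists (c X0); split; auto; apply Sat_cinst; auto.
  - destruct (IHproves1 e c He Hc HG) as (x & Hx & K).
    apply (Sat_cshift M X e c x); apply IHproves2; auto using scons_in; intros r [<-|Hr]; auto.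
    apply in_map_iff in Hr; destruct Hr as (r' & <- & Hr); apply Sat_cshift; auto.
  - reflexivity.
  - specialize (IHproves1 e c He Hc HG); specialize (IHproves2 e c He Hc HG); simpl in IHproves1.
    apply Sat_inst; apply Sat_inst in IHproves2; rewrite <- IHproves1; auto.
  - reflexivity.
  - specialize (IHproves1 e c He Hc HG); specialize (IHproves2 e c He Hc HG); simpl in IHproves1.
    apply Sat_cinst; apply Sat_cinst in IHproves2; rewrite <- IHproves1; auto.
Qed.


(** * Definability over a structure *)

Notation inN N e := (forall i : nat, e i ∈ N).

(* Predicates on environments that are elementary over [N] with class
   parameters from [Y]; quantifiers over [N] are read off from the shape
   [forall x, x ∈ N -> _] of the predicate. *)
Definition DfP (N : set) (Y : set -> Prop) (P : env -> Prop) : Prop :=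
  exists p c, elementary p = true /\ (forall i, Y (c i)) /\
    forall e, inN N e -> (esat N e c p <-> P e).

(** A term is definable through its graph: variable 0 carries the value and the arguments are
    shifted by one. *)
Definition DfF (N : set) (Y : set -> Prop) (t : env -> set) : Prop :=
  (forall e, inN N e -> t e ∈ N) /\ DfP N Y (fun e => e 0 = t (fun i => e (S i))).

(** Much less than a model of GB, so that the closure lemmas also apply to a single level of [L]
    with its own elements as classes. *)
Class Str (N : set) (Y : set -> Prop) : Prop :=
  { str_trans : trans N; str_inh : exists A, Y A }.

Section Definability.
Variables (N : set) (Y : set -> Prop).
Notation dfP := (DfP N Y).
Notation dfF := (DfF N Y).

Lemma df_ext P Q : (forall e, inN N e -> (P e <-> Q e)) -> dfP P -> dfP Q.
Proof.
  intros H (p & c & E & Hc & K); exists p, c; repeat split; auto;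
    intros; [apply H, K|apply K, H]; auto.
Qed.

(** Two class assignments are interleaved on even and odd indices, so that two formulas can be
    evaluated under a common one. *)
Definition cmix (c d : env) : env := fun i => if Nat.odd i then d (Nat.div2 i) else c (Nat.div2 i).

Lemma cmix_even c d i : cmix c d (2 * i) = c i.
Proof. unfold cmix; rewrite Nat.odd_even, Nat.div2_double; auto. Qed.
Lemma cmix_odd c d i : cmix c d (S (2 * i)) = d i.
Proof.
  unfold cmix; rewrite Nat.odd_succ, Nat.even_even, Nat.div2_succ_double; auto.
Qed.

Lemma df_two P Q : dfP P -> dfP Q -> exists p q c,
  elementary p = true /\ elementary q = true /\ (forall i, Y (c i)) /\
  forall e, inN N e -> (esat N e c p <-> P e) /\ (esat N e c q <-> Q e).
Proof.
  intros (p & c & Ep & Hc & Hp) (q & d & Eq & Hd & Hq).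
  exists (ren idn (fun i => 2 * i) p), (ren idn (fun i => S (2 * i)) q), (cmix c d).
  rewrite !elementary_ren; do 2 (split; [assumption|]); split.
  - intro i; unfold cmix; destruct Nat.odd; auto.
  - intros e He; rewrite <- (Hp e He), <- (Hq e He); unfold esat; rewrite !Sat_ren.
    replace (fun i => cmix c d (2 * i)) with c
      by (apply functional_extensionality; intro; rewrite cmix_even; auto).
    replace (fun i => cmix c d (S (2 * i))) with d
      by (apply functional_extensionality; intro; rewrite cmix_odd; auto).
    split; reflexivity.
Qed.

Lemma df_and P Q : dfP P -> dfP Q -> dfP (fun e => P e /\ Q e).
Proof.
  intros HP HQ; destruct (df_two P Q HP HQ) as (p & q & c & Ep & Eq & Hc & H).
  exists (fAnd p q), c; simpl; rewrite Ep, Eq; split; [auto|split; [auto|]].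
  intros e He; destruct (H e He); unfold esat in *; simpl; tauto.
Qed.
Lemma df_or P Q : dfP P -> dfP Q -> dfP (fun e => P e \/ Q e).
Proof.
  intros HP HQ; destruct (df_two P Q HP HQ) as (p & q & c & Ep & Eq & Hc & H).
  exists (fOr p q), c; simpl; rewrite Ep, Eq; split; [auto|split; [auto|]].
  intros e He; destruct (H e He); unfold esat in *; simpl; tauto.
Qed.
Lemma df_imp P Q : dfP P -> dfP Q -> dfP (fun e => P e -> Q e).
Proof.
  intros HP HQ; destruct (df_two P Q HP HQ) as (p & q & c & Ep & Eq & Hc & H).
  exists (fImp p q), c; simpl; rewrite Ep, Eq; split; [auto|split; [auto|]].
  intros e He; destruct (H e He); unfold esat in *; simpl; tauto.
Qed.
Lemma df_iff P Q : dfP P -> dfP Q -> dfP (fun e => P e <-> Q e).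
Proof. intros; apply df_and; apply df_imp; auto. Qed.
Lemma df_not P : dfP P -> dfP (fun e => ~ P e).
Proof.
  intros (p & c & E & Hc & K); exists (fImp p fBot), c; simpl; rewrite E; split; [auto|split; [auto|]].
  intros e He; specialize (K e He); unfold esat in *; simpl; tauto.
Qed.
Lemma df_ren P s : dfP P -> dfP (fun e => P (fun i => e (s i))).
Proof.
  intros (p & c & E & Hc & K); exists (ren s idn p), c; rewrite elementary_ren; split; [auto|split; [auto|]].
  intros e He; unfold esat; rewrite Sat_ren; apply (K (fun i => e (s i))); auto.
Qed.
Lemma df_all (Q : set -> env -> Prop) : dfP (fun e => Q (e 0) (fun i => e (S i))) ->
  dfP (fun e => forall x, x ∈ N -> Q x e).
Proof.
  intros (p & c & E & Hc & K); exists (fAll p), c; split; [auto|split; [auto|]].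
  intros e He; split; intros H x Hx.
  - apply (proj1 (K (scons x e) (scons_in N x e Hx He))), H, Hx.
  - apply (proj2 (K (scons x e) (scons_in N x e Hx He))), H, Hx.
Qed.
Lemma df_ex (Q : set -> env -> Prop) : dfP (fun e => Q (e 0) (fun i => e (S i))) ->
  dfP (fun e => exists x, x ∈ N /\ Q x e).
Proof.
  intros (p & c & E & Hc & K); exists (fEx p), c; split; [auto|split; [auto|]].
  intros e He; split; intros (x & Hx & H); exists x; split; auto.
  - apply (proj1 (K (scons x e) (scons_in N x e Hx He))), H.
  - apply (proj2 (K (scons x e) (scons_in N x e Hx He))), H.
Qed.

(** Substituting a term means quantifying existentially over its graph. The quantifier ranges over
    [N], which is why [DfF] asks for values in [N]. *)
Lemma df_sub (Q : set -> env -> Prop) t : dfP (fun e => Q (e 0) (fun i => e (S i))) -> dfF t ->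
  dfP (fun e => Q (t e) e).
Proof.
  intros HQ [C D].
  apply df_ext with (P := fun e => exists x, x ∈ N /\ (x = t e /\ Q x e)).
  - intros e He; split; [intros (x & _ & -> & H); auto|]; intro; exists (t e); auto.
  - apply (df_ex (fun x e => x = t e /\ Q x e)), df_and; auto.
Qed.

Lemma dfF_ren t s : dfF t -> dfF (fun e => t (fun i => e (s i))).
Proof.
  intros [C D]; split; [intros; apply C; auto|].
  exact (df_ren _ (fun i => match i with 0 => 0 | S i => S (s i) end) D).
Qed.

Lemma df_rel1 (R : set -> Prop) t : dfP (fun e => R (e 0)) -> dfF t -> dfP (fun e => R (t e)).
Proof. intros H Ht; apply (df_sub (fun x e => R x)); auto. Qed.
Lemma df_rel2 (R : set -> set -> Prop) t u : dfP (fun e => R (e 0) (e 1)) -> dfF t -> dfF u ->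
  dfP (fun e => R (t e) (u e)).
Proof.
  intros H Ht Hu; apply (df_sub (fun x e => R x (u e))); auto.
  apply (df_sub (fun y e => R (e 0) y) (fun e => u (fun i => e (S i)))).
  - exact (df_ren _ (fun i => match i with 0 => 1 | 1 => 0 | S i => S i end) H).
  - exact (dfF_ren _ S Hu).
Qed.
Lemma df_rel3 (R : set -> set -> set -> Prop) t u v : dfP (fun e => R (e 0) (e 1) (e 2)) ->
  dfF t -> dfF u -> dfF v -> dfP (fun e => R (t e) (u e) (v e)).
Proof.
  intros H Ht Hu Hv; apply (df_sub (fun x e => R x (u e) (v e))); auto.
  apply (df_sub (fun y e => R (e 0) y (v (fun i => e (S i)))) (fun e => u (fun i => e (S i)))).
  - apply (df_sub (fun z e => R (e 1) (e 0) z) (fun e => v (fun i => e (S (S i))))).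
    + exact (df_ren _ (fun i => match i with 0 => 2 | 1 => 1 | 2 => 0 | S i => S i end) H).
    + exact (dfF_ren _ (fun i => S (S i)) Hv).
  - exact (dfF_ren _ S Hu).
Qed.
Lemma df_rel4 (R : set -> set -> set -> set -> Prop) t u v w :
  dfP (fun e => R (e 0) (e 1) (e 2) (e 3)) ->
  dfF t -> dfF u -> dfF v -> dfF w -> dfP (fun e => R (t e) (u e) (v e) (w e)).
Proof.
  intros H Ht Hu Hv Hw; apply (df_sub (fun x e => R x (u e) (v e) (w e))); auto.
  apply (df_sub (fun y e => R (e 0) y (v (fun i => e (S i))) (w (fun i => e (S i))))
                (fun e => u (fun i => e (S i)))).
  - apply (df_sub (fun z e => R (e 1) (e 0) z (w (fun i => e (S (S i)))))
                  (fun e => v (fun i => e (S (S i))))).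
    + apply (df_sub (fun z e => R (e 2) (e 1) (e 0) z) (fun e => w (fun i => e (S (S (S i)))))).
      * exact (df_ren _ (fun i => match i with 0 => 3 | 1 => 2 | 2 => 1 | 3 => 0 | S i => S i end) H).
      * exact (dfF_ren _ (fun i => S (S (S i))) Hw).
    + exact (dfF_ren _ (fun i => S (S i)) Hv).
  - exact (dfF_ren _ S Hu).
Qed.

Context {St : Str N Y}.
Let trN : trans N := str_trans.
Let inh : exists A, Y A := str_inh.

Lemma df_atom p : elementary p = true -> (forall A, Y A -> dfP (fun e => esat N e (fun _ => A) p)).
Proof. intros E A HA; exists p, (fun _ => A); repeat split; auto. Qed.

Lemma df_const (P : Prop) : dfP (fun _ => P).
Proof.
  destruct inh as [A HA]; destruct (classic P).
  - exists (fImp fBot fBot), (fun _ => A); unfold esat; simpl; repeat split; auto.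
  - exists fBot, (fun _ => A); unfold esat; simpl; repeat split; auto; tauto.
Qed.
Lemma df_eqv i j : dfP (fun e => e i = e j).
Proof. destruct inh as [A HA]; exact (df_atom (fEq i j) eq_refl A HA). Qed.
Lemma df_memv i j : dfP (fun e => e i ∈ e j).
Proof. destruct inh as [A HA]; exact (df_atom (fMem i j) eq_refl A HA). Qed.
Lemma df_var i : dfF (fun e => e i).
Proof. split; [auto|]; exact (df_eqv 0 (S i)). Qed.

Lemma df_fun1 (f : set -> set) t : dfF (fun e => f (e 0)) -> dfF t -> dfF (fun e => f (t e)).
Proof.
  intros [C D] Ht; split.
  - intros e He; apply (C (fun _ => t e)); intro; apply Ht; auto.
  - apply (df_rel2 (fun z x => z = f x) (fun e => e 0) (fun e => t (fun i => e (S i))));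
      auto using df_var; exact (dfF_ren _ S Ht).
Qed.
Lemma df_fun2 (f : set -> set -> set) t u : dfF (fun e => f (e 0) (e 1)) -> dfF t -> dfF u ->
  dfF (fun e => f (t e) (u e)).
Proof.
  intros [C D] Ht Hu; split.
  - intros e He; apply (C (scons (t e) (fun _ => u e))); intros [|i]; [apply Ht|apply Hu]; auto.
  - apply (df_rel3 (fun z x y => z = f x y) (fun e => e 0) (fun e => t (fun i => e (S i)))
             (fun e => u (fun i => e (S i)))); auto using df_var.
    + exact (dfF_ren _ S Ht).
    + exact (dfF_ren _ S Hu).
Qed.
Lemma df_fun3 (f : set -> set -> set -> set) t u v : dfF (fun e => f (e 0) (e 1) (e 2)) ->
  dfF t -> dfF u -> dfF v -> dfF (fun e => f (t e) (u e) (v e)).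
Proof.
  intros [C D] Ht Hu Hv; split.
  - intros e He; apply (C (scons (t e) (scons (u e) (fun _ => v e))));
      intros [|[|i]]; [apply Ht|apply Hu|apply Hv]; auto.
  - apply (df_rel4 (fun z x y w => z = f x y w) (fun e => e 0) (fun e => t (fun i => e (S i)))
             (fun e => u (fun i => e (S i))) (fun e => v (fun i => e (S i)))); auto using df_var.
    + exact (dfF_ren _ S Ht).
    + exact (dfF_ren _ S Hu).
    + exact (dfF_ren _ S Hv).
Qed.

Lemma df_eq t u : dfF t -> dfF u -> dfP (fun e => t e = u e).
Proof. intros; apply (df_rel2 eq); auto using df_eqv. Qed.
Lemma df_mem t u : dfF t -> dfF u -> dfP (fun e => t e ∈ u e).
Proof. intros; apply (df_rel2 mem); auto using df_memv. Qed.
Lemma df_cls A t : Y A -> dfF t -> dfP (fun e => t e ∈ A).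
Proof. intros H; apply (df_rel1 (fun x => x ∈ A)); exact (df_atom (fCMem 0 0) eq_refl A H). Qed.
Lemma df_ball t (Q : set -> env -> Prop) : dfF t -> dfP (fun e => Q (e 0) (fun i => e (S i))) ->
  dfP (fun e => forall x, x ∈ t e -> Q x e).
Proof.
  intros Ht HQ; apply df_ext with (P := fun e => forall x, x ∈ N -> x ∈ t e -> Q x e).
  - intros e He; split; intros H x Hx; auto; apply H; auto; apply (trN (t e)); auto; apply Ht; auto.
  - apply (df_all (fun x e => x ∈ t e -> Q x e)), df_imp; auto.
    apply df_mem; [apply df_var|]; exact (dfF_ren _ S Ht).
Qed.
Lemma df_bex t (Q : set -> env -> Prop) : dfF t -> dfP (fun e => Q (e 0) (fun i => e (S i))) ->
  dfP (fun e => exists x, x ∈ t e /\ Q x e).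
Proof.
  intros Ht HQ; apply df_ext with (P := fun e => exists x, x ∈ N /\ (x ∈ t e /\ Q x e)).
  - intros e He; split; intros (x & Hx & H); exists x; [tauto|]; split; auto.
    apply (trN (t e)); auto; apply Ht; auto.
  - apply (df_ex (fun x e => x ∈ t e /\ Q x e)), df_and; auto.
    apply df_mem; [apply df_var|]; exact (dfF_ren _ S Ht).
Qed.

(** By extensionality in the transitive set [N], a definable membership condition defines the graph.
    Most operations below are shown definable in this way; what remains each time is closure of
    [N]. *)
Lemma df_bymem (F : env -> set) (Q : set -> env -> Prop) :
  (forall e, inN N e -> F e ∈ N) ->
  (forall e, inN N e -> forall x, x ∈ N -> (x ∈ F e <-> Q x e)) ->
  dfP (fun e => Q (e 0) (fun i => e (S i))) -> dfF F.
Proof.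
  intros C H D; split; auto.
  apply df_ext with (P := fun e => forall x, x ∈ N -> (x ∈ e 0 <-> Q x (fun i => e (S i)))).
  - intros e He; assert (He' : inN N (fun i => e (S i))) by auto; split.
    + intro K; apply set_ext; intro x; split; intro Hx.
      * assert (x ∈ N) by (apply (trN (e 0)); auto); apply H; auto; apply K; auto.
      * assert (x ∈ N) by (apply (trN (F (fun i => e (S i)))); auto); apply K; auto; apply H; auto.
    + intros -> x Hx; apply H; auto.
  - apply (df_all (fun x e => x ∈ e 0 <-> Q x (fun i => e (S i)))), df_iff; [apply df_memv|].
    exact (df_ren _ (fun i => match i with 0 => 0 | S i => S (S i) end) D).
Qed.

Lemma df_cst a : a ∈ N -> Y a -> dfF (fun _ => a).
Proof.
  intros Ha Hy; apply (df_bymem _ (fun x e => x ∈ a)); auto; [tauto|].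
  apply df_cls; auto; apply df_var.
Qed.

Lemma df_ite P t u : dfP P -> dfF t -> dfF u -> dfF (fun e => ite (P e) (t e) (u e)).
Proof.
  intros HP [Ct Dt] [Cu Du]; split.
  - intros e He; unfold ite; destruct excluded_middle_informative; auto.
  - apply df_ext with (P := fun e => (P (fun i => e (S i)) /\ e 0 = t (fun i => e (S i))) \/
      (~ P (fun i => e (S i)) /\ e 0 = u (fun i => e (S i)))).
    + intros e He; unfold ite; destruct excluded_middle_informative; tauto.
    + pose proof (df_ren _ S HP); apply df_or; apply df_and; auto; apply df_not; auto.
Qed.

(* Satisfaction over a definable class [D]; the values of the class variables
   are given by definable membership predicates. *)
Lemma df_esat p (D : env -> set) (te tc : nat -> env -> set) : elementary p = true ->
  dfP (fun e => e 0 ∈ D (fun i => e (S i))) ->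
  (forall j, dfP (fun e => e 0 ∈ tc j (fun i => e (S i)))) ->
  (forall e, inN N e -> sub (D e) N) -> (forall j e, inN N e -> sub (tc j e) N) ->
  (forall i, dfF (te i)) ->
  dfP (fun e => esat (D e) (fun i => te i e) (fun j => tc j e) p).
Proof.
  unfold esat; intros E; revert D te tc; induction p; simpl in E; intros D te tc HD Hc SD Sc He; simpl;
    try discriminate; try (apply andb_prop in E; destruct E);
    (* Quantifier case: the bound variable becomes entry 0 of the environment, the old terms are
       shifted, and the family of terms grows by one, so the induction hypothesis must be general in
       [D], [te] and [tc]. *)
    try (assert (Q : dfP (fun e => Sat (D (fun i => e (S i))) emp (scons (e 0) (fun i => te i (fun i => e (S i))))
        (fun j => tc j (fun i => e (S i))) p)) by
      (apply df_ext with (P := fun e => Sat (D (fun i => e (S i))) emp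
        (fun i => (fun i (e : env) => match i with 0 => e 0 | S i => te i (fun j => e (S j)) end) i e)
        (fun j => tc j (fun i => e (S i))) p);
       [intros e Hin;
        replace (fun i => (fun i (e : env) => match i with 0 => e 0 | S i => te i (fun j => e (S j)) end) i e)
          with (scons (e 0) (fun i => te i (fun i => e (S i))))
          by (apply functional_extensionality; intros [|i]; auto); tauto|];
       apply (IHp E (fun e => D (fun i => e (S i))) _ (fun j e => tc j (fun i => e (S i)))); auto;
       [exact (df_ren _ (fun i => match i with 0 => 0 | S i => S (S i) end) HD)
       |intro j; exact (df_ren _ (fun i => match i with 0 => 0 | S i => S (S i) end) (Hc j))
       |intros [|i]; [apply df_var|exact (dfF_ren _ S (He i))]])).
  - apply df_eq; auto.
  - apply df_mem; auto.
  - apply df_ext with (P := fun e => forall x, x ∈ N -> (x ∈ tc X e <-> x ∈ tc Y0 e)).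
    + intros e Hin; split; [|intros ->; tauto].
      intro K; apply set_ext; intro z; split; intro Hz; apply K; auto; eapply Sc; eauto.
    + apply (df_all (fun x e => x ∈ tc X e <-> x ∈ tc Y0 e)), df_iff; auto.
  - exact (df_sub (fun x e => x ∈ tc X e) _ (Hc X) (He x)).
  - apply df_const.
  - apply df_and; auto.
  - apply df_or; auto.
  - apply df_imp; auto.
  - apply df_ext with (P := fun e => forall x, x ∈ N -> x ∈ D e ->
      Sat (D e) emp (scons x (fun i => te i e)) (fun j => tc j e) p).
    + intros e Hin; split; intros H x Hx; auto; apply H; auto; eapply SD; eauto.
    + apply (df_all (fun x e => x ∈ D e -> Sat (D e) emp (scons x (fun i => te i e)) (fun j => tc j e) p)).
      apply df_imp; auto.
  - apply df_ext with (P := fun e => exists x, x ∈ N /\ (x ∈ D e /\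
      Sat (D e) emp (scons x (fun i => te i e)) (fun j => tc j e) p)).
    + intros e Hin; split; intros (x & Hx & H); exists x; [tauto|]; split; auto; eapply SD; eauto.
    + apply (df_ex (fun x e => x ∈ D e /\ Sat (D e) emp (scons x (fun i => te i e)) (fun j => tc j e) p)).
      apply df_and; auto.
Qed.

Lemma df_esat_cst p D e c : elementary p = true -> Y D -> (forall j, Y (c j)) -> sub D N ->
  (forall j, sub (c j) N) -> (forall i, dfF (fun _ => e i)) ->
  dfP (fun v => esat D (scons (v 0) e) c p).
Proof.
  intros E HD Hc SD Sc He.
  apply df_ext with (P := fun v => esat ((fun _ => D) v)
    (fun i => (fun i (v : env) => match i with 0 => v 0 | S i => e i end) i v) (fun j => (fun j (_ : env) => c j) j v) p).
  - intros v _; match goal with |- esat _ ?f _ _ <-> esat _ ?h _ _ => replace h with f end; [reflexivity|].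
    apply functional_extensionality; intros [|i]; auto.
  - apply df_esat; auto; try (intros; apply df_cls; auto; apply df_var); intros [|i]; auto; apply df_var.
Qed.

End Definability.


(** * Models of GB *)

(** GB read semantically over a transitive set. Classes form a predicate, so that inductively
    generated families qualify directly. Replacement asks for functionality on [a] only, and
    [isect (pow a) N] is the power set in the sense of [N]. *)
Class GBm (N : set) (Y : set -> Prop) : Prop := {
  gb_trans : trans N;
  gb_emp : emp ∈ N;
  gb_pair : forall a b, a ∈ N -> b ∈ N -> upair a b ∈ N;
  gb_union : forall a, a ∈ N -> union a ∈ N;
  gb_pow : forall a, a ∈ N -> isect (pow a) N ∈ N;
  gb_omega : omega ∈ N;
  gb_sub : forall A, Y A -> sub A N;
  gb_compr : forall p e c, elementary p = true -> inN N e -> (forall i, Y (c i)) ->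
    Y (sep N (fun x => esat N (scons x e) c p));
  gb_repl : forall F a, Y F -> a ∈ N ->
    (forall x y y', x ∈ a -> opair x y ∈ F -> opair x y' ∈ F -> y = y') ->
    sep N (fun y => exists x, x ∈ a /\ opair x y ∈ F) ∈ N;
  gb_inh : exists A, Y A
}.

#[global] Instance GBm_Str N Y : GBm N Y -> Str N Y.
Proof. intros G; split; [apply gb_trans|apply gb_inh]. Qed.
#[global] Hint Resolve GBm_Str : core.

(** Extension point of [dfn_step], redefined whenever new operations have been shown definable. *)
Ltac dfx := fail.
(** Quantifiers over [N] itself are tried before bounded ones, because [N] is not the value of a
    definable term. *)
Ltac dfn_step :=
  cbn beta;
  lazymatch goal with
  | |- Str _ _ => typeclasses eauto
  | |- GBm _ _ => typeclasses eauto
  | |- DfP _ _ (fun e => _ /\ _) => apply df_and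
  | |- DfP _ _ (fun e => _ \/ _) => apply df_or
  | |- DfP _ _ (fun e => _ <-> _) => apply df_iff
  | |- DfP _ _ (fun e => ~ _) => apply df_not
  | |- DfP ?N _ (fun e => forall x, x ∈ ?N -> _) => apply df_all
  | |- DfP ?N _ (fun e => exists x, x ∈ ?N /\ _) => apply df_ex
  | |- DfP _ _ (fun e => forall x, mem x _ -> _) =>
      apply df_ball
  | |- DfP _ _ (fun e => exists x, mem x _ /\ _) =>
      apply df_bex
  | |- DfP _ _ (fun e => _ -> _) => apply df_imp
  | |- DfP _ _ (fun e => _ = _) => apply df_eq
  | |- DfP _ _ (fun e => mem _ _) => first [apply df_cls; [solve [auto]|] | apply df_mem]
  | |- DfF _ _ (fun e => e _) => apply df_var
  | |- _ => dfx
  end.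
Ltac dfn := repeat dfn_step.

Section GB.
Context {N : set} {Y : set -> Prop} {G : GBm N Y}.
Notation dfP := (DfP N Y).
Notation dfF := (DfF N Y).

Lemma gb_class P e : dfP P -> inN N e -> Y (sep N (fun x => P (scons x e))).
Proof.
  intros (p & c & E & Hc & K) He; pose proof (gb_compr p e c E He Hc) as H.
  erewrite sep_ext; [exact H|]; intros x Hx; cbn beta; symmetry; apply K; auto using scons_in.
Qed.

Lemma gb_class1 (P : set -> Prop) : dfP (fun e => P (e 0)) -> Y (sep N P).
Proof.
  intro H; apply (gb_class _ (fun _ => emp) H); intro; apply gb_emp.
Qed.

Lemma df_upair t u : dfF t -> dfF u -> dfF (fun e => upair (t e) (u e)).
Proof.
  apply (df_fun2 _ _ upair).
  apply (df_bymem _ _ _ (fun x e => x = e 0 \/ x = e 1)).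
  - intros; apply gb_pair; auto.
  - intros; apply mem_upair.
  - dfn.
Qed.
Lemma df_opair t u : dfF t -> dfF u -> dfF (fun e => opair (t e) (u e)).
Proof. intros; repeat (apply df_upair; auto). Qed.
Lemma df_union t : dfF t -> dfF (fun e => union (t e)).
Proof.
  apply (df_fun1 _ _ union).
  apply (df_bymem _ _ _ (fun x e => exists y, y ∈ e 0 /\ x ∈ y)).
  - intros; apply gb_union; auto.
  - intros; apply mem_union.
  - dfn.
Qed.

(** Separation is replacement along the identity on [A]. *)
Lemma gb_sep a A : a ∈ N -> Y A -> isect a A ∈ N.
Proof.
  intros Ha HA.
  assert (HF : Y (sep N (fun w => exists x, x ∈ N /\ (x ∈ A /\ w = opair x x)))).
  { apply gb_class1; dfn; apply df_opair; dfn. }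
  assert (E : isect a A = sep N (fun y => exists x, x ∈ a /\
     opair x y ∈ sep N (fun w => exists x, x ∈ N /\ (x ∈ A /\ w = opair x x)))).
  { apply set_ext; intro z; rewrite mem_isect, mem_sep; split.
    - intros [Hz Az]; assert (Nz : z ∈ N) by (eapply gb_trans; eauto); split; auto.
      exists z; split; auto; apply mem_sep; split; [repeat apply gb_pair; auto|eauto].
    - intros (Nz & x & Hx & K); apply mem_sep in K; destruct K as (_ & y & Ny & Ay & E).
      apply opair_inj in E; destruct E; subst; auto. }
  rewrite E; apply gb_repl; auto.
  intros x y y' _ H K; apply mem_sep in H; apply mem_sep in K.
  destruct H as (_ & u & _ & _ & H), K as (_ & v & _ & _ & K).
  apply opair_inj in H; apply opair_inj in K; intuition congruence.
Qed.

Lemma df_sep t (P : set -> env -> Prop) : dfF t -> dfP (fun e => P (e 0) (fun i => e (S i))) ->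
  dfF (fun e => sep (t e) (fun x => P x e)).
Proof.
  intros Ht HP; apply (df_bymem _ _ _ (fun x e => x ∈ t e /\ P x e)).
  - intros e He; pose proof (gb_sep (t e) _ (proj1 Ht e He) (gb_class _ e HP He)) as H.
    cbn in H; replace (sep (t e) (fun x => P x e)) with
      (isect (t e) (sep N (fun x => P x (fun i => e i)))); auto.
    apply set_ext; intro z; rewrite mem_isect, !mem_sep; split; [tauto|].
    intros [Hz Pz]; repeat split; auto; exact (gb_trans _ (proj1 Ht e He) z Hz).
  - intros; apply mem_sep.
  - dfn; auto; exact (dfF_ren _ _ _ S Ht).
Qed.

Lemma df_img t (f : set -> env -> set) : dfF t -> dfF (fun e => f (e 0) (fun i => e (S i))) ->
  dfF (fun e => img (t e) (fun x => f x e)).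
Proof.
  intros Ht Hf; apply (df_bymem _ _ _ (fun x e => exists y, y ∈ t e /\ x = f y e)).
  - intros e He.
    assert (Cf : forall x, x ∈ N -> f x e ∈ N).
    { intros x Hx; exact (proj1 Hf (scons x e) (scons_in N x e Hx He)). }
    assert (HF : Y (sep N (fun w => exists x, x ∈ N /\ w = opair x (f x e)))).
    { apply (gb_class (fun e => exists x, x ∈ N /\ e 0 = opair x (f x (fun i => e (S i)))) e); auto.
      dfn; apply df_opair; [dfn|].
      exact (dfF_ren _ _ _ (fun i => match i with 0 => 0 | S i => S (S i) end) Hf). }
    assert (E : img (t e) (fun x => f x e) = sep N (fun y => exists x, x ∈ t e /\
       opair x y ∈ sep N (fun w => exists x, x ∈ N /\ w = opair x (f x e)))).
    { apply set_ext; intro z; rewrite mem_img, mem_sep; split.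
      - intros (y & Hy & ->); assert (Ny : y ∈ N) by exact (gb_trans _ (proj1 Ht e He) y Hy).
        split; auto; exists y; split; auto; apply mem_sep; split; [repeat apply gb_pair; auto|eauto].
      - intros (Nz & x & Hx & K); apply mem_sep in K; destruct K as (_ & y & Ny & E).
        apply opair_inj in E; destruct E; subst; eauto. }
    rewrite E; apply gb_repl; auto; [apply Ht; auto|].
    intros x y y' _ H K; apply mem_sep in H; apply mem_sep in K.
    destruct H as (_ & u & _ & H), K as (_ & v & _ & K).
    apply opair_inj in H; apply opair_inj in K; intuition congruence.
  - intros; apply mem_img.
  - dfn; [exact (dfF_ren _ _ _ S Ht)|].
    exact (dfF_ren _ _ _ (fun i => match i with 0 => 0 | S i => S (S i) end) Hf).
Qed.

Lemma gb_set a : a ∈ N -> Y a.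
Proof.
  intro Ha; replace a with (sep N (fun x => x ∈ a)).
  - apply (gb_class (fun e => e 0 ∈ e 1) (fun _ => a)); auto; dfn.
  - apply set_ext; intro z; rewrite mem_sep; split; [tauto|]; split; auto; eapply gb_trans; eauto.
Qed.

Lemma df_gcst a : a ∈ N -> dfF (fun _ => a).
Proof. intro; apply df_cst; auto using gb_set, GBm_Str. Qed.

End GB.

Ltac dfx ::= first
  [ apply df_gcst; first [assumption | apply gb_emp | apply gb_omega | solve [auto]]
  | apply df_upair | apply df_opair | apply df_union | apply df_sep | apply df_img | apply df_ite ].

Section GB2.
Context {N : set} {Y : set -> Prop} {G : GBm N Y}.
Notation dfP := (DfP N Y).
Notation dfF := (DfF N Y).

Lemma df_sing t : dfF t -> dfF (fun e => sing (t e)).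
Proof. intros; apply df_upair; auto. Qed.
Lemma df_cup t u : dfF t -> dfF u -> dfF (fun e => cup (t e) (u e)).
Proof. intros; apply df_union, df_upair; auto. Qed.
Lemma df_succ t : dfF t -> dfF (fun e => succ (t e)).
Proof. intros; apply df_cup; auto; apply df_sing; auto. Qed.
Lemma df_bigU t (f : set -> env -> set) : dfF t -> dfF (fun e => f (e 0) (fun i => e (S i))) ->
  dfF (fun e => bigU (t e) (fun x => f x e)).
Proof. intros; apply df_union, df_img; auto. Qed.
Lemma df_isect t u : dfF t -> dfF u -> dfF (fun e => isect (t e) (u e)).
Proof. apply (df_fun2 _ _ isect); unfold isect; dfn. Qed.
Lemma df_prod t u : dfF t -> dfF u -> dfF (fun e => prod (t e) (u e)).
Proof. apply (df_fun2 _ _ prod); unfold prod; apply df_bigU; dfn. Qed.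
Lemma df_fst t : dfF t -> dfF (fun e => fst (t e)).
Proof. apply (df_fun1 _ _ fst); unfold fst; dfn. Qed.
Lemma df_snd t : dfF t -> dfF (fun e => snd (t e)).
Proof. apply (df_fun1 _ _ snd); unfold snd; dfn. Qed.
Lemma df_app t u : dfF t -> dfF u -> dfF (fun e => app (t e) (u e)).
Proof. apply (df_fun2 _ _ app); unfold app; dfn. Qed.
Lemma df_graph t (f : set -> env -> set) : dfF t -> dfF (fun e => f (e 0) (fun i => e (S i))) ->
  dfF (fun e => graph (t e) (fun x => f x e)).
Proof. intros; apply df_img; auto; apply df_opair; auto; dfn. Qed.
Lemma df_ord t : dfF t -> dfP (fun e => ord (t e)).
Proof. apply (df_rel1 _ _ ord); unfold ord, trans; dfn. Qed.
Lemma df_sub_ t u : dfF t -> dfF u -> dfP (fun e => sub (t e) (u e)).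
Proof. apply (df_rel2 _ _ sub); unfold sub; dfn. Qed.
Lemma df_num n : dfF (fun _ => num n).
Proof. apply df_gcst; eapply gb_trans; [apply gb_omega|apply num_omega]. Qed.

End GB2.

Ltac dfb := lazymatch goal with
  | |- DfF _ _ (fun e => upair _ _) => apply df_upair
  | |- DfF _ _ (fun e => opair _ _) => apply df_opair
  | |- DfF _ _ (fun e => union _) => apply df_union
  | |- DfF _ _ (fun e => sep _ _) => apply df_sep
  | |- DfF _ _ (fun e => img _ _) => apply df_img
  | |- DfF _ _ (fun e => ite _ _ _) => apply df_ite
  | |- DfF _ _ (fun e => sing _) => apply df_sing
  | |- DfF _ _ (fun e => cup _ _) => apply df_cup
  | |- DfF _ _ (fun e => succ _) => apply df_succ
  | |- DfF _ _ (fun e => bigU _ _) => apply df_bigU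
  | |- DfF _ _ (fun e => isect _ _) => apply df_isect
  | |- DfF _ _ (fun e => prod _ _) => apply df_prod
  | |- DfF _ _ (fun e => fst _) => apply df_fst
  | |- DfF _ _ (fun e => snd _) => apply df_snd
  | |- DfF _ _ (fun e => app _ _) => apply df_app
  | |- DfF _ _ (fun e => graph _ _) => apply df_graph
  | |- DfP _ _ (fun e => ord _) => apply df_ord
  | |- DfP _ _ (fun e => sub _ _) => apply df_sub_
  | |- DfF _ _ (fun e => num _) => apply df_num
  | |- _ => first [ assumption
      | apply df_gcst; first [assumption | apply gb_emp | apply gb_omega | solve [auto]]
      | apply df_const ]
  end.
Ltac dfx ::= dfb.

(** * Transfinite recursion inside a model of GB *)

Section Recursion.
Context {N : set} {Y : set -> Prop} {G : GBm N Y}.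
Notation dfP := (DfP N Y).
Notation dfF := (DfF N Y).
Variable F : set -> set -> set -> set.

(* For an ordinal [z]: [h] is the restriction of [mrec (F p)] to [z]. *)
Definition isrec (p z h : set) : Prop :=
  (forall w, w ∈ h -> exists y, y ∈ z /\ w = opair y (F p y (sep h (fun v => fst v ∈ y)))) /\
  (forall y, y ∈ z -> exists w, w ∈ h /\ fst w = y).

(** The local rule determines [h] at [y] from its values below [y], so by induction an approximation
    can only be the true function. This uniqueness is what makes the recursion definable. *)
Lemma isrec_iff p z h : ord z -> (isrec p z h <-> h = graph z (mrec (F p))).
Proof.
  intro Oz; split.
  - intros [H1 H2].
    assert (K : forall y, y ∈ z -> forall v, opair y v ∈ h -> v = mrec (F p) y).
    { induction y as [y IH] using mem_ind; intros Hy v Hv.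
      destruct (H1 _ Hv) as (y' & Hy' & E); apply opair_inj in E; destruct E as [<- E].
      rewrite E, mrec_eq; f_equal; apply set_ext; intro w; rewrite mem_sep; split.
      - intros [Hw Fw]; destruct (H1 _ Hw) as (u & Hu & Ew); rewrite Ew in Fw, Hw |- *.
        rewrite fst_opair in Fw; apply mem_graph; split; auto.
      - intro Hw; apply mem_img in Hw; destruct Hw as (u & Hu & ->); rewrite fst_opair; split; auto.
        destruct (H2 u) as (w & Hw & Ew); [eapply ord_trans; eauto|].
        destruct (H1 _ Hw) as (u' & Hu' & E'); rewrite E', fst_opair in Ew; subst u'.
        rewrite <- (IH u Hu Hu' _ (eq_ind _ (fun w => w ∈ h) Hw _ E')), <- E'; auto. }
    apply set_ext; intro w; split.
    + intro Hw; destruct (H1 _ Hw) as (y & Hy & E); rewrite E in Hw |- *; apply mem_graph; split; auto.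
    + intro Hw; apply mem_img in Hw; destruct Hw as (y & Hy & ->).
      destruct (H2 y Hy) as (w & Hw & Ew); destruct (H1 _ Hw) as (u' & Hu' & E').
      rewrite E', fst_opair in Ew; subst u'; rewrite E' in Hw; rewrite (K y Hy _ Hw) in Hw; auto.
  - intros ->; split.
    + intros w Hw; apply mem_img in Hw; destruct Hw as (y & Hy & ->); exists y; split; auto.
      rewrite mrec_eq; do 2 f_equal; apply set_ext; intro w; rewrite mem_sep; split.
      * intro Hw; apply mem_img in Hw; destruct Hw as (u & Hu & ->); rewrite fst_opair; split; auto.
        apply mem_graph; split; auto; eapply ord_trans; eauto.
      * intros [Hw Fw]; apply mem_img in Hw; destruct Hw as (u & Hu & ->); rewrite fst_opair in Fw.
        apply mem_graph; auto.
    + intros y Hy; exists (opair y (mrec (F p) y)); rewrite fst_opair; split; auto; apply mem_graph; auto.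
Qed.

Hypothesis HF : dfF (fun e => F (e 0) (e 1) (e 2)).

Lemma df_F3 t u v : dfF t -> dfF u -> dfF v -> dfF (fun e => F (t e) (u e) (v e)).
Proof. apply df_fun3; auto. Qed.

Lemma df_isrec t u v : dfF t -> dfF u -> dfF v -> dfP (fun e => isrec (t e) (u e) (v e)).
Proof.
  apply (df_rel3 _ _ isrec); unfold isrec; dfn; apply df_F3; dfn.
Qed.

(** The induction on [z] runs in the ambient universe. Shorter approximations are in [N] by
    induction hypothesis, and Class Replacement assembles them. *)
Lemma gb_recgraph p z : p ∈ N -> z ∈ N -> ord z -> graph z (mrec (F p)) ∈ N.
Proof.
  intros Hp; induction z as [z IH] using mem_ind; intros Hz Oz.
  assert (IH' : forall y, y ∈ z -> y ∈ N /\ graph y (mrec (F p)) ∈ N /\ mrec (F p) y ∈ N).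
  { intros y Hy; assert (Ny : y ∈ N) by (eapply gb_trans; eauto).
    assert (Gy : graph y (mrec (F p)) ∈ N) by (apply IH; auto; eapply ord_mem; eauto).
    repeat split; auto; rewrite mrec_eq.
    apply (proj1 HF (scons p (scons y (fun _ => graph y (mrec (F p)))))); intros [|[|i]]; auto. }
  (* [K] sends [y] to the pair of [y] and its value, so the image of [z] under [K] is the required
     graph itself. *)
  pose (K := sep N (fun w => exists y, y ∈ N /\ exists h, h ∈ N /\
               (ord y /\ isrec p y h /\ w = opair y (opair y (F p y h))))).
  assert (HK : Y K).
  { apply gb_class1; dfn; [apply df_isrec; dfn|apply df_F3; dfn]. }
  assert (Ops : forall x y, x ∈ N -> y ∈ N -> opair x y ∈ N) by (intros; repeat apply gb_pair; auto).
  replace (graph z (mrec (F p))) with (sep N (fun y => exists x, x ∈ z /\ opair x y ∈ K)).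
  - apply gb_repl; auto.
    intros x y y' _ H1 H2; apply mem_sep in H1; apply mem_sep in H2.
    destruct H1 as (_ & u & _ & h & _ & Ou & H1 & E1), H2 as (_ & u' & _ & h' & _ & Ou' & H2 & E2).
    apply opair_inj in E1; apply opair_inj in E2; destruct E1, E2; subst.
    apply isrec_iff in H1; apply isrec_iff in H2; auto; subst; auto.
  - apply set_ext; intro w; rewrite mem_sep; split.
    + intros (_ & x & Hx & H1); apply mem_sep in H1.
      destruct H1 as (_ & u & _ & h & _ & Ou & H1 & E1); apply opair_inj in E1; destruct E1; subst.
      apply isrec_iff in H1; auto; subst; rewrite <- mrec_eq; apply mem_graph; auto.
    + intro Hw; apply mem_img in Hw; destruct Hw as (y & Hy & ->); destruct (IH' y Hy) as (Ny & Gy & My).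
      split; auto; exists y; split; auto; apply mem_sep; split; auto.
      exists y; split; auto; exists (graph y (mrec (F p))); split; auto.
      assert (ord y) by (eapply ord_mem; eauto).
      split; [auto|split; [apply isrec_iff; auto|rewrite <- mrec_eq; auto]].
Qed.

(** The default [emp] off the ordinals makes this a total operation on [N], as [DfF] demands. *)
Definition orec (p z : set) : set := ite (ord z) (mrec (F p) z) emp.

Lemma df_orec t u : dfF t -> dfF u -> dfF (fun e => orec (t e) (u e)).
Proof.
  apply (df_fun2 _ _ orec); unfold orec; split.
  - intros e He; unfold ite; destruct excluded_middle_informative; [|apply gb_emp].
    rewrite mrec_eq; apply (proj1 HF (scons (e 0) (scons (e 1) (fun _ => graph (e 1) (mrec (F (e 0))))))).
    intros [|[|i]]; simpl; auto; apply gb_recgraph; auto.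
  - apply df_ext with (P := fun e => (ord (e 2) /\ exists h, h ∈ N /\ (isrec (e 1) (e 2) h /\
       e 0 = F (e 1) (e 2) h)) \/ (~ ord (e 2) /\ e 0 = emp)).
    + intros e He; unfold ite; destruct excluded_middle_informative as [Oz|Oz]; [|tauto].
      split.
      * intros [(_ & h & _ & Hh & E)|]; [|tauto]; apply isrec_iff in Hh; auto; subst; rewrite mrec_eq; auto.
      * intro E; left; split; auto; exists (graph (e 2) (mrec (F (e 1)))); split;
          [apply gb_recgraph; auto|]; split; [apply isrec_iff; auto|]; rewrite <- mrec_eq; auto.
    + dfn; [apply df_isrec; dfn|apply df_F3; dfn].
Qed.

End Recursion.


(** * Definable well-orders *)

Definition rel (W x y : set) : Prop := opair x y ∈ W.

Definition WO (A W : set) : Prop :=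
  (forall x y, x ∈ A -> y ∈ A -> x = y \/ rel W x y \/ rel W y x) /\
  well_founded (rel W) /\ (forall x y, rel W x y -> x ∈ A /\ y ∈ A).

Lemma wf_asym {T} (R : T -> T -> Prop) : well_founded R -> forall x y, R x y -> ~ R y x.
Proof.
  intros H x; induction (H x) as [x _ IH]; intros y K L; apply (IH y L x L K).
Qed.

Lemma wo_trans A W x y z : WO A W -> rel W x y -> rel W y z -> rel W x z.
Proof.
  intros (T & F & D) H K; destruct (T x z) as [E|[E|E]]; auto.
  - apply (D _ _ H).
  - apply (D _ _ K).
  - subst; destruct (wf_asym _ F _ _ H K).
  - exfalso. destruct (wf_min (rel W) (fun u => u = x \/ u = y \/ u = z) x (F x)) as (m & [->|[->| ->]] & Hm); auto.
    + apply (Hm _ E); auto.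
    + apply (Hm _ H); auto.
    + apply (Hm _ K); auto.
Qed.

(** Points of the image are compared by their least preimages: [x] precedes [y] when some preimage
    of [x] lies below every preimage of [y]. No preimage has to be chosen. *)
Definition imgW (Q W : set) (g : set -> set) : set :=
  sep (prod (img Q g) (img Q g)) (fun w => exists q, q ∈ Q /\ (g q = fst w /\
    forall q', q' ∈ Q -> g q' = snd w -> opair q q' ∈ W)).

Lemma rel_imgW Q W g x y : rel (imgW Q W g) x y <-> x ∈ img Q g /\ y ∈ img Q g /\
  exists q, q ∈ Q /\ g q = x /\ forall q', q' ∈ Q -> g q' = y -> rel W q q'.
Proof.
  unfold rel at 1, imgW; rewrite mem_sep, mem_prod_opair, fst_opair, snd_opair; tauto.
Qed.

Lemma wo_least A W (P : set -> Prop) x : WO A W -> x ∈ A -> P x ->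
  exists m, m ∈ A /\ P m /\ forall y, y ∈ A -> P y -> y = m \/ rel W m y.
Proof.
  intros (T & F & D) Hx Px.
  destruct (wf_min (rel W) (fun m => m ∈ A /\ P m) x (F x)) as (m & [Hm Pm] & K); auto.
  exists m; repeat split; auto; intros y Hy Py; destruct (T y m Hy Hm) as [E|[E|E]]; auto.
  destruct (K y E); auto.
Qed.

Lemma WO_img Q W g : WO Q W -> WO (img Q g) (imgW Q W g).
Proof.
  intro H; pose proof H as (T & F & D).
  assert (Min : forall x, x ∈ img Q g -> exists q, q ∈ Q /\ g q = x /\
     forall q', q' ∈ Q -> g q' = x -> q' = q \/ rel W q q').
  { intros x Hx; apply mem_img in Hx; destruct Hx as (q & Hq & ->).
    destruct (wo_least Q W (fun r => g r = g q) q H Hq eq_refl) as (m & Hm & Em & K); eauto. }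
  split; [|split].
  - intros x y Hx Hy; destruct (Min x Hx) as (q & Hq & Eq & Kq), (Min y Hy) as (r & Hr & Er & Kr).
    destruct (T q r Hq Hr) as [E|[E|E]]; [left; congruence|right; left|right; right];
      apply rel_imgW; repeat split; auto.
    + exists q; repeat split; auto; intros q' Hq' Eq'; destruct (Kr q' Hq' Eq') as [->|K]; auto.
      eapply wo_trans; eauto.
    + exists r; repeat split; auto; intros q' Hq' Eq'; destruct (Kq q' Hq' Eq') as [->|K]; auto.
      eapply wo_trans; eauto.
  (* Accessibility of a point of the image is proved by induction on its least preimage [q]. *)
  - assert (K : forall q x, g q = x -> q ∈ Q ->
      (forall q', q' ∈ Q -> g q' = x -> q' = q \/ rel W q q') -> Acc (rel (imgW Q W g)) x).
    { intro q; induction (F q) as [q _ IH]; intros x Eq Hq Kq; constructor; intros y Hy.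
      apply rel_imgW in Hy; destruct Hy as (Iy & Ix & r & Hr & Er & Kr).
      specialize (Kr q Hq Eq); destruct (Min y Iy) as (m & Hm & Em & Km).
      apply (IH m); auto; destruct (Km r Hr Er) as [->|L]; auto; eapply wo_trans; eauto. }
    intro x; constructor; intros y Hy; apply rel_imgW in Hy; destruct Hy as (Iy & _ & _).
    destruct (Min y Iy) as (m & Hm & Em & Km); apply (K m); auto.
  - intros x y K; apply rel_imgW in K; tauto.
Qed.

Definition lexW (A W B W' : set) : set :=
  sep (prod (prod A B) (prod A B)) (fun w =>
    opair (fst (fst w)) (fst (snd w)) ∈ W \/
    (fst (fst w) = fst (snd w) /\ opair (snd (fst w)) (snd (snd w)) ∈ W')).

Lemma WO_lex A W B W' : WO A W -> WO B W' -> WO (prod A B) (lexW A W B W').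
Proof.
  intros (T & F & D) (T' & F' & D').
  assert (R : forall x y x' y', rel (lexW A W B W') (opair x y) (opair x' y') <->
     (x ∈ A /\ y ∈ B) /\ (x' ∈ A /\ y' ∈ B) /\ (rel W x x' \/ (x = x' /\ rel W' y y'))).
  { intros; unfold rel at 1, lexW; rewrite mem_sep, !fst_opair, !snd_opair, !mem_prod_opair, !fst_opair.
    unfold rel; tauto. }
  assert (P : forall u v, rel (lexW A W B W') u v -> u ∈ prod A B /\ v ∈ prod A B).
  { intros u v H; unfold rel, lexW in H; apply mem_sep in H; destruct H as [H _].
    apply mem_prod_opair in H; auto. }
  split; [|split].
  - intros u v Hu Hv; apply mem_prod in Hu; apply mem_prod in Hv.
    destruct Hu as (x & y & Hx & Hy & ->), Hv as (x' & y' & Hx' & Hy' & ->).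
    rewrite !R; destruct (T x x' Hx Hx') as [->|[E|E]]; auto.
    + destruct (T' y y' Hy Hy') as [->|[E|E]]; auto 10.
    + auto 10.
    + auto 10.
  - assert (K : forall x y, Acc (rel (lexW A W B W')) (opair x y)).
    { intro x; induction (F x) as [x _ IHx]; intro y; induction (F' y) as [y _ IHy].
      constructor; intros u Hu; pose proof (proj1 (P _ _ Hu)) as Pu; apply mem_prod in Pu.
      destruct Pu as (x' & y' & _ & _ & ->); apply R in Hu; destruct Hu as (_ & _ & [H|[-> H]]); auto. }
    intro u; constructor; intros v Hv; destruct (P _ _ Hv) as [Pv _]; apply mem_prod in Pv.
    destruct Pv as (x & y & _ & _ & ->); auto.
  - exact P.
Qed.

Definition omW : set := sep (prod omega omega) (fun w => fst w ∈ snd w).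

Lemma WO_omega : WO omega omW.
Proof.
  assert (R : forall x y, rel omW x y <-> x ∈ omega /\ y ∈ omega /\ x ∈ y).
  { intros; unfold rel, omW; rewrite mem_sep, mem_prod_opair, fst_opair, snd_opair; tauto. }
  split; [|split].
  - intros x y Hx Hy; rewrite !R.
    destruct (ord_total x y) as [H|[H|H]]; auto using (ord_mem omega), ord_omega.
  - intro x; induction x as [x IH] using mem_ind; constructor; intros y Hy; apply R in Hy; apply IH; tauto.
  - intros x y H; apply R in H; tauto.
Qed.

(* The ranked union of the well-ordered sets [h z], [z ∈ xi]: an element is
   compared first by the least [z] at which it appears, then by the order of
   [h z]. Pairs (set, order) are coded as ordered pairs. *)
Definition newat (h : set -> set) (y z : set) : Prop :=
  y ∈ fst (h z) /\ forall u, u ∈ z -> ~ y ∈ fst (h u).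
Definition RU (xi : set) (h : set -> set) : set :=
  opair (bigU xi (fun z => fst (h z)))
    (sep (prod (bigU xi (fun z => fst (h z))) (bigU xi (fun z => fst (h z))))
      (fun w => exists z, z ∈ xi /\ (newat h (snd w) z /\
        ((exists u, u ∈ z /\ fst w ∈ fst (h u)) \/
         (newat h (fst w) z /\ opair (fst w) (snd w) ∈ snd (h z)))))).

Lemma RU_ext xi h h' : ord xi -> (forall z, z ∈ xi -> h z = h' z) -> RU xi h = RU xi h'.
Proof.
  intros O E; unfold RU.
  assert (B : bigU xi (fun z => fst (h z)) = bigU xi (fun z => fst (h' z))).
  { unfold bigU; f_equal; apply img_ext; intros; rewrite E; auto. }
  rewrite B; f_equal; apply sep_ext; intros w _.
  assert (Nw : forall y z, z ∈ xi -> (newat h y z <-> newat h' y z)).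
  { intros y z Hz; unfold newat; rewrite (E z Hz).
    assert (Eu : forall u, u ∈ z -> h u = h' u) by (intros u Hu; apply E; exact (ord_trans _ _ _ O Hu Hz)).
    split; intros [H K]; (split; [exact H|]); intros u Hu;
      [rewrite <- (Eu u Hu)|rewrite (Eu u Hu)]; exact (K u Hu). }
  split; intros (z & Hz & H1 & H2); exists z; (split; [exact Hz|]);
    (split; [apply (Nw _ _ Hz); exact H1|]);
    (destruct H2 as [(u & Hu & K)|[K1 K2]];
     [left; exists u; split; [exact Hu|]; pose proof (E u (ord_trans _ _ _ O Hu Hz)) as Eu
     |right; split; [apply (Nw _ _ Hz); exact K1|]]).
  - rewrite <- Eu; exact K.
  - rewrite <- (E z Hz); exact K2.
  - rewrite Eu; exact K.
  - rewrite (E z Hz); exact K2.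
Qed.

Lemma rel_RU xi h x y : rel (snd (RU xi h)) x y <->
  x ∈ fst (RU xi h) /\ y ∈ fst (RU xi h) /\ exists z, z ∈ xi /\ (newat h y z /\
        ((exists u, u ∈ z /\ x ∈ fst (h u)) \/ (newat h x z /\ rel (snd (h z)) x y))).
Proof.
  unfold RU, rel; rewrite fst_opair, snd_opair, mem_sep, mem_prod_opair, fst_opair, snd_opair; tauto.
Qed.

Lemma mem_RU xi h x : ord xi -> (x ∈ fst (RU xi h) <-> exists z, z ∈ xi /\ newat h x z).
Proof.
  intro O; unfold RU; rewrite fst_opair, mem_bigU; split.
  - intros (z & Hz & Hx).
    destruct (ord_least (fun z => x ∈ fst (h z)) z) as (m & Om & Hm & Lm & K); auto;
      [eapply ord_mem; eauto|].
    exists m; split; [|split; auto]; destruct Lm; subst; auto; eapply ord_trans; eauto.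
  - intros (z & Hz & Hx & _); eauto.
Qed.

Lemma newat_uniq h x z z' : ord z -> ord z' -> newat h x z -> newat h x z' -> z = z'.
Proof.
  intros O O' [H K] [H' K']; destruct (ord_total z z' O O') as [E|[E|E]]; auto.
  - destruct (K' _ E H).
  - destruct (K _ E H').
Qed.

Lemma WO_RU xi h : ord xi -> (forall z, z ∈ xi -> WO (fst (h z)) (snd (h z))) ->
  WO (fst (RU xi h)) (snd (RU xi h)).
Proof.
  intros O H.
  assert (Oz : forall z, z ∈ xi -> ord z) by (intros; eapply ord_mem; eauto).
  split; [|split].
  - intros x y Hx Hy; rewrite !rel_RU; pose proof Hx as Hx'; pose proof Hy as Hy'.
    apply mem_RU in Hx'; auto; apply mem_RU in Hy'; auto.
    destruct Hx' as (z & Hz & Nz), Hy' as (z' & Hz' & Nz').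
    destruct (ord_total z z' (Oz _ Hz) (Oz _ Hz')) as [E|[E|E]].
    + right; left; repeat split; auto; exists z'; split; auto; split; auto; left; exists z; split; auto; apply Nz.
    + subst z'; destruct (proj1 (H z Hz) x y (proj1 Nz) (proj1 Nz')) as [->|[E|E]]; auto; right;
        [left|right]; repeat split; auto; exists z; auto 6.
    + right; right; repeat split; auto; exists z; split; auto; split; auto; left; exists z'; split; auto; apply Nz'.
  (* Outer induction on the stage at which [x] is new, inner induction along the order of that
     stage. *)
  - assert (K : forall z, z ∈ xi -> forall x, newat h x z -> Acc (rel (snd (RU xi h))) x).
    { induction z as [z IH] using mem_ind; intros Hz x.
      destruct (H z Hz) as (_ & F & _); induction (F x) as [x _ IHx]; intros Nx.
      constructor; intros y Hy; apply rel_RU in Hy; destruct Hy as (Dy & Dx & z' & Hz' & Nx' & C).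
      assert (z' = z) by (eapply newat_uniq; eauto); subst z'; destruct C as [(u & Hu & Ku)|[C1 C2]].
      - destruct (ord_least (fun u => y ∈ fst (h u)) u) as (m & Om & Hm & Lm & Km); auto.
        { eapply ord_mem; [|exact Hu]; auto. }
        assert (m ∈ z) by (destruct Lm; subst; auto; eapply ord_trans; eauto).
        apply (IH m); auto; [eapply ord_trans; eauto|split; auto].
      - apply IHx; auto. }
    intro x; constructor; intros y Hy; apply rel_RU in Hy; destruct Hy as (Dy & _).
    apply mem_RU in Dy; auto; destruct Dy as (z & Hz & Nz); eapply K; eauto.
  - intros x y K; apply rel_RU in K; tauto.
Qed.

(** Iteration of a step on well-ordered sets, with ranked unions throughout. It is used with [StepI]
    up to [omega] to close a family under operations, and with [StepO] along the ordinals to build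
    [L]. *)
Definition BLF (Step : set -> set -> set) (p xi f : set) : set :=
  RU xi (fun z => Step p (app f z)).
Definition BL (Step : set -> set -> set) : set -> set -> set := orec (BLF Step).

Lemma BL_eq Step p xi : ord xi -> BL Step p xi = RU xi (fun z => Step p (BL Step p z)).
Proof.
  intro O; unfold BL, orec; rewrite ite_T by auto; rewrite mrec_eq.
  unfold BLF at 1; apply RU_ext; auto; intros z Hz; rewrite app_graph by auto; rewrite ite_T; auto.
  eapply ord_mem; eauto.
Qed.

Lemma WO_BL Step p xi : ord xi ->
  (forall I, WO (fst I) (snd I) -> WO (fst (Step p I)) (snd (Step p I))) ->
  WO (fst (BL Step p xi)) (snd (BL Step p xi)).
Proof.
  intros O H; induction xi as [xi IH] using mem_ind; rewrite BL_eq by auto; apply WO_RU; auto.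
  intros z Hz; apply H, IH; auto; eapply ord_mem; eauto.
Qed.

Section DfWO.
Context {N : set} {Y : set -> Prop} {G : GBm N Y}.
Notation dfP := (DfP N Y).
Notation dfF := (DfF N Y).

Lemma df_imgW t u (g : set -> env -> set) : dfF t -> dfF u -> dfF (fun e => g (e 0) (fun i => e (S i))) ->
  dfF (fun e => imgW (t e) (u e) (fun x => g x e)).
Proof.
  intros Ht Hu Hg; unfold imgW.
  pose proof (dfF_ren _ _ _ S Ht) as Ht1; pose proof (dfF_ren _ _ _ (fun i => S (S i)) Ht) as Ht2.
  pose proof (dfF_ren _ _ _ (fun i => S (S (S i))) Hu) as Hu3.
  pose proof (dfF_ren _ _ _ (fun i => match i with 0 => 0 | S i => S (S i) end) Hg) as Hg1.
  pose proof (dfF_ren _ _ _ (fun i => match i with 0 => 0 | S i => S (S (S i)) end) Hg) as Hg2.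
  dfn; auto.
Qed.

Lemma df_lexW t u v w : dfF t -> dfF u -> dfF v -> dfF w -> dfF (fun e => lexW (t e) (u e) (v e) (w e)).
Proof.
  intros Ht Hu Hv Hw; unfold lexW.
  pose proof (dfF_ren _ _ _ S Hu) as Hu1; pose proof (dfF_ren _ _ _ S Hw) as Hw1.
  dfn; auto.
Qed.

Lemma df_omW : dfF (fun _ => omW).
Proof. unfold omW; dfn. Qed.

Lemma df_newat (h : set -> env -> set) t u : dfF (fun e => h (e 0) (fun i => e (S i))) -> dfF t -> dfF u ->
  dfP (fun e => newat (fun x => h x e) (t e) (u e)).
Proof.
  intros Hh Ht Hu; unfold newat.
  pose proof (dfF_ren _ _ _ S Ht) as Ht1.
  assert (H1 : dfF (fun e => h (u e) e)).
  { destruct Hh as [C D]; split.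
    - intros e He; apply (C (scons (u e) e)); apply scons_in; auto; apply Hu; auto.
    - apply (df_sub _ _ (fun x e => e 0 = h x (fun i => e (S i))) (fun e => u (fun i => e (S i)))).
      + exact (df_ren _ _ _ (fun i => match i with 0 => 1 | 1 => 0 | S i => S i end) D).
      + exact (dfF_ren _ _ _ S Hu). }
  dfn; auto.
Qed.

Lemma df_RU (h : set -> env -> set) t : dfF (fun e => h (e 0) (fun i => e (S i))) -> dfF t ->
  dfF (fun e => RU (t e) (fun x => h x e)).
Proof.
  intros Hh Ht; unfold RU.
  pose proof (dfF_ren _ _ _ S Ht) as Ht1.
  pose proof (dfF_ren _ _ _ (fun i => match i with 0 => 0 | S i => S (S i) end) Hh) as Hh1.
  pose proof (dfF_ren _ _ _ (fun i => match i with 0 => 0 | S i => S (S (S i)) end) Hh) as Hh2.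
  pose proof (dfF_ren _ _ _ (fun i => match i with 0 => 0 | S i => S (S (S (S i))) end) Hh) as Hh3.
  dfn; auto; try (apply (df_newat (fun x e => h x (fun i => e (S (S i))))); dfn; auto).
Qed.

Lemma df_BL Step t u : dfF (fun e => Step (e 0) (e 1)) -> dfF t -> dfF u ->
  dfF (fun e => BL Step (t e) (u e)).
Proof.
  intro H; apply df_orec; unfold BLF.
  apply (df_RU (fun z e => Step (e 0) (app (e 2) z))); dfn.
  apply (df_fun2 _ _ Step); dfn; auto.
Qed.

End DfWO.


(** * Definable subsets, generated by operations on relations *)

Definition definable (A x : set) : Prop :=
  exists (n : nat) (p : form) (e : env),
    elementary p = true /\ bounded (S n) 0 p = true /\ (forall i, i < n -> e i ∈ A) /\
    forall y, y ∈ A -> (y ∈ x <-> esat A (scons y e) (fun _ => emp) p).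

Definition Dfb (A : set) : set := sep (pow A) (definable A).

Definition memOf (A x : set) : Prop := x ∈ A.

Lemma Str_memOf A : trans A -> (exists x, x ∈ A) -> Str A (memOf A).
Proof. split; auto. Qed.

Lemma df_Dfb A x (P : env -> Prop) : DfP A (memOf A) P -> sub x A ->
  (forall y, y ∈ A -> (y ∈ x <-> P (fun _ => y))) -> x ∈ Dfb A.
Proof.
  intros (p & c & E & Hc & K) Sx H; apply mem_sep; split; [apply mem_pow; auto|].
  destruct (bounded_setvars p (fun _ => 0) (fun j => S j)) as [n Hn].
  exists n, (setvars (fun _ => 0) (fun j => S j) p), c.
  split; [apply elementary_setvars|]; split; [apply (bounded_mono _ n 0); auto|]; split; [intros; apply Hc|].
  intros y Hy; rewrite esat_setvars by auto; rewrite H by auto; symmetry; apply (K (fun _ => y)); auto.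
Qed.

(* A list over [A] is a nested pair ending in [emp], and a relation is a set
   of lists. *)
Definition rins (A R : set) : set :=
  sep (prod A (prod A (union (union R)))) (fun w => opair (fst w) (snd (snd w)) ∈ R).
Definition req (A R : set) : set := sep (prod A (prod A R)) (fun w => fst w = fst (snd w)).
Definition rmem (A R : set) : set := sep (prod A (prod A R)) (fun w => fst w ∈ fst (snd w)).
(** One operation for two purposes: with [T] all one-element lists it projects the first coordinate
    away, and with [T = sg a] it substitutes the parameter [a] there. *)
Definition rsect (A R T : set) : set :=
  sep (union (union R)) (fun l => exists a, a ∈ A /\ (opair a emp ∈ T /\ opair a l ∈ R)).
Definition rdiff (R T : set) : set := sep R (fun w => ~ w ∈ T).
Definition sg (a : set) : set := sing (opair a emp).
Definition unl (A R : set) : set := sep A (fun a => opair a emp ∈ R).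

(** Numbering the operations makes one closure step the image of a product of [omega] with two
    copies of the family, which carries a lexicographic well-order. Other numbers return [R]. *)
Definition op (A i R T : set) : set :=
  ite (i = num 1) (prod A R) (ite (i = num 2) (rdiff R T) (ite (i = num 3) (rins A R)
  (ite (i = num 4) (req A R) (ite (i = num 5) (rmem A R) (ite (i = num 6) (rsect A R T) R))))).
Lemma op_cases (Q : set -> Prop) A i R T : Q (prod A R) -> Q (rdiff R T) -> Q (rins A R) ->
  Q (req A R) -> Q (rmem A R) -> Q (rsect A R T) -> Q R -> Q (op A i R T).
Proof.
  assert (K : forall P a b, Q a -> Q b -> Q (ite P a b))
    by (intros; unfold ite; destruct excluded_middle_informative; assumption).
  intros; unfold op; repeat apply K; assumption.
Qed.
Definition opq (A q : set) : set := op A (fst q) (fst (snd q)) (snd (snd q)).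

(** [p] is the structure with its well-order, [I] the family generated so far with its order. An
    empty family signals stage 0, where the one-element lists of parameters are put in. *)
Definition StepI (p I : set) : set :=
  ite (fst I = emp)
    (opair (img (fst p) sg) (imgW (fst p) (snd p) sg))
    (opair (img (prod omega (prod (fst I) (fst I))) (opq (fst p)))
      (imgW (prod omega (prod (fst I) (fst I)))
            (lexW omega omW (prod (fst I) (fst I)) (lexW (fst I) (snd I) (fst I) (snd I)))
            (opq (fst p)))).
(** The empty structure is treated apart: it offers no lists to start from, yet has one definable
    subset, the empty one. *)
Definition StepO (_ I : set) : set :=
  ite (fst I = emp) (opair (sing emp) emp)
    (opair (img (fst (BL StepI I omega)) (unl (fst I)))
           (imgW (fst (BL StepI I omega)) (snd (BL StepI I omega)) (unl (fst I)))).

Lemma WO_StepI p I : WO (fst p) (snd p) -> WO (fst I) (snd I) -> WO (fst (StepI p I)) (snd (StepI p I)).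
Proof.
  intros Hp HI; unfold StepI, ite; destruct excluded_middle_informative;
    rewrite fst_opair, snd_opair; apply WO_img; auto using WO_lex, WO_omega.
Qed.

Lemma WO_StepO p I : WO (fst I) (snd I) -> WO (fst (StepO p I)) (snd (StepO p I)).
Proof.
  intros HI; unfold StepO, ite; destruct excluded_middle_informative; rewrite fst_opair, snd_opair.
  - split; [|split].
    + intros x y Hx Hy; apply mem_sing in Hx; apply mem_sing in Hy; left; congruence.
    + intro x; constructor; intros y Hy; destruct (mem_emp _ Hy).
    + intros x y H; destruct (mem_emp _ H).
  - apply WO_img, WO_BL; auto using ord_omega, WO_StepI.
Qed.

Section DfSteps.
Context {N : set} {Y : set -> Prop} {G : GBm N Y}.
Notation dfP := (DfP N Y).
Notation dfF := (DfF N Y).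

Lemma df_sg t : dfF t -> dfF (fun e => sg (t e)).
Proof. intros; unfold sg; dfn. Qed.
Lemma df_unl t u : dfF t -> dfF u -> dfF (fun e => unl (t e) (u e)).
Proof. apply (df_fun2 _ _ unl); unfold unl; dfn. Qed.
Lemma df_opq t u : dfF t -> dfF u -> dfF (fun e => opq (t e) (u e)).
Proof.
  apply (df_fun2 _ _ opq); unfold opq, op, rdiff, rins, req, rmem, rsect; dfn.
Qed.
End DfSteps.

Ltac dfx ::= lazymatch goal with
  | |- DfF _ _ (fun e => imgW _ _ _) => apply df_imgW
  | |- DfF _ _ (fun e => lexW _ _ _ _) => apply df_lexW
  | |- DfF _ _ (fun e => omW) => apply df_omW
  | |- DfF _ _ (fun e => sg _) => apply df_sg
  | |- DfF _ _ (fun e => unl _ _) => apply df_unl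
  | |- DfF _ _ (fun e => opq _ _) => apply df_opq
  | |- _ => dfb
  end.

Section DfSteps2.
Context {N : set} {Y : set -> Prop} {G : GBm N Y}.
Notation dfP := (DfP N Y).
Notation dfF := (DfF N Y).

Lemma df_StepI t u : dfF t -> dfF u -> dfF (fun e => StepI (t e) (u e)).
Proof. apply (df_fun2 _ _ StepI); unfold StepI; dfn. Qed.
Lemma df_StepO t u : dfF t -> dfF u -> dfF (fun e => StepO (t e) (u e)).
Proof.
  apply (df_fun2 _ _ StepO); unfold StepO; dfn; apply df_BL; dfn; apply df_StepI; dfn.
Qed.

End DfSteps2.

(** * The generated relations are exactly the definable ones *)

Section Family.
Variables (p : set).
Notation A := (fst p).
Hypothesis neA : exists a, a ∈ A.
Notation FF := (fst (BL StepI p omega)).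
Notation B k := (fst (BL StepI p (num k))).
Notation J k := (fst (StepI p (BL StepI p (num k)))).

Lemma mem_FF R : R ∈ FF <-> exists k, R ∈ J k.
Proof.
  rewrite BL_eq by apply ord_omega; unfold RU; rewrite fst_opair, mem_bigU; split.
  - intros (z & Hz & H); apply mem_omega in Hz; destruct Hz as [k ->]; eauto.
  - intros (k & H); eauto using num_omega.
Qed.

Lemma mem_B R k : R ∈ B k <-> exists i, i < k /\ R ∈ J i.
Proof.
  rewrite BL_eq by apply ord_num; unfold RU; rewrite fst_opair, mem_bigU; split.
  - intros (z & Hz & H); apply mem_num in Hz; destruct Hz as (i & Hi & ->); eauto.
  - intros (i & Hi & H); eauto using num_mem.
Qed.

Lemma mem_J0 R : R ∈ J 0 <-> exists a, a ∈ A /\ R = sg a.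
Proof.
  unfold StepI; rewrite ite_T; [rewrite fst_opair; apply mem_img|].
  apply set_ext; intro z; rewrite mem_B; split; [intros (i & Hi & _); lia|].
  intro H; destruct (mem_emp _ H).
Qed.

Lemma mem_JS R k : R ∈ J (S k) <->
  exists i T T', i ∈ omega /\ T ∈ B (S k) /\ T' ∈ B (S k) /\ R = op A i T T'.
Proof.
  unfold StepI; rewrite ite_F.
  - rewrite fst_opair, mem_img; split.
    + intros (q & Hq & ->); apply mem_prod in Hq; destruct Hq as (i & r & Hi & Hr & ->).
      apply mem_prod in Hr; destruct Hr as (T & T' & HT & HT' & ->).
      exists i, T, T'; unfold opq; rewrite !snd_opair, !fst_opair; auto.
    + intros (i & T & T' & Hi & HT & HT' & ->); exists (opair i (opair T T')).
      unfold opq; rewrite !snd_opair, !fst_opair; split; auto; rewrite !mem_prod_opair; auto.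
  - intro E; destruct neA as [a Ha]; apply (mem_emp (sg a)); rewrite <- E, mem_B.
    exists 0; split; [lia|]; apply mem_J0; eauto.
Qed.

Lemma FF_ind (Q : set -> Prop) : (forall a, a ∈ A -> Q (sg a)) ->
  (forall i T T', Q T -> Q T' -> Q (op A i T T')) -> forall R, R ∈ FF -> Q R.
Proof.
  intros H0 H1 R HR; apply mem_FF in HR; destruct HR as [k HR]; revert R HR.
  induction k as [k IH] using (well_founded_induction Nat.lt_wf_0); intros R HR; destruct k.
  - apply mem_J0 in HR; destruct HR as (a & Ha & ->); auto.
  - apply mem_JS in HR; destruct HR as (i & T & T' & _ & HT & HT' & ->).
    apply mem_B in HT; apply mem_B in HT'; destruct HT as (j & Hj & HT), HT' as (j' & Hj' & HT').
    apply H1; [apply (IH j)|apply (IH j')]; auto.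
Qed.

Lemma FF_sg a : a ∈ A -> sg a ∈ FF.
Proof. intro H; apply mem_FF; exists 0; apply mem_J0; eauto. Qed.

Lemma FF_op i T T' : T ∈ FF -> T' ∈ FF -> op A (num i) T T' ∈ FF.
Proof.
  intros H H'; apply mem_FF in H; apply mem_FF in H'; destruct H as [k H], H' as [k' H'].
  apply mem_FF; exists (S (k + k')); apply mem_JS; exists (num i), T, T'; repeat split; auto using num_omega;
    apply mem_B; [exists k|exists k']; split; auto; lia.
Qed.

Lemma FF_prod R : R ∈ FF -> prod A R ∈ FF.
Proof. intro H; pose proof (FF_op 1 R R H H) as K; unfold op in K; rewrite ite_T in K; auto. Qed.
Lemma ite_numF i j a b : i <> j -> ite (num i = num j) a b = b.
Proof. intro H; apply ite_F; intro K; apply H, num_inj, K. Qed.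
Ltac iteF K := rewrite ?ite_numF in K by discriminate; rewrite ite_T in K; auto.
Lemma FF_diff R T : R ∈ FF -> T ∈ FF -> rdiff R T ∈ FF.
Proof. intros H H'; pose proof (FF_op 2 R T H H') as K; unfold op in K; iteF K. Qed.
Lemma FF_ins R : R ∈ FF -> rins A R ∈ FF.
Proof. intros H; pose proof (FF_op 3 R R H H) as K; unfold op in K; iteF K. Qed.
Lemma FF_eq R : R ∈ FF -> req A R ∈ FF.
Proof. intros H; pose proof (FF_op 4 R R H H) as K; unfold op in K; iteF K. Qed.
Lemma FF_memr R : R ∈ FF -> rmem A R ∈ FF.
Proof. intros H; pose proof (FF_op 5 R R H H) as K; unfold op in K; iteF K. Qed.
Lemma FF_sect R T : R ∈ FF -> T ∈ FF -> rsect A R T ∈ FF.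
Proof. intros H H'; pose proof (FF_op 6 R T H H') as K; unfold op in K; iteF K. Qed.

Lemma mem_rsect l R T : l ∈ rsect A R T <-> exists a, a ∈ A /\ (opair a emp ∈ T /\ opair a l ∈ R).
Proof.
  unfold rsect; rewrite mem_sep; split; [tauto|]; intro H; split; auto.
  destruct H as (a & _ & _ & H); eapply mem_UU_r; eauto.
Qed.

Fixpoint tup (n : nat) : set := match n with 0 => sing emp | S n => prod A (tup n) end.
(** A list read as an environment. Entries past its end are irrelevant to formulas bounded by its
    length. *)
Definition unpack (l : set) : env := fun i => fst (Nat.iter i snd l).

Lemma unpack_cons a l : unpack (opair a l) = scons a (unpack l).
Proof.
  apply functional_extensionality; intros [|i]; unfold unpack, scons; [simpl; apply fst_opair|].
  rewrite Nat.iter_succ_r, snd_opair; auto.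
Qed.

Lemma FF_tup n : tup n ∈ FF.
Proof.
  induction n; simpl; auto using FF_prod; destruct neA as [a Ha].
  (* The relation true of the empty list alone is the section of [sg a] by itself; this uses an
     element of the structure. *)
  replace (sing emp) with (rsect A (sg a) (sg a)); [apply FF_sect; apply FF_sg; auto|].
  apply set_ext; intro l; rewrite mem_rsect, mem_sing; split.
  - intros (b & _ & _ & H); unfold sg in H; apply mem_sing in H; apply opair_inj in H; tauto.
  - intros ->; exists a; unfold sg; rewrite mem_sing; auto.
Qed.

Definition ran (R : set) : set := rsect A R (tup 1).
Lemma mem_ran l R : l ∈ ran R <-> exists a, a ∈ A /\ opair a l ∈ R.
Proof.
  unfold ran; rewrite mem_rsect; split; intros (a & Ha & H); exists a; split; auto; [tauto|split; auto].
  simpl; apply mem_prod_opair; rewrite mem_sing; auto.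
Qed.
Lemma FF_ran R : R ∈ FF -> ran R ∈ FF.
Proof. intro; apply FF_sect; auto using FF_tup. Qed.
Lemma FF_isect R T : R ∈ FF -> T ∈ FF -> isect R T ∈ FF.
Proof.
  intros; replace (isect R T) with (rdiff R (rdiff R T)); [auto using FF_diff|].
  apply set_ext; intro z; unfold rdiff; rewrite mem_isect, !mem_sep; split; [|tauto].
  intros [H1 H2]; split; auto; apply NNPP; tauto.
Qed.

Lemma tup_cons n l : l ∈ tup (S n) <-> exists a m, a ∈ A /\ m ∈ tup n /\ l = opair a m.
Proof. apply mem_prod. Qed.

(** A relation between the first two coordinates becomes one between the first and a later
    coordinate when [rins] inserts free coordinates in between. *)
Lemma FF_rel (C : set -> set -> Prop) :
  (forall n, sep (prod A (prod A (tup n))) (fun w => C (fst w) (fst (snd w))) ∈ FF) ->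
  forall n i, i < n -> sep (tup (S n)) (fun l => C (fst l) (unpack l (S i))) ∈ FF.
Proof.
  intro Base; induction n as [|n IH]; intros i Hi; [lia|]; destruct i.
  - exact (Base n).
  - replace (sep (tup (S (S n))) (fun l => C (fst l) (unpack l (S (S i))))) with
      (rins A (sep (tup (S n)) (fun l => C (fst l) (unpack l (S i))))); [apply FF_ins, IH; lia|].
    apply set_ext; intro l; split; intro H.
    + apply mem_sep in H; destruct H as [Hl H]; apply mem_prod in Hl; destruct Hl as (u & v & Hu & Hv & ->).
      apply mem_prod in Hv; destruct Hv as (b & m & Hb & Hm & ->).
      rewrite !fst_opair, !snd_opair in H; apply mem_sep in H; destruct H as [H K].
      simpl in H; apply mem_prod_opair in H; rewrite fst_opair, unpack_cons in K; simpl in K.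
      apply mem_sep; split; [simpl; rewrite !mem_prod_opair; tauto|].
      rewrite fst_opair, !unpack_cons; exact K.
    + apply mem_sep in H; destruct H as [Hl H]; apply tup_cons in Hl; destruct Hl as (u & v & Hu & Hv & ->).
      apply tup_cons in Hv; destruct Hv as (b & m & Hb & Hm & ->).
      rewrite fst_opair, !unpack_cons in H; simpl in H.
      assert (K : opair u m ∈ sep (tup (S n)) (fun l => C (fst l) (unpack l (S i)))).
      { apply mem_sep; split; [simpl; apply mem_prod_opair; auto|]; rewrite fst_opair, unpack_cons; exact H. }
      apply mem_sep; rewrite fst_opair, !snd_opair; split; [|exact K].
      apply mem_prod_opair; split; auto; apply mem_prod_opair; split; auto; eapply mem_UU_r; eauto.
Qed.

Lemma FF_E n i : i < n -> sep (tup (S n)) (fun l => fst l = unpack l (S i)) ∈ FF.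
Proof. apply (FF_rel eq); intro; apply FF_eq, FF_tup. Qed.
Lemma FF_M n i : i < n -> sep (tup (S n)) (fun l => fst l ∈ unpack l (S i)) ∈ FF.
Proof. apply (FF_rel mem); intro; apply FF_memr, FF_tup. Qed.

Lemma unpack_tup n : forall l i, l ∈ tup n -> i < n -> unpack l i ∈ A.
Proof.
  induction n; intros l i Hl Hi; [lia|]; apply tup_cons in Hl; destruct Hl as (a & m & Ha & Hm & ->).
  rewrite unpack_cons; destruct i; simpl; auto; apply IHn; auto; lia.
Qed.

Definition Rl (n : nat) (q : form) : set :=
  sep (tup n) (fun l => esat A (unpack l) (fun _ => emp) q).

(** Connectives are Boolean operations and quantifiers projections. For an atom on variables [x] and
    [y], a new first coordinate is made equal to the one at [x], related to the one at [y], and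
    projected away. *)
Lemma FF_Rl q : forall n, elementary q = true -> bounded n 0 q = true -> Rl n q ∈ FF.
Proof.
  assert (Tc : forall n a l, opair a l ∈ tup (S n) <-> a ∈ A /\ l ∈ tup n)
    by (intros; apply mem_prod_opair).
  assert (Cmp : forall n R, R ∈ FF -> rdiff (tup n) R ∈ FF) by (intros; apply FF_diff; auto using FF_tup).
  induction q; intros n E Bd; simpl in E, Bd; try discriminate;
    try (apply andb_prop in Bd; destruct Bd as [B1 B2]);
    try (apply andb_prop in E; destruct E as [E1 E2]).
  - apply Nat.ltb_lt in B1; apply Nat.ltb_lt in B2.
    replace (Rl n (fEq x y)) with (ran (isect (sep (tup (S n)) (fun l => fst l = unpack l (S x)))
                                       (sep (tup (S n)) (fun l => fst l = unpack l (S y)))));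
      [apply FF_ran, FF_isect; apply FF_E; auto|].
    apply set_ext; intro l; unfold Rl, esat; rewrite mem_ran, mem_sep; simpl Sat; split.
    + intros (a & Ha & H); apply mem_isect in H; rewrite !mem_sep, Tc, fst_opair, unpack_cons in H; simpl in H.
      destruct H as [[[_ Hl] H1] [_ H2]]; split; auto; congruence.
    + intros [Hl H]; exists (unpack l x); assert (Hx : unpack l x ∈ A) by (eapply unpack_tup; eauto).
      split; auto; apply mem_isect; rewrite !mem_sep, Tc, fst_opair, unpack_cons; simpl; auto.
  - apply Nat.ltb_lt in B1; apply Nat.ltb_lt in B2.
    replace (Rl n (fMem x y)) with (ran (isect (sep (tup (S n)) (fun l => fst l = unpack l (S x)))
                                       (sep (tup (S n)) (fun l => fst l ∈ unpack l (S y)))));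
      [apply FF_ran, FF_isect; [apply FF_E|apply FF_M]; auto|].
    apply set_ext; intro l; unfold Rl, esat; rewrite mem_ran, mem_sep; simpl Sat; split.
    + intros (a & Ha & H); apply mem_isect in H; rewrite !mem_sep, Tc, fst_opair, unpack_cons in H; simpl in H.
      destruct H as [[[_ Hl] H1] [_ H2]]; split; auto; congruence.
    + intros [Hl H]; exists (unpack l x); assert (Hx : unpack l x ∈ A) by (eapply unpack_tup; eauto).
      split; auto; apply mem_isect; rewrite !mem_sep, Tc, fst_opair, unpack_cons; simpl; auto.
  - discriminate.
  - replace (Rl n fBot) with (rdiff (tup n) (tup n)); [auto using FF_tup|].
    apply set_ext; intro l; unfold Rl, rdiff; rewrite !mem_sep; unfold esat; simpl; tauto.
  - replace (Rl n (fAnd q1 q2)) with (isect (Rl n q1) (Rl n q2)); [auto using FF_isect|].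
    apply set_ext; intro l; unfold Rl; rewrite mem_isect, !mem_sep; unfold esat; simpl; tauto.
  - replace (Rl n (fOr q1 q2)) with (rdiff (tup n) (rdiff (rdiff (tup n) (Rl n q1)) (Rl n q2)));
      [auto using FF_diff|].
    apply set_ext; intro l; unfold Rl, rdiff; rewrite !mem_sep; unfold esat; simpl.
    split; [intros [H K]; split; auto; apply NNPP|]; tauto.
  - replace (Rl n (fImp q1 q2)) with (rdiff (tup n) (rdiff (Rl n q1) (Rl n q2))); [auto using FF_diff|].
    apply set_ext; intro l; unfold Rl, rdiff; rewrite !mem_sep; unfold esat; simpl.
    split; [intros [H K]; split; auto; intro; apply NNPP|]; tauto.
  - replace (Rl n (fAll q)) with (rdiff (tup n) (ran (rdiff (tup (S n)) (Rl (S n) q)))); [auto using FF_ran|].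
    apply set_ext; intro l; unfold Rl at 2, rdiff at 1; rewrite !mem_sep, mem_ran; unfold esat; simpl Sat.
    split; intros [Hl H]; split; auto.
    + intros a Ha; apply NNPP; intro K; apply H; exists a; split; auto; apply mem_sep; rewrite Tc; split; auto.
      intro L; apply mem_sep in L; destruct L as [_ L]; unfold esat in L; rewrite unpack_cons in L; auto.
    + intros (a & Ha & K); apply mem_sep in K; destruct K as [K L]; apply L; apply mem_sep; split; auto.
      unfold esat; rewrite unpack_cons; auto.
  - replace (Rl n (fEx q)) with (ran (Rl (S n) q)); [auto using FF_ran|].
    apply set_ext; intro l; unfold Rl at 2; rewrite !mem_sep, mem_ran; unfold esat; simpl Sat; split.
    + intros (a & Ha & K); apply mem_sep in K; destruct K as [K L]; apply Tc in K; split; [tauto|].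
      exists a; split; auto; unfold esat in L; rewrite unpack_cons in L; auto.
    + intros [Hl (a & Ha & H)]; exists a; split; auto; apply mem_sep; rewrite Tc; split; auto.
      unfold esat; rewrite unpack_cons; auto.
Qed.

Fixpoint pre (n : nat) (e : env) (l : set) : set :=
  match n with 0 => l | S n => opair (e 0) (pre n (fun i => e (S i)) l) end.

(** Parameters are substituted one at a time, each by a section with [sg] of the parameter. *)
Lemma FF_pre n : forall (e : env) R, R ∈ FF -> (forall i, i < n -> e i ∈ A) ->
  exists R', R' ∈ FF /\ forall l, l ∈ R' <-> pre n e l ∈ R.
Proof.
  induction n; intros e R HR He; [exists R; split; [auto|tauto]|].
  destruct (IHn (fun i => e (S i)) (rsect A R (sg (e 0)))) as (R' & HR' & K).
  - apply FF_sect; auto; apply FF_sg, He; lia.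
  - intros; apply He; lia.
  - exists R'; split; auto; intro l; rewrite K, mem_rsect; simpl; split.
    + intros (a & _ & H & H'); unfold sg in H; apply mem_sing, opair_inj in H; destruct H; subst; auto.
    + intro H; exists (e 0); split; [apply He; lia|]; unfold sg; rewrite mem_sing; auto.
Qed.

Lemma pre_tup n : forall e y, (forall i, i < n -> e i ∈ A) -> y ∈ A -> pre n e (opair y emp) ∈ tup (S n).
Proof.
  induction n; intros e y He Hy.
  - apply mem_prod_opair; split; auto; apply mem_sing; auto.
  - apply mem_prod_opair; split; [apply He; lia|]; apply IHn; auto; intros; apply He; lia.
Qed.

Lemma unpack_pre n : forall e y, (forall i, i < n -> unpack (pre n e (opair y emp)) i = e i) /\
  unpack (pre n e (opair y emp)) n = y.
Proof.
  induction n; intros e y; simpl pre; rewrite unpack_cons; [split; [lia|auto]|].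
  destruct (IHn (fun i => e (S i)) y) as [H K]; split; [|exact K].
  intros [|i] Hi; simpl; auto; apply H; lia.
Qed.

Lemma definable_unl x : sub x A -> definable A x -> exists R, R ∈ FF /\ x = unl A R.
Proof.
  intros Sx (n & q & e & E & Bd & He & H).
  (* Sections consume coordinates from the front, so the variable of the subset is moved behind the
     [n] parameters. *)
  pose (s := fun k => match k with 0 => n | S k => k end).
  assert (Bs : bounded (S n) 0 (ren s idn q) = true).
  { apply (bounded_ren q (S n) 0); auto; intros [|i] Hi; simpl; lia. }
  destruct (FF_pre n e _ (FF_Rl _ (S n) (eq_trans (elementary_ren _ _ _) E) Bs) He) as (R & HR & K).
  exists R; split; auto; apply set_ext; intro y; unfold unl; rewrite mem_sep, K; unfold Rl; rewrite mem_sep.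
  assert (Eq : y ∈ A -> (y ∈ x <-> esat A (unpack (pre n e (opair y emp))) (fun _ => emp)
                  (ren s idn q))).
  { intro Hy; rewrite H by auto; unfold esat; rewrite Sat_ren; destruct (unpack_pre n e y) as [U1 U2].
    apply Sat_bounded with (n := S n) (m := 0); auto; intros i Hi.
    destruct i; simpl; [auto|]; rewrite U1; auto; lia. }
  split.
  - intro Hx; assert (y ∈ A) by auto; repeat split; auto; [apply pre_tup; auto|apply Eq; auto].
  - intros (Hy & _ & L); apply Eq; auto.
Qed.

Fixpoint lst (n : nat) (e : env) : set :=
  match n with 0 => emp | S n => opair (e 0) (lst n (fun i => e (S i))) end.

Hypothesis trA : trans A.

Lemma opair_emp x y : opair x y <> emp.
Proof. intro E; apply (mem_emp (upair x x)); rewrite <- E; apply mem_upair; auto. Qed.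

Lemma emp_prod A1 A2 : ~ emp ∈ prod A1 A2.
Proof. intro H; apply mem_prod in H; destruct H as (x & y & _ & _ & E); symmetry in E; apply (opair_emp _ _ E). Qed.

(** Induction on the generation of [R]. A generated set has no declared arity, hence the statement
    for all lengths [n]; lengths for which no list can belong to the set give the false
    predicate. *)
Lemma df_lst R : R ∈ FF -> forall n, DfP A (memOf A) (fun e => lst n e ∈ R).
Proof.
  assert (St : Str A (memOf A)) by (apply Str_memOf; auto).
  assert (Fls : forall P : env -> Prop, (forall e, inN A e -> ~ P e) -> DfP A (memOf A) P).
  { intros P HP; apply (df_ext _ _ (fun _ => False)); [|apply df_const; auto].
    intros e He; specialize (HP e He); tauto. }
  revert R; apply (FF_ind (fun R => forall n, DfP A (memOf A) (fun e => lst n e ∈ R))).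
  - intros a Ha [|[|n]]; unfold sg.
    + apply Fls; intros e He H; apply mem_sing in H; symmetry in H; apply (opair_emp _ _ H).
    + apply (df_ext _ _ (fun e => e 0 = a)).
      * intros e He; rewrite mem_sing; simpl; split; [intros ->; auto|]; intro H; apply opair_inj in H; tauto.
      * apply df_eq; auto; [apply df_var|apply df_cst]; auto.
    + apply Fls; intros e He H; apply mem_sing in H; apply opair_inj in H; destruct H as [_ H].
      apply (opair_emp _ _ H).
  - intros i T T' HT HT' n.
    apply (op_cases (fun R => DfP A (memOf A) (fun e => lst n e ∈ R))).
    + destruct n; simpl; [apply Fls; intros; apply emp_prod|].
      apply (df_ext _ _ (fun e => lst n (fun i => e (S i)) ∈ T)).
      * intros e0 He; rewrite mem_prod_opair; specialize (He 0); tauto.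
      * exact (df_ren _ _ _ S (HT n)).
    + apply (df_ext _ _ (fun e => lst n e ∈ T /\ ~ lst n e ∈ T')).
      * intros e0 He; unfold rdiff; rewrite mem_sep; tauto.
      * apply df_and; [|apply df_not]; auto.
    + destruct n as [|[|n]]; simpl.
      * apply Fls; intros e0 He H; apply mem_sep in H; destruct H as [H _]; apply (emp_prod _ _ H).
      * apply Fls; intros e0 He H; apply mem_sep in H; destruct H as [H _].
        apply mem_prod_opair in H; destruct H as [_ H]; apply (emp_prod _ _ H).
      * apply (df_ext _ _ (fun e => lst (S n) (fun i => e (match i with 0 => 0 | S i => S (S i) end)) ∈ T)).
        -- intros e0 He; unfold rins; rewrite mem_sep, fst_opair, !snd_opair, !mem_prod_opair; simpl.
           split; [|tauto]; intro H; repeat split; auto; eapply mem_UU_r; eauto.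
        -- exact (df_ren _ _ _ _ (HT (S n))).
    + destruct n as [|[|n]]; simpl.
      * apply Fls; intros e0 He H; apply mem_sep in H; destruct H as [H _]; apply (emp_prod _ _ H).
      * apply Fls; intros e0 He H; apply mem_sep in H; destruct H as [H _].
        apply mem_prod_opair in H; destruct H as [_ H]; apply (emp_prod _ _ H).
      * apply (df_ext _ _ (fun e => lst n (fun i => e (S (S i))) ∈ T /\ e 0 = e 1)).
        -- intros e0 He; unfold req; rewrite mem_sep, !fst_opair, !snd_opair, !mem_prod_opair, fst_opair.
           pose proof (He 0); pose proof (He 1); tauto.
        -- apply df_and; [exact (df_ren _ _ _ (fun i => S (S i)) (HT n))|apply df_eqv; auto].
    + destruct n as [|[|n]]; simpl.
      * apply Fls; intros e0 He H; apply mem_sep in H; destruct H as [H _]; apply (emp_prod _ _ H).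
      * apply Fls; intros e0 He H; apply mem_sep in H; destruct H as [H _].
        apply mem_prod_opair in H; destruct H as [_ H]; apply (emp_prod _ _ H).
      * apply (df_ext _ _ (fun e => lst n (fun i => e (S (S i))) ∈ T /\ e 0 ∈ e 1)).
        -- intros e0 He; unfold rmem; rewrite mem_sep, !fst_opair, !snd_opair, !mem_prod_opair, fst_opair.
           pose proof (He 0); pose proof (He 1); tauto.
        -- apply df_and; [exact (df_ren _ _ _ (fun i => S (S i)) (HT n))|apply df_memv; auto].
    + apply (df_ext _ _ (fun e => exists a, a ∈ A /\ (lst 1 (scons a e) ∈ T' /\ lst (S n) (scons a e) ∈ T))).
      * intros e0 He; rewrite mem_rsect; reflexivity.
      * apply (df_ex _ _ (fun a e => lst 1 (scons a e) ∈ T' /\ lst (S n) (scons a e) ∈ T)).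
        apply df_and; [apply (df_ext _ _ (fun e => lst 1 e ∈ T'))|apply (df_ext _ _ (fun e => lst (S n) e ∈ T))];
          auto; intros e0 He; rewrite scons_eta; reflexivity.
    + apply HT.
Qed.

End Family.

(** Ties the recursion to the definable power set: [df_lst] shows that generated sets are definable,
    [definable_unl] that definable sets are generated. *)
Lemma StepO_Dfb p I : trans (fst I) -> fst (StepO p I) = Dfb (fst I).
Proof.
  intro T; unfold StepO, ite; destruct excluded_middle_informative as [E|E]; rewrite fst_opair.
  - rewrite E; apply set_ext; intro x; unfold Dfb; rewrite mem_sing, mem_sep, mem_pow; split.
    + intros ->; split; [intros z Hz; auto|]; exists 0, fBot, (fun _ => emp); repeat split; auto; try lia;
        intros; destruct (mem_emp _ H).
    + intros [H _]; apply set_ext; intro z; split; intro Hz; [auto|destruct (mem_emp _ Hz)].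
  - assert (ne : exists a, a ∈ fst I).
    { apply NNPP; intro K; apply E, set_ext; intro z; split; intro Hz; [destruct K; eauto|destruct (mem_emp _ Hz)]. }
    apply set_ext; intro x; rewrite mem_img; split.
    + intros (R & HR & ->); apply (df_Dfb _ _ (fun e => lst 1 e ∈ R)).
      * apply df_lst; auto.
      * intros z Hz; apply mem_sep in Hz; tauto.
      * intros y Hy; unfold unl; rewrite mem_sep; simpl; tauto.
    + intro H; apply mem_sep in H; destruct H as [H K]; apply definable_unl; auto; apply mem_pow; auto.
Qed.


(** * The constructible hierarchy *)

(** Levels and their well-orders come out of a single recursion. As instances of [orec] both are
    definable in every model of GB, with values computed once and for all in the ambient universe;
    this is the absoluteness of the constructible hierarchy. *)
Definition Lv (xi : set) : set := fst (BL StepO emp xi).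
Definition Lw (xi : set) : set := snd (BL StepO emp xi).

Lemma mem_Lv0 xi x : ord xi -> (x ∈ Lv xi <-> exists z, z ∈ xi /\ x ∈ fst (StepO emp (BL StepO emp z))).
Proof. intro O; unfold Lv; rewrite BL_eq by auto; unfold RU; rewrite fst_opair, mem_bigU; tauto. Qed.

Lemma Lv_mono xi z : ord xi -> z ∈ xi -> sub (Lv z) (Lv xi).
Proof.
  intros O Hz x Hx; apply mem_Lv0 in Hx; [|eapply ord_mem; eauto]; apply mem_Lv0; auto.
  destruct Hx as (u & Hu & Hx); exists u; split; auto; eapply ord_trans; eauto.
Qed.

Lemma Lv_trans xi : ord xi -> trans (Lv xi).
Proof.
  induction xi as [xi IH] using mem_ind; intros O y Hy z Hz.
  apply mem_Lv0 in Hy; auto; destruct Hy as (u & Hu & Hy).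
  assert (Ou : ord u) by (eapply ord_mem; eauto).
  rewrite StepO_Dfb in Hy by (apply IH; auto); apply mem_sep in Hy; destruct Hy as [Hy _].
  apply (Lv_mono xi u O Hu); apply (proj1 (mem_pow _ _) Hy z Hz).
Qed.

Lemma mem_Lv xi x : ord xi -> (x ∈ Lv xi <-> exists z, z ∈ xi /\ x ∈ Dfb (Lv z)).
Proof.
  intro O; rewrite mem_Lv0 by auto; split; intros (z & Hz & H); exists z; split; auto.
  - rewrite StepO_Dfb in H; auto; apply Lv_trans; eapply ord_mem; eauto.
  - rewrite StepO_Dfb; auto; apply Lv_trans; eapply ord_mem; eauto.
Qed.

Lemma Dfb_self A : A ∈ Dfb A.
Proof.
  apply mem_sep; split; [apply mem_pow; intro; auto|].
  exists 0, (fImp fBot fBot), (fun _ => emp); split; [reflexivity|]; split; [reflexivity|].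
  split; [intros i Hi; inversion Hi|]; intros y Hy; unfold esat; simpl; split; auto.
Qed.

Lemma Lv_ord xi x : ord xi -> x ∈ Lv xi -> ord x -> x ∈ xi.
Proof.
  revert x; induction xi as [xi IH] using mem_ind; intros x O Hx Ox.
  apply mem_Lv in Hx; auto; destruct Hx as (z & Hz & Hx); assert (Oz : ord z) by exact (ord_mem _ _ O Hz).
  apply mem_sep in Hx; destruct Hx as [Hx _]; pose proof (proj1 (mem_pow _ _) Hx) as Sx.
  destruct (ord_sub x z Ox Oz) as [->|K]; auto; [|exact (ord_trans _ _ _ O K Hz)].
  intros y Hy; apply IH; auto; exact (ord_mem _ _ Ox Hy).
Qed.

Lemma esat_fOrd A e c i : trans A -> e i ∈ A -> (esat A e c (fOrd i) <-> ord (e i)).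
Proof.
  intros T Hi; unfold esat; simpl; split.
  - intros [H K]; split.
    + intros y Hy z Hz; assert (Ay : y ∈ A) by (eapply T; eauto).
      apply (H y Ay Hy z); auto; eapply T; eauto.
    + intros y Hy; assert (Ay : y ∈ A) by (eapply T; eauto); intros z Hz w Hw.
      assert (Az : z ∈ A) by (eapply T; eauto); apply (K y Ay Hy z Az Hz w); auto; eapply T; eauto.
  - intros [H K]; split.
    + intros y Ay Hy z Az Hz; eapply H; eauto.
    + intros y Ay Hy z Az Hz w Aw Hw; eapply K; eauto.
Qed.

(** [z] consists of precisely the ordinals of [Lv z], which [fOrd] defines over that transitive
    level. *)
Lemma ord_Dfb z : ord z -> z ∈ Dfb (Lv z).
Proof.
  induction z as [z IH] using mem_ind; intro O.
  assert (S1 : sub z (Lv z)).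
  { intros y Hy; apply mem_Lv; auto; exists y; split; auto; apply IH; auto; eapply ord_mem; eauto. }
  apply mem_sep; split; [apply mem_pow; auto|].
  exists 0, (fOrd 0), (fun _ => emp); split; [reflexivity|]; split; [reflexivity|].
  split; [intros; lia|]; intros y Hy; split.
  - intro H'; apply esat_fOrd; simpl; auto using Lv_trans; eapply ord_mem; eauto.
  - intro H'; apply esat_fOrd in H'; simpl in *; auto using Lv_trans; apply Lv_ord; auto.
Qed.

Lemma isect_Dfb A a b : trans A -> a ∈ A -> b ∈ A -> isect a b ∈ Dfb A.
Proof.
  intros T Ha Hb; assert (St : Str A (memOf A)) by (apply Str_memOf; eauto).
  apply (df_Dfb _ _ (fun e => e 0 ∈ a /\ e 0 ∈ b)).
  - apply df_and; apply df_cls; auto; apply df_var; auto.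
  - intros z Hz; apply mem_isect in Hz; eapply T; eauto; tauto.
  - intros y Hy; apply mem_isect.
Qed.

Lemma upair_Dfb A a b : trans A -> a ∈ A -> b ∈ A -> upair a b ∈ Dfb A.
Proof.
  intros T Ha Hb; assert (St : Str A (memOf A)) by (apply Str_memOf; eauto).
  apply (df_Dfb _ _ (fun e => e 0 = a \/ e 0 = b)).
  - apply df_or; apply df_eq; auto; try apply df_var; auto; apply df_cst; auto.
  - intros z Hz; apply mem_upair in Hz; destruct Hz; subst; auto.
  - intros y Hy; apply mem_upair.
Qed.

Definition limit (g : set) : Prop := emp ∈ g /\ forall z, z ∈ g -> succ z ∈ g.

Lemma mem_Lv_limit g x : ord g -> limit g -> (x ∈ Lv g <-> exists z, z ∈ g /\ x ∈ Lv z).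
Proof.
  intros O [_ L]; split.
  - intro H; apply mem_Lv in H; auto; destruct H as (z & Hz & H); exists (succ z); split; auto.
    apply mem_Lv; [apply ord_succ; eapply ord_mem; eauto|]; exists z; split; auto; apply mem_succ; auto.
  - intros (z & Hz & H); eapply Lv_mono; eauto.
Qed.

Lemma Lv_join g x y : ord g -> limit g -> x ∈ Lv g -> y ∈ Lv g -> exists z, z ∈ g /\ x ∈ Lv z /\ y ∈ Lv z.
Proof.
  intros O L Hx Hy; apply mem_Lv_limit in Hx; auto; apply mem_Lv_limit in Hy; auto.
  destruct Hx as (u & Hu & Hx), Hy as (v & Hv & Hy).
  destruct (ord_total u v) as [E|[E|E]]; try (eapply ord_mem; eauto).
  - exists v; repeat split; auto; eapply Lv_mono; eauto; eapply ord_mem; eauto.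
  - subst; eauto.
  - exists u; repeat split; auto; eapply Lv_mono; eauto; eapply ord_mem; eauto.
Qed.

Lemma Lv_Dfb g z x : ord g -> z ∈ g -> x ∈ Dfb (Lv z) -> x ∈ Lv g.
Proof. intros; apply mem_Lv; eauto. Qed.

Lemma Lv_upair g x y : ord g -> limit g -> x ∈ Lv g -> y ∈ Lv g -> upair x y ∈ Lv g.
Proof.
  intros O L Hx Hy; destruct (Lv_join g x y O L Hx Hy) as (z & Hz & Hx' & Hy').
  apply (Lv_Dfb g z); auto; apply upair_Dfb; auto; apply Lv_trans; eapply ord_mem; eauto.
Qed.

Lemma Lv_opair g x y : ord g -> limit g -> x ∈ Lv g -> y ∈ Lv g -> opair x y ∈ Lv g.
Proof. intros; repeat apply Lv_upair; auto. Qed.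

Lemma Lv_isect g x y : ord g -> limit g -> x ∈ Lv g -> y ∈ Lv g -> isect x y ∈ Lv g.
Proof.
  intros O L Hx Hy; destruct (Lv_join g x y O L Hx Hy) as (z & Hz & Hx' & Hy').
  apply (Lv_Dfb g z); auto; apply isect_Dfb; auto; apply Lv_trans; eapply ord_mem; eauto.
Qed.

Lemma Lv_ord_in g z : ord g -> z ∈ g -> z ∈ Lv g.
Proof. intros O H; apply (Lv_Dfb g z); auto; apply ord_Dfb; eapply ord_mem; eauto. Qed.

Lemma Lv_Lv g z : ord g -> z ∈ g -> Lv z ∈ Lv g.
Proof. intros O H; apply (Lv_Dfb g z); auto; apply Dfb_self. Qed.

Lemma Lv_emp g : ord g -> limit g -> emp ∈ Lv g.
Proof. intros O [L _]; apply Lv_ord_in; auto. Qed.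

Lemma unpack_emp : unpack emp = fun _ => emp.
Proof.
  apply functional_extensionality; intro i; unfold unpack.
  assert (U : union emp = emp).
  { apply set_ext; intro z; split; intro H; [apply mem_union in H; destruct H as (y & H & _)|];
      destruct (mem_emp _ H). }
  assert (K : forall P, union (sep (union emp) P) = emp).
  { intro P; apply set_ext; intro z; split; intro H; [|destruct (mem_emp _ H)].
    apply mem_union in H; destruct H as (y & H & _); apply mem_sep in H; rewrite U in H.
    destruct H as [H _]; destruct (mem_emp _ H). }
  assert (E : forall j, Nat.iter j snd emp = emp) by (induction j; simpl; auto; rewrite IHj; apply K).
  rewrite E; apply K.
Qed.

Lemma unpack_pre_emp n : forall e i, unpack (pre n e emp) i = if i <? n then e i else emp.
Proof.
  induction n; intros e i; simpl pre; [rewrite unpack_emp; auto|].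
  rewrite unpack_cons; destruct i; simpl; auto; rewrite IHn; auto.
Qed.

(** * Reflection and amenability *)

Section Constructible.
Context {N : set} {Y : set -> Prop} {G : GBm N Y}.
Notation dfP := (DfP N Y).
Notation dfF := (DfF N Y).

Definition height (M : set) : set := sep M ord.
Notation al := (height N).
Notation LA := (Lv (height N)).

Lemma mem_al z : z ∈ al <-> z ∈ N /\ ord z.
Proof. apply mem_sep. Qed.

Lemma trN : trans N.
Proof. exact gb_trans. Qed.

Lemma ord_al : ord al.
Proof.
  split.
  - intros y Hy z Hz; apply mem_al in Hy; destruct Hy as [Ny Oy]; apply mem_al; split.
    + exact (trN y Ny z Hz).
    + exact (ord_mem _ _ Oy Hz).
  - intros y Hy; apply mem_al in Hy; exact (proj1 (proj2 Hy)).
Qed.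

Lemma gb_succ z : z ∈ N -> succ z ∈ N.
Proof. intro; repeat first [apply gb_union | apply gb_pair]; auto. Qed.

Lemma limit_al : limit al.
Proof.
  split; [apply mem_al; split; [apply gb_emp|apply ord_emp]|].
  intros z Hz; apply mem_al in Hz; destruct Hz; apply mem_al; split; auto using gb_succ, ord_succ.
Qed.

Lemma df_Lv t : dfF t -> dfF (fun e => Lv (t e)).
Proof. intro; unfold Lv; apply df_fst, df_BL; dfn; apply df_StepO; dfn. Qed.
Lemma df_Lw t : dfF t -> dfF (fun e => Lw (t e)).
Proof. intro; unfold Lw; apply df_snd, df_BL; dfn; apply df_StepO; dfn. Qed.

Lemma gb_Lv z : z ∈ N -> Lv z ∈ N.
Proof. intro H; apply (proj1 (df_Lv _ (df_var N Y 0)) (fun _ => z)); auto. Qed.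

Lemma LA_sub : sub LA N.
Proof.
  intros x Hx; apply mem_Lv_limit in Hx; auto using ord_al, limit_al; destruct Hx as (z & Hz & Hx).
  apply mem_al in Hz; eapply trN; [|exact Hx]; apply gb_Lv; tauto.
Qed.

Lemma LA_class : Y LA.
Proof.
  replace LA with (sep N (fun x => exists z, z ∈ N /\ (ord z /\ x ∈ Lv z))).
  - apply gb_class1; dfn; apply df_Lv; dfn.
  - apply set_ext; intro x; rewrite mem_sep, mem_Lv_limit by auto using ord_al, limit_al; split.
    + intros (_ & z & Hz & Oz & H); exists z; rewrite mem_al; auto.
    + intros (z & Hz & H); apply mem_al in Hz; destruct Hz as [Nz Oz]; split; eauto.
      eapply trN; [|exact H]; apply gb_Lv; auto.
Qed.

(** * Closed unbounded sets of levels *)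

Definition closed (f : set -> set) (g : set) : Prop := forall z, z ∈ g -> f z ∈ g.
(** [K] holds on a club of the height: at every limit ordinal closed under one definable function.
    Finite intersections and unboundedness are then statements about functions. *)
Definition big (K : set -> Prop) : Prop :=
  exists f, dfF (fun e => f (e 0)) /\ (forall z, z ∈ al -> f z ∈ al) /\
    forall g, g ∈ al -> limit g -> closed f g -> K g.

Lemma big_imp (K K' : set -> Prop) : (forall g, g ∈ al -> limit g -> K g -> K' g) -> big K -> big K'.
Proof. intros H (f & Df & Cf & Kf); exists f; split; [|split]; auto. Qed.

Lemma ord_cup_l g a b : ord g -> ord a -> ord b -> cup a b ∈ g -> a ∈ g.
Proof.
  intros Og Oa Ob H; destruct (ord_sub a (cup a b) Oa) as [->|K]; auto.
  - apply ord_cup; auto.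
  - intros z Hz; apply mem_cup; auto.
  - eapply ord_trans; eauto.
Qed.

Lemma cup_comm a b : cup a b = cup b a.
Proof. apply set_ext; intro; rewrite !mem_cup; tauto. Qed.

Lemma al_cup a b : a ∈ al -> b ∈ al -> cup a b ∈ al.
Proof.
  intros Ha Hb; apply mem_al in Ha; apply mem_al in Hb; apply mem_al; split.
  - apply gb_union, gb_pair; tauto.
  - apply ord_cup; tauto.
Qed.

(** The union of two ordinals is their maximum, so closure under the union of the two functions
    gives closure under each. *)
Lemma big_and K K' : big K -> big K' -> big (fun g => K g /\ K' g).
Proof.
  intros (f & Df & Cf & Kf) (h & Dh & Ch & Kh); exists (fun z => cup (f z) (h z)); split; [|split].
  - dfn.
  - intros z Hz; apply al_cup; auto.
  - intros g Hg Lg C.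
    assert (Og : ord g) by exact (ord_mem _ _ ord_al Hg).
    assert (O : forall z, z ∈ g -> ord (f z) /\ ord (h z)).
    { intros z Hz; assert (Az : z ∈ al) by exact (ord_trans _ _ _ ord_al Hz Hg).
      split; [exact (ord_mem _ _ ord_al (Cf z Az))|exact (ord_mem _ _ ord_al (Ch z Az))]. }
    split; [apply Kf|apply Kh]; auto; intros z Hz; destruct (O z Hz); specialize (C z Hz); cbn in C.
    + apply (ord_cup_l g (f z) (h z)); auto.
    + rewrite cup_comm in C; apply (ord_cup_l g (h z) (f z)); auto.
Qed.

Lemma big_gt d : d ∈ al -> big (fun g => d ∈ g).
Proof.
  intro Hd; exists (fun _ => d); split; [|split]; auto.
  - apply df_gcst; apply mem_al in Hd; tauto.
  - intros g Hg Lg C; apply (C emp); apply Lg.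
Qed.

Lemma big_all (K : nat -> set -> Prop) n : (forall i, i < n -> big (K i)) ->
  big (fun g => forall i, i < n -> K i g).
Proof.
  induction n; intro H.
  - apply (big_imp (fun g => emp ∈ g)); [intros; lia|]; apply big_gt, limit_al.
  - apply (big_imp (fun g => (forall i, i < n -> K i g) /\ K n g)).
    + intros g _ _ [H1 H2] i Hi; assert (i < n \/ i = n) as [|] by lia; subst; auto.
    + apply big_and; auto.
Qed.

(** The closure of [d] under [f] and successor is reached after [omega] rounds. The rounds form a
    recursion inside [N], which keeps their supremum below the height. *)
Lemma big_unbounded K d : big K -> d ∈ al -> exists g, g ∈ al /\ limit g /\ d ∈ g /\ K g.
Proof.
  intros (f & Df & Cf & Kf) Hd.
  (* One round: 0 and [d] become elements, and for each [z] in [a] so do [succ z] and [f z]. The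
     extra successors turn bounds into members. *)
  pose (T := fun d a => cup (cup (num 1) (succ d)) (bigU a (fun z => cup (succ (succ z)) (succ (f z))))).
  pose (F := fun d xi h => bigU xi (fun z => T d (app h z))).
  assert (DF : dfF (fun e => F (e 0) (e 1) (e 2))).
  { unfold F, T; dfn; apply (df_fun1 _ _ f); dfn. }
  pose (H := orec F d).
  assert (EH : forall z, ord z -> H z = bigU z (fun u => T d (H u))).
  { intros z O; unfold H, orec; rewrite ite_T by auto; rewrite mrec_eq; unfold F at 1, bigU; f_equal.
    apply img_ext; intros u Hu; rewrite app_graph by auto; rewrite ite_T; auto; eapply ord_mem; eauto. }
  assert (NH : forall z, z ∈ N -> H z ∈ N).
  { intros z Hz; apply mem_al in Hd; destruct Hd.
    apply (proj1 (df_orec F DF _ _ (df_var N Y 0) (df_var N Y 1)) (scons d (fun _ => z))); intros [|i]; auto. }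
  pose proof Hd as Hd'; apply mem_al in Hd'; destruct Hd' as [Nd Od].
  assert (AH : forall z, ord z -> z ∈ N -> H z ∈ al).
  { induction z as [z IH] using mem_ind; intros Oz Nz; apply mem_al; split; auto; rewrite EH by auto.
    apply ord_bigU; intros u Hu; unfold T; apply ord_cup; [apply ord_cup; auto using ord_succ; apply (ord_num 1)|].
    assert (Au : H u ∈ al) by (apply IH; auto; [eapply ord_mem; eauto|eapply trN; eauto]).
    apply ord_bigU; intros v Hv; assert (Av : v ∈ al) by (eapply ord_trans; [apply ord_al| |]; eauto).
    specialize (Cf v Av); apply mem_al in Cf; apply mem_al in Av; apply ord_cup; repeat apply ord_succ; tauto. }
  assert (Step : forall n x, x ∈ T d (H (num n)) -> x ∈ H (num (S n))).
  { intros n x Hx; rewrite EH by apply ord_num; apply mem_bigU; exists (num n); split; auto.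
    apply mem_succ; auto. }
  assert (Lim : forall n x, x ∈ T d (H (num n)) -> x ∈ H omega).
  { intros n x Hx; rewrite EH by apply ord_omega; apply mem_bigU; exists (num n); auto using num_omega. }
  assert (Inv : forall x, x ∈ H omega -> exists n, x ∈ T d (H (num n))).
  { intros x Hx; rewrite EH in Hx by apply ord_omega; apply mem_bigU in Hx; destruct Hx as (z & Hz & Hx).
    apply mem_omega in Hz; destruct Hz as [n ->]; eauto. }
  assert (B : forall x z, x ∈ H omega -> z ∈ cup (succ (succ x)) (succ (f x)) -> z ∈ H omega).
  { intros x z Hx Hz; destruct (Inv x Hx) as [n Hn]; apply Step in Hn; apply (Lim (S n)).
    unfold T; apply mem_cup; right; apply mem_bigU; eauto. }
  exists (H omega); assert (A1 : H omega ∈ al) by (apply AH; [apply ord_omega|apply gb_omega]).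
  assert (L : limit (H omega)).
  { split.
    - apply (Lim 0); unfold T; apply mem_cup; left; apply mem_cup; left; apply mem_succ; auto.
    - intros z Hz; apply (B z (succ z)); auto; apply mem_cup; left; apply mem_succ; auto. }
  repeat split; auto; try apply L.
  - apply (Lim 0); unfold T; apply mem_cup; left; apply mem_cup; right; apply mem_succ; auto.
  - apply Kf; auto; intros z Hz; apply (B z (f z)); auto; apply mem_cup; right; apply mem_succ; auto.
Qed.

(* [wit Q x] is the least [u] such that [Lv u] contains a witness for [Q x]. *)
Definition wit (Q : set -> set -> Prop) (x : set) : set :=
  sep N (fun u => (exists y, y ∈ LA /\ Q x y) /\ ord u /\ forall y, y ∈ Lv u -> ~ Q x y).

(** The ordinals whose level has no witness form an initial segment, which is the least ordinal with
    one. The conjunct asserting existence makes the value [emp] when no witness exists at all. *)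
Lemma wit_spec Q x : wit Q x ∈ al /\
  ((exists y, y ∈ LA /\ Q x y) -> exists y, y ∈ Lv (wit Q x) /\ Q x y).
Proof.
  destruct (classic (exists y, y ∈ LA /\ Q x y)) as [W|W].
  - pose proof W as (y & Hy & Qy); apply mem_Lv_limit in Hy; auto using ord_al, limit_al.
    destruct Hy as (z & Hz & Hy); apply mem_al in Hz; destruct Hz as [Nz Oz].
    destruct (ord_least (fun u => exists y, y ∈ Lv u /\ Q x y) z) as (m & Om & Pm & Lm & K); eauto.
    assert (Nm : m ∈ N) by (destruct Lm; subst; auto; eapply trN; eauto).
    replace (wit Q x) with m; [split; auto; apply mem_al; auto|].
    apply set_ext; intro u; unfold wit; rewrite mem_sep; split.
    + intro Hu; split; [eapply trN; eauto|]; split; auto; split; [eapply ord_mem; eauto|].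
      intros v Hv Qv; apply (K u Hu); eauto.
    + intros (Nu & _ & Ou & Ku); destruct (ord_total u m Ou Om) as [E|[E|E]]; auto; exfalso.
      * subst; destruct Pm as (v & Hv & Qv); apply (Ku v); auto.
      * destruct Pm as (v & Hv & Qv); apply (Ku v); auto; eapply Lv_mono; eauto.
  - split; [|tauto]; replace (wit Q x) with emp; [apply limit_al|].
    apply set_ext; intro z; unfold wit; rewrite mem_sep; split; [intro H; destruct (mem_emp _ H)|tauto].
Qed.

Lemma df_wit Q t : dfP (fun e => Q (e 0) (e 1)) -> dfF t -> dfF (fun e => wit Q (t e)).
Proof.
  intro HQ; apply (df_fun1 _ _ (wit Q)).
  pose proof LA_class.
  apply (df_bymem _ _ _ (fun u e => (exists y, y ∈ N /\ (y ∈ LA /\ Q (e 0) y)) /\ ord u /\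
           forall y, y ∈ Lv u -> ~ Q (e 0) y)).
  - intros e He; destruct (wit_spec Q (e 0)) as [H1 _]; apply mem_al in H1; tauto.
  - intros e He x Hx; unfold wit; rewrite mem_sep; split; [intros (_ & (y & Hy & Qy) & H1)|intros [(y & _ & Hy) H1]].
    + split; auto; exists y; split; auto; apply LA_sub; auto.
    + split; [auto|]; split; [exists y; tauto|auto].
  - dfn; try (apply df_Lv; dfn); apply (df_rel2 _ _ Q); dfn; auto.
Qed.

Lemma gb_bound Q b : dfP (fun e => Q (e 0) (e 1)) -> b ∈ N ->
  exists g, g ∈ al /\ forall x, x ∈ b -> (exists y, y ∈ LA /\ Q x y) -> exists y, y ∈ Lv g /\ Q x y.
Proof.
  intros HQ Hb; exists (bigU b (wit Q)).
  assert (A1 : bigU b (wit Q) ∈ al).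
  { apply mem_al; split.
    - assert (D : dfF (fun e => bigU (e 0) (wit Q))) by (dfn; apply df_wit; dfn; auto).
      apply (proj1 D (fun _ => b)); auto.
    - apply ord_bigU; intros x _; destruct (wit_spec Q x) as [H _]; apply mem_al in H; tauto. }
  split; auto; intros x Hx W; destruct (wit_spec Q x) as [H K]; destruct (K W) as (y & Hy & Qy).
  exists y; split; auto; apply mem_al in H; apply mem_al in A1.
  destruct (ord_sub (wit Q x) (bigU b (wit Q))) as [<-|E]; try tauto.
  - intros z Hz; apply mem_bigU; eauto.
  - eapply Lv_mono; eauto; tauto.
Qed.

Lemma gb_bounded b : b ∈ N -> sub b LA -> exists g, g ∈ al /\ sub b (Lv g).
Proof.
  intros Hb S1; destruct (gb_bound eq b) as (g & Hg & K); auto; [dfn|].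
  exists g; split; auto; intros x Hx; destruct (K x Hx) as (y & Hy & <-); eauto.
Qed.

(** Levels closed under witnesses. The function takes [z] to the supremum of the least witness
    levels over [Lv z]; at a closed limit [g], each [x] lies in some earlier [Lv z], so its witness
    appears below [g]. *)
Lemma big_collect Q : dfP (fun e => Q (e 0) (e 1)) ->
  big (fun g => forall x, x ∈ Lv g -> (exists y, y ∈ LA /\ Q x y) -> exists y, y ∈ Lv g /\ Q x y).
Proof.
  intro HQ; exists (fun z => bigU (Lv z) (wit Q)).
  assert (D : dfF (fun e => bigU (Lv (e 0)) (wit Q))).
  { apply df_bigU; [apply df_Lv; dfn|apply df_wit; dfn; auto]. }
  assert (O : forall z, ord (bigU (Lv z) (wit Q))).
  { intro z; apply ord_bigU; intros x _; destruct (wit_spec Q x) as [H _]; apply mem_al in H; tauto. }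
  split; [auto|split].
  - intros z Hz; apply mem_al; split; auto; apply mem_al in Hz; apply (proj1 D (fun _ => z)); tauto.
  - intros g Hg Lg C x Hx W; destruct (wit_spec Q x) as [H K]; destruct (K W) as (y & Hy & Qy).
    exists y; split; auto; assert (Og : ord g) by exact (ord_mem _ _ ord_al Hg).
    apply mem_Lv_limit in Hx; auto; destruct Hx as (z & Hz & Hx); specialize (C z Hz); cbn in C.
    apply mem_al in H; destruct (ord_sub (wit Q x) (bigU (Lv z) (wit Q))) as [E|E]; try tauto; auto.
    + intros v Hv; apply mem_bigU; eauto.
    + rewrite <- E in C; exact (Lv_mono g _ Og C y Hy).
    + exact (Lv_mono g _ Og (ord_trans _ _ _ Og E C) y Hy).
Qed.

Lemma df_unpack t i : dfF t -> dfF (fun e => unpack (t e) i).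
Proof.
  intro H; unfold unpack; apply df_fst; induction i; simpl; auto; apply df_snd; auto.
Qed.

(** Reflection by induction on the formula, with [big_collect] supplying witnesses for an
    existential quantifier and counterexamples for a universal one. Environments are coded by a
    single list, so that witness relations are binary. The class parameters may vary with a set [r]
    of the level, as the restrictions of a solution do. *)
Lemma reflect p (C : set -> nat -> set) : elementary p = true ->
  (forall j, dfP (fun e => e 0 ∈ C (e 1) j)) -> (forall r j, r ∈ N -> sub (C r j) N) ->
  big (fun g => forall x r, x ∈ Lv g -> r ∈ Lv g ->
    (esat LA (unpack x) (C r) p <-> esat (Lv g) (unpack x) (C r) p)).
Proof.
  intros E HC SC; pose proof LA_class as YL.
  assert (Sg : forall g, g ∈ al -> sub (Lv g) LA) by (intros g Hg; apply Lv_mono; auto using ord_al).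
  assert (Triv : forall K : set -> Prop, (forall g, K g) -> big K).
  { intros K HK; apply (big_imp (fun g => emp ∈ g)); auto; apply big_gt, limit_al. }
  assert (Dq : forall q, elementary q = true ->
    dfP (fun e => esat LA (unpack (opair (e 1) (snd (e 0)))) (C (fst (e 0))) q)).
  { intros q Eq; apply (df_esat N Y q (fun _ => LA) (fun i e => unpack (opair (e 1) (snd (e 0))) i)
                          (fun j e => C (fst (e 0)) j)); auto.
    - dfn.
    - intro j; apply (df_rel2 _ _ (fun z r => z ∈ C r j)); [exact (HC j)|dfn|dfn].
    - intros; apply LA_sub.
    - intros j e He; apply SC; apply (proj1 (df_fst _ (df_var N Y 0)) e He).
    - intro i; apply df_unpack; dfn. }
  assert (Og : forall g, g ∈ al -> ord g) by (intros; eapply ord_mem; [apply ord_al|auto]).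
  induction p; simpl in E; try discriminate; try (apply andb_prop in E; destruct E as [E1 E2]);
    try (apply Triv; intros; unfold esat; simpl; tauto).
  - apply (big_imp (fun g => _ /\ _)) with (2 := big_and _ _ (IHp1 E1) (IHp2 E2)).
    intros g _ _ [H1 H2] x r Hx Hr; specialize (H1 x r Hx Hr); specialize (H2 x r Hx Hr).
    unfold esat in *; simpl; tauto.
  - apply (big_imp (fun g => _ /\ _)) with (2 := big_and _ _ (IHp1 E1) (IHp2 E2)).
    intros g _ _ [H1 H2] x r Hx Hr; specialize (H1 x r Hx Hr); specialize (H2 x r Hx Hr).
    unfold esat in *; simpl; tauto.
  - apply (big_imp (fun g => _ /\ _)) with (2 := big_and _ _ (IHp1 E1) (IHp2 E2)).
    intros g _ _ [H1 H2] x r Hx Hr; specialize (H1 x r Hx Hr); specialize (H2 x r Hx Hr).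
    unfold esat in *; simpl; tauto.
  - pose proof (big_collect (fun w y => ~ esat LA (unpack (opair y (snd w))) (C (fst w)) p)
      (df_not _ _ _ (Dq p E))) as BC.
    apply (big_imp (fun g => _ /\ _)) with (2 := big_and _ _ (IHp E) BC).
    intros g Hg Lg [H1 H2] x r Hx Hr; unfold esat; simpl; split; intros H y Hy.
    + rewrite <- unpack_cons; apply H1; auto using Lv_opair; rewrite unpack_cons; apply H, (Sg g); auto.
    + apply NNPP; intro K; destruct (H2 (opair r x)) as (z & Hz & Kz); auto using Lv_opair.
      * exists y; rewrite fst_opair, snd_opair, unpack_cons; auto.
      * apply Kz; rewrite fst_opair, snd_opair; apply H1; auto using Lv_opair; rewrite unpack_cons; apply H; auto.
  - pose proof (big_collect (fun w y => esat LA (unpack (opair y (snd w))) (C (fst w)) p) (Dq p E)) as BC.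
    apply (big_imp (fun g => _ /\ _)) with (2 := big_and _ _ (IHp E) BC).
    intros g Hg Lg [H1 H2] x r Hx Hr; unfold esat; simpl; split; intros (y & Hy & H).
    + destruct (H2 (opair r x)) as (z & Hz & Kz); auto using Lv_opair.
      * exists y; rewrite fst_opair, snd_opair, unpack_cons; auto.
      * exists z; split; auto; rewrite fst_opair, snd_opair in Kz; apply H1 in Kz; auto using Lv_opair.
        rewrite unpack_cons in Kz; auto.
    + exists y; split; [apply (Sg g); auto|]; rewrite <- unpack_cons; apply H1; auto using Lv_opair.
      rewrite unpack_cons; auto.
Qed.

End Constructible.


(** * Recursion along class relations *)

Lemma Sat_fUpair M X e c p a b : trans M -> inN M e ->
  (Sat M X e c (fUpair p a b) <-> e p = upair (e a) (e b)).
Proof.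
  intros T He; simpl; split.
  - intro H; apply set_ext; intro z; rewrite mem_upair; split.
    + intro Hz; apply (H z); auto; apply (T (e p)); auto.
    + intros [->| ->]; apply H; auto.
  - intros -> z Hz; rewrite mem_upair; tauto.
Qed.

Lemma Sat_fOpair M X e c p a b : trans M -> inN M e ->
  (Sat M X e c (fOpair p a b) <-> e p = opair (e a) (e b)).
Proof.
  intros T He; unfold fOpair.
  assert (Q : forall x y, x ∈ M -> y ∈ M -> (Sat M X (scons y (scons x e)) c
     (fAnd (fUpair 1 (S (S a)) (S (S a))) (fAnd (fUpair 0 (S (S a)) (S (S b))) (fUpair (S (S p)) 1 0))) <->
     x = upair (e a) (e a) /\ y = upair (e a) (e b) /\ e p = upair x y)).
  { intros x y Hx Hy; cbn [Sat]; rewrite !Sat_fUpair by auto using scons_in; simpl; tauto. }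
  simpl Sat; split.
  - intros (x & Hx & y & Hy & H); apply (proj1 (Q x y Hx Hy)) in H; destruct H as (-> & -> & ->); auto.
  - intro E; assert (H : upair (e a) (e a) ∈ M /\ upair (e a) (e b) ∈ M).
    { split; apply (T (e p)); auto; rewrite E; apply mem_upair; auto. }
    exists (upair (e a) (e a)); split; [tauto|]; exists (upair (e a) (e b)); split; [tauto|].
    apply (proj2 (Q _ _ (proj1 H) (proj2 H))); auto.
Qed.

Lemma Sat_fPairIn M X e c a b F : trans M -> inN M e -> sub (c F) M ->
  (Sat M X e c (fPairIn a b F) <-> opair (e a) (e b) ∈ c F).
Proof.
  intros T He HF.
  assert (Q : forall x, x ∈ M -> (Sat M X (scons x e) c (fAnd (fOpair 0 (S a) (S b)) (fCMem 0 F)) <->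
     x = opair (e a) (e b) /\ x ∈ c F)).
  { intros x Hx; pose proof (Sat_fOpair M X (scons x e) c 0 (S a) (S b) T (scons_in M x e Hx He)) as K.
    cbn [Sat]; rewrite K; simpl; tauto. }
  unfold fPairIn; split.
  - intros (x & Hx & H); apply (Q x Hx) in H; destruct H as [-> H]; auto.
  - intro H; exists (opair (e a) (e b)); split; auto; apply Q; auto.
Qed.

Inductive tc (R : set) (a : set) : set -> Prop :=
| tc1 b : rel R a b -> tc R a b
| tcn c b : tc R a c -> rel R c b -> tc R a b.

Lemma tc_trans R a b c : tc R a b -> tc R b c -> tc R a c.
Proof. intros H K; induction K; eapply tcn; eauto. Qed.

Lemma tc_wf R : well_founded (rel R) -> well_founded (tc R).
Proof.
  intros H b; induction (H b) as [b _ IH]; constructor; intros a Ha; destruct Ha as [b Ha|c b Ha Hc].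
  - apply IH; auto.
  - apply (IH c Hc); auto.
Qed.

Definition dom (R x : set) : Prop := exists y, rel R x y \/ rel R y x.
Definition domset (M R : set) : set := sep M (dom R).
Definition tcs (M R : set) : set := sep M (fun w => tc R (fst w) (snd w) /\ w = opair (fst w) (snd w)).

Lemma rel_in M R x y : trans M -> sub R M -> rel R x y -> x ∈ M /\ y ∈ M.
Proof.
  intros T S1 H; apply S1 in H.
  assert (K : upair x y ∈ M) by (apply (T _ H); apply mem_upair; auto).
  split; apply (T _ K); apply mem_upair; auto.
Qed.

Lemma tc_in M R x y : trans M -> sub R M -> tc R x y -> x ∈ M /\ y ∈ M.
Proof.
  intros T S1 H; induction H as [b H|c b H IH K].
  - eapply rel_in; eauto.
  - split; [tauto|]; eapply rel_in; eauto.
Qed.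

Lemma rel_tcs M R a b : trans M -> (forall x y, x ∈ M -> y ∈ M -> opair x y ∈ M) -> sub R M ->
  (rel (tcs M R) a b <-> tc R a b).
Proof.
  intros T P S1; unfold rel, tcs; rewrite mem_sep, fst_opair, snd_opair; split; [tauto|].
  intro H; destruct (tc_in M R a b T S1 H); auto.
Qed.

Definition cenv2 (P A : set) : env := fun j => match j with 0 => P | S _ => A end.
(* [S ↾ r], provided that [S] consists of pairs ([fst] is [emp] elsewhere). *)
Definition restr (S0 T r : set) : set := sep S0 (fun w => opair (fst w) r ∈ T).
(** Domain, index set and relation are arguments, so that one notion covers recursion over all of
    [L] and its relativization to a level. *)
Definition sol (B D T A : set) (p : form) (S0 : set) : Prop :=
  (forall w, w ∈ S0 -> exists r x, r ∈ D /\ x ∈ B /\ w = opair r x) /\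
  forall r x, r ∈ D -> x ∈ B ->
    (opair r x ∈ S0 <-> esat B (fun _ => x) (cenv2 (restr S0 T r) A) p).

Lemma sol_uniq B D T A p S1 S2 : well_founded (rel T) -> sol B D T A p S1 -> sol B D T A p S2 -> S1 = S2.
Proof.
  intros W [P1 Q1] [P2 Q2].
  assert (K : forall r, r ∈ D -> forall x, x ∈ B -> (opair r x ∈ S1 <-> opair r x ∈ S2)).
  { intro r; induction (W r) as [r _ IH]; intros Hr x Hx; rewrite Q1, Q2 by auto.
    replace (restr S2 T r) with (restr S1 T r); [tauto|].
    apply set_ext; intro w; unfold restr; rewrite !mem_sep; split; intros [Hw Tw]; split; auto.
    - destruct (P1 w Hw) as (a & y & Ha & Hy & ->); rewrite fst_opair in Tw; apply IH; auto.
    - destruct (P2 w Hw) as (a & y & Ha & Hy & ->); rewrite fst_opair in Tw; apply IH; auto. }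
  apply set_ext; intro w; split; intro Hw.
  - destruct (P1 w Hw) as (a & y & Ha & Hy & ->); apply K; auto.
  - destruct (P2 w Hw) as (a & y & Ha & Hy & ->); apply K; auto.
Qed.

(** * Recursions whose data are sets of the model *)

Section SetSol.
Context {M : set} {Y : set -> Prop} {G : GBm M Y}.
Notation dfP := (DfP M Y).
Notation dfF := (DfF M Y).

(* A chain leading down from [b] can only stop at [a]. *)
Lemma tc_def R a b : sub R M -> well_founded (rel R) -> a ∈ M -> (tc R a b <->
  exists u, u ∈ M /\ ((exists y, y ∈ u /\ opair y b ∈ R) /\
    forall y, y ∈ u -> y = a \/ exists z, z ∈ u /\ opair z y ∈ R)).
Proof.
  intros S1 W Ha; split.
  - intro H; induction H as [b H|c b H IH K].
    + exists (sing a); split; [apply gb_pair; auto|]; split.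
      * exists a; split; auto; apply mem_sing; auto.
      * intros y Hy; apply mem_sing in Hy; auto.
    + destruct IH as (u & Hu & (y & Hy & Ry) & IH).
      assert (Hc : c ∈ M) by (eapply rel_in; eauto using (gb_trans (N:=M))).
      exists (cup u (sing c)); split; [apply gb_union; repeat apply gb_pair; auto|]; split.
      * exists c; split; auto; apply mem_cup; rewrite mem_sing; auto.
      * intros v Hv; apply mem_cup in Hv; rewrite mem_sing in Hv; destruct Hv as [Hv| ->].
        -- destruct (IH v Hv) as [->|(z & Hz & Rz)]; auto; right; exists z; split; auto; apply mem_cup; auto.
        -- right; exists y; split; auto; apply mem_cup; auto.
  - intros (u & _ & (y & Hy & Ry) & K).
    assert (L : forall v, v ∈ u -> v = a \/ tc R a v).
    { intro v; induction (W v) as [v _ IH]; intro Hv; destruct (K v Hv) as [->|(z & Hz & Rz)]; auto.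
      right; destruct (IH z Rz Hz) as [->|H]; [apply tc1|eapply tcn]; eauto. }
    destruct (L y Hy) as [->|H]; [apply tc1|eapply tcn]; eauto.
Qed.

Lemma tcs_class R : Y R -> well_founded (rel R) -> Y (tcs M R).
Proof.
  intros HR W; pose proof (gb_sub _ HR) as S1.
  replace (tcs M R) with (sep M (fun w => (exists u, u ∈ M /\ ((exists y, y ∈ u /\ opair y (snd w) ∈ R) /\
    forall y, y ∈ u -> y = fst w \/ exists z, z ∈ u /\ opair z y ∈ R)) /\ w = opair (fst w) (snd w))).
  - apply gb_class1; dfn.
  - apply set_ext; intro w; unfold tcs; rewrite !mem_sep; split; intros (Hw & H & E); repeat split; auto.
    + apply tc_def; auto; apply (proj1 (df_fst _ (df_var M Y 0)) (fun _ => w)); auto.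
    + apply tc_def in H; auto; apply (proj1 (df_fst _ (df_var M Y 0)) (fun _ => w)); auto.
Qed.

Lemma domset_class R : Y R -> Y (domset M R).
Proof.
  intro HR; pose proof (gb_sub _ HR) as S1.
  replace (domset M R) with (sep M (fun x => exists y, y ∈ M /\ (opair x y ∈ R \/ opair y x ∈ R))).
  - apply gb_class1; dfn.
  - apply sep_ext; intros x Hx; split; [intros (y & _ & H); exists y; auto|].
    intros (y & H); exists y; split; [|exact H]; destruct H as [H|H]; apply (rel_in M R _ _ gb_trans S1) in H; tauto.
Qed.

Definition psol (B D T A : set) (p : form) (r s : set) : Prop :=
  (forall w, w ∈ s -> exists a, a ∈ D /\ (opair a r ∈ T /\ exists x, x ∈ B /\ w = opair a x)) /\
  forall a, a ∈ D -> opair a r ∈ T -> forall x, x ∈ B ->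
    (opair a x ∈ s <-> esat B (fun _ => x) (cenv2 (restr s T a) A) p).

Lemma df_restr t u v : dfF t -> dfF u -> dfF v -> dfF (fun e => restr (t e) (u e) (v e)).
Proof. apply (df_fun3 _ _ restr); unfold restr; dfn. Qed.

Lemma df_esat2 B A p t u : elementary p = true -> B ∈ M -> A ∈ M -> dfF t -> dfF u ->
  dfP (fun e => esat B (fun _ => t e) (cenv2 (u e) A) p).
Proof.
  intros E HB HA Ht Hu.
  assert (K : dfP (fun e => esat B (fun i => (fun _ => t) i e) (fun j => (fun j e => cenv2 (u e) A j) j e) p)).
  { apply df_esat; auto.
    - dfn.
    - intros [|j]; simpl; dfn; exact (dfF_ren _ _ _ S Hu).
    - intros e He z Hz; exact (gb_trans _ HB z Hz).
    - intros [|j] e He z Hz; simpl in Hz.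
      + exact (gb_trans _ (proj1 Hu e He) z Hz).
      + exact (gb_trans _ HA z Hz). }
  exact K.
Qed.

(** A partial solution below [r] is unique, so the true solution is definable from its own initial
    parts. Induction on [r] puts each initial part into [M], and then the whole. *)
Lemma set_sol B D T A p S0 : B ∈ M -> D ∈ M -> T ∈ M -> A ∈ M -> elementary p = true ->
  well_founded (rel T) -> (forall x y z, rel T x y -> rel T y z -> rel T x z) ->
  sol B D T A p S0 -> S0 ∈ M.
Proof.
  intros HB HD HT HA E W Tr [PS QS].
  assert (RR : forall S1 r r', rel T r' r -> restr (restr S1 T r) T r' = restr S1 T r').
  { intros S1 r r' H; apply set_ext; intro w; unfold restr; rewrite !mem_sep; split; [tauto|].
    intros [Hw K]; repeat split; auto; eapply Tr; eauto. }
  assert (Ex : forall r, psol B D T A p r (restr S0 T r)).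
  { intro r; split.
    - intros w Hw; apply mem_sep in Hw; destruct Hw as [Hw Tw]; destruct (PS w Hw) as (a & x & Ha & Hx & ->).
      rewrite fst_opair in Tw; eauto 8.
    - intros a Ha Ta x Hx; rewrite (RR _ _ _ Ta), <- QS by auto; unfold restr; rewrite mem_sep, fst_opair; tauto. }
  assert (Un : forall r s, psol B D T A p r s -> s = restr S0 T r).
  { intros r s [P1 Q1].
    assert (K : forall a, a ∈ D -> rel T a r -> forall x, x ∈ B -> (opair a x ∈ s <-> opair a x ∈ S0)).
    { intro a; induction (W a) as [a _ IH]; intros Ha Ta x Hx; rewrite Q1, QS by auto.
      replace (restr s T a) with (restr S0 T a); [tauto|].
      apply set_ext; intro w; unfold restr; rewrite !mem_sep; split; intros [Hw Tw]; split; auto.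
      - destruct (PS w Hw) as (b & y & Hb & Hy & ->); rewrite fst_opair in Tw; apply IH; auto; eapply Tr; eauto.
      - destruct (P1 w Hw) as (b & Hb & Tb & y & Hy & ->); rewrite fst_opair in Tw; apply IH in Hw; auto. }
    apply set_ext; intro w; unfold restr; rewrite mem_sep; split.
    - intro Hw; destruct (P1 w Hw) as (b & Hb & Tb & y & Hy & ->); rewrite fst_opair; split; auto; apply K in Hw; auto.
    - intros [Hw Tw]; destruct (PS w Hw) as (b & y & Hb & Hy & ->); rewrite fst_opair in Tw; apply K; auto. }
  assert (Dp : forall t u, dfF t -> dfF u -> dfP (fun e => psol B D T A p (t e) (u e))).
  { intros t u; apply (df_rel2 _ _ (psol B D T A p)); unfold psol; dfn; apply df_esat2; dfn; apply df_restr; dfn. }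
  (* Collects the rows with index in [P]. Row [r] is obtained by evaluating [p] at the unique
     partial solution below [r], so separation from a product suffices once these partial solutions
     are in [M]. *)
  assert (Col : forall P : set -> Prop, dfP (fun e => P (e 0)) ->
     (forall r, r ∈ D -> P r -> restr S0 T r ∈ M) -> sep S0 (fun w => P (fst w)) ∈ M).
  { intros P DP H.
    replace (sep S0 (fun w => P (fst w))) with (sep (prod D B) (fun w => P (fst w) /\
      exists s, s ∈ M /\ (psol B D T A p (fst w) s /\ esat B (fun _ => snd w) (cenv2 s A) p))).
    - assert (K : dfF (fun _ => sep (prod D B) (fun w => P (fst w) /\
        exists s, s ∈ M /\ (psol B D T A p (fst w) s /\ esat B (fun _ => snd w) (cenv2 s A) p)))).
      { dfn; [apply (df_rel1 _ _ P); dfn|apply Dp; dfn|apply df_esat2; dfn]. }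
      apply (proj1 K (fun _ => B)); auto.
    - apply set_ext; intro w; rewrite !mem_sep; split.
      + intros (Hw & Pw & s & _ & Hs & Es); split; auto; apply mem_prod in Hw.
        destruct Hw as (r & x & Hr & Hx & ->); rewrite !fst_opair, !snd_opair in *.
        apply QS; auto; rewrite <- (Un _ _ Hs); auto.
      + intros [Hw Pw]; destruct (PS w Hw) as (r & x & Hr & Hx & ->); rewrite !fst_opair, !snd_opair in *.
        split; [apply mem_prod_opair; auto|]; split; auto; exists (restr S0 T r).
        split; [auto|]; split; [apply Ex|]; apply QS; auto. }
  assert (Rs : forall r, r ∈ D -> restr S0 T r ∈ M).
  { intro r; induction (W r) as [r _ IH]; intro Hr.
    (* The rows below [r] make up the partial solution at [r]; transitivity of [T] has ensured that
       their own restrictions agree with those of [S0]. *)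
    apply (Col (fun a => opair a r ∈ T)); auto.
    dfn; apply df_gcst; exact (gb_trans _ HD r Hr). }
  replace S0 with (sep S0 (fun _ => True)).
  - apply (Col (fun _ => True)); auto; dfn.
  - apply set_ext; intro w; rewrite mem_sep; tauto.
Qed.

End SetSol.


(** * The least family of classes over L *)

Definition ranked (M : set) (gam : set -> set -> Prop) (R F : set) : Prop :=
  (forall x y z, x ∈ M -> y ∈ M -> z ∈ M -> opair x y ∈ F -> opair x z ∈ F -> y = z) /\
  (forall x, x ∈ M -> dom R x ->
     exists y, y ∈ M /\ ((exists z, z ∈ M /\ (gam y z \/ gam z y)) /\ opair x y ∈ F)) /\
  (forall x x' y y', x ∈ M -> x' ∈ M -> y ∈ M -> y' ∈ M -> dom R x -> dom R x' -> rel R x x' ->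
     opair x y ∈ F -> opair x' y' ∈ F -> gam y y').

Lemma ranked_wf M gam R F : trans M -> sub R M -> well_founded gam -> ranked M gam R F -> well_founded (rel R).
Proof.
  intros T S1 W (_ & Tot & Mon).
  assert (K : forall y x, y ∈ M -> x ∈ M -> opair x y ∈ F -> Acc (rel R) x).
  { intro y; induction (W y) as [y _ IH]; intros x Hy Hx Fx; constructor; intros x' Rx.
    destruct (rel_in M R x' x T S1 Rx) as [Hx' _].
    assert (Dx : dom R x') by (exists x; auto); destruct (Tot x' Hx' Dx) as (y' & Hy' & _ & Fx').
    apply (IH y'); auto; apply (Mon x' x); auto; exists x'; auto. }
  intro x; constructor; intros x' Rx; destruct (rel_in M R x' x T S1 Rx) as [Hx' _].
  destruct (Tot x' Hx') as (y' & Hy' & _ & Fx'); [exists x; auto|]; eauto.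
Qed.

(* Recursion is allowed only if [b]: amenability of [Xs True] is proved by
   carrying out set recursions in the model given by [Xs False]. *)
Inductive Xs (b : Prop) (D : set) (gam : set -> set -> Prop) : set -> Prop :=
| Xs_emp : Xs b D gam emp
| Xs_def p e c : elementary p = true -> inN D e -> (forall i, Xs b D gam (c i)) ->
    Xs b D gam (sep D (fun x => esat D (scons x e) c p))
| Xs_etr R A F p S0 : b -> Xs b D gam R -> Xs b D gam A -> Xs b D gam F -> ranked D gam R F ->
    elementary p = true -> bounded 1 2 p = true ->
    sol D (domset D R) (tcs D R) A p S0 -> Xs b D gam S0.

(** * Amenability of the generated classes *)

Section Amenable.
Context {N : set} {Y : set -> Prop} {G : GBm N Y}.
Notation al := (height N).
Notation LA := (Lv (height N)).
Let Oal : ord al := ord_al.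
Let Lal : limit al := limit_al.

(** Required on a club only, which is what reflection provides; [Am_all] extends it to every level
    by cutting down a larger one. *)
Definition Am (C : set) : Prop := big (N:=N) (Y:=Y) (fun g => isect C (Lv g) ∈ LA).

Lemma isect_comm a b : isect a b = isect b a.
Proof. apply set_ext; intro; rewrite !mem_isect; tauto. Qed.

Lemma Am_all C g : Am C -> g ∈ al -> isect C (Lv g) ∈ LA.
Proof.
  intros H Hg; destruct (big_unbounded _ g H Hg) as (h & Hh & Lh & Hgh & K).
  replace (isect C (Lv g)) with (isect (isect C (Lv h)) (Lv g)).
  - apply Lv_isect; auto using Lv_Lv.
  - assert (S1 : sub (Lv g) (Lv h)) by (apply Lv_mono; auto; exact (ord_mem _ _ Oal Hh)).
    apply set_ext; intro z; rewrite !mem_isect; specialize (S1 z); tauto.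
Qed.

Lemma LA_finite (s : nat -> set) n : (forall i, i < n -> s i ∈ LA) ->
  exists d, d ∈ al /\ forall i, i < n -> s i ∈ Lv d.
Proof.
  induction n; intro H; [exists emp; split; [apply Lal|intros; lia]|].
  destruct IHn as (d & Hd & Kd); [intros; apply H; lia|].
  assert (Hn : s n ∈ LA) by (apply H; lia); apply mem_Lv_limit in Hn; auto; destruct Hn as (u & Hu & Hn).
  assert (Od : ord d) by exact (ord_mem _ _ Oal Hd); assert (Ou : ord u) by exact (ord_mem _ _ Oal Hu).
  destruct (ord_total d u Od Ou) as [E|[E|E]].
  - exists u; split; auto; intros i Hi; assert (i < n \/ i = n) as [|] by lia; subst; auto.
    eapply Lv_mono; eauto.
  - subst u; exists d; split; auto; intros i Hi; assert (i < n \/ i = n) as [|] by lia; subst; auto.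
  - exists d; split; auto; intros i Hi; assert (i < n \/ i = n) as [|] by lia; subst; auto.
    eapply Lv_mono; [| |exact Hn]; auto.
Qed.

Lemma pre_Lv g n : forall e, ord g -> limit g -> (forall i, i < n -> e i ∈ Lv g) -> pre n e emp ∈ Lv g.
Proof.
  induction n; intros e O L H; simpl; [apply Lv_emp; auto|].
  apply Lv_opair; auto; [apply H; lia|apply IHn; auto; intros; apply H; lia].
Qed.

(** Where the defining formula reflects to [Lv g], the trace of the class is defined over [Lv g]
    from the traces of its class parameters. These are elements of [LA] by assumption, so the trace
    is a definable subset of a somewhat later level. *)
Lemma Am_def p e c : elementary p = true -> inN LA e ->
  (forall i, sub (c i) LA /\ Y (c i) /\ Am (c i)) ->
  Am (sep LA (fun x => esat LA (scons x e) c p)).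
Proof.
  intros Ep He Hc.
  destruct (bounded_ex (noceq p)) as (n & m & Bd).
  assert (Eq : elementary (noceq p) = true) by (apply elementary_noceq; auto).
  destruct (LA_finite e n) as (d & Hd & Kd); [auto|].
  assert (B1 := reflect (N:=N) (Y:=Y) (noceq p) (fun _ => c) Eq).
  assert (B2 : big (N:=N) (Y:=Y) (fun g => forall i, i < m -> isect (c i) (Lv g) ∈ LA)).
  { apply (big_all (fun i g => isect (c i) (Lv g) ∈ LA)); intros; apply Hc. }
  assert (B3 := big_gt (N:=N) (Y:=Y) d Hd).
  refine (big_imp _ _ _ (big_and _ _ (B1 _ _) (big_and _ _ B2 B3))).
  2: { intro j; assert (Y (c j)) by apply Hc; dfn. }
  2: { intros _ j _ z Hz; apply LA_sub; apply (Hc j); auto. }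
  clear B1 B2 B3; intros g Hg Lg (R & Am' & Dg); cbn beta in *.
  assert (Og : ord g) by exact (ord_mem _ _ Oal Hg).
  assert (Sg : sub (Lv g) LA) by (apply Lv_mono; auto).
  (* Parameters that do not occur in the formula are reset to [emp]; the finitely many others share
     a level. *)
  pose (e' := fun i => if i <? n then e i else emp).
  pose (c' := fun j => if j <? m then isect (c j) (Lv g) else emp).
  assert (He' : inN (Lv g) e').
  { intro i; unfold e'; destruct (Nat.ltb_spec i n); [|apply Lv_emp; auto].
    eapply Lv_mono; [| |apply Kd; auto]; auto. }
  assert (Eq' : forall x, x ∈ Lv g -> (esat LA (scons x e) c p <-> esat (Lv g) (scons x e') c' (noceq p))).
  { intros x Hx; rewrite <- esat_noceq by (auto; intro; apply Hc).
    transitivity (esat LA (unpack (opair x (pre n e emp))) c (noceq p)).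
    { unfold esat; apply Sat_bounded with (n := n) (m := m); auto; intros i Hi.
      rewrite unpack_cons; destruct i; simpl; auto; rewrite unpack_pre_emp.
      destruct (Nat.ltb_spec i n); auto; lia. }
    rewrite (R _ emp).
    - rewrite unpack_cons; replace (unpack (pre n e emp)) with e'
        by (apply functional_extensionality; intro; rewrite unpack_pre_emp; auto).
      transitivity (esat (Lv g) (scons x e') (fun j => if j <? m then c j else emp) (noceq p)).
      + unfold esat; apply Sat_bounded with (n := n) (m := m); auto; intros i Hi.
        destruct (Nat.ltb_spec i m); auto; lia.
      + apply esat_trace; auto using scons_in; intros i y Hy; unfold c'; destruct (i <? m); [|tauto].
        rewrite mem_isect; tauto.
    - apply Lv_opair; auto; apply pre_Lv; auto; intros i Hi; eapply Lv_mono; [| |apply Kd; auto]; auto.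
    - apply Lv_emp; auto. }
  destruct (LA_finite c' m) as (d' & Hd' & Kd').
  { intros j Hj; unfold c'; destruct (Nat.ltb_spec j m); [auto|lia]. }
  (* [h] lies above both [g] and the level holding the traces of the class parameters, so [Lv g] and
     these traces are elements of [Lv h]. *)
  pose (h := cup (succ g) (succ d')).
  assert (Hh : h ∈ al) by (apply al_cup; apply Lal; auto).
  assert (Od' : ord d') by exact (ord_mem _ _ Oal Hd').
  assert (Oh : ord h) by exact (ord_mem _ _ Oal Hh).
  assert (Gh : g ∈ h) by (unfold h; apply mem_cup; left; apply mem_succ; auto).
  assert (Dh : d' ∈ h) by (unfold h; apply mem_cup; right; apply mem_succ; auto).
  apply (Lv_Dfb al h); auto.
  assert (Tr : trans (Lv h)) by (apply Lv_trans; auto).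
  assert (Eh : emp ∈ Lv h) by exact (Lv_mono h g Oh Gh _ (Lv_emp g Og Lg)).
  assert (St : Str (Lv h) (memOf (Lv h))) by (apply Str_memOf; eauto).
  assert (Lgh : Lv g ∈ Lv h) by (apply Lv_Lv; auto).
  assert (Ch : forall j, c' j ∈ Lv h).
  { intro j; destruct (Nat.ltb_spec j m).
    - eapply Lv_mono; [| |apply Kd'; auto]; auto.
    - unfold c'; destruct (Nat.ltb_spec j m); [lia|auto]. }
  apply (df_Dfb _ _ (fun v => v 0 ∈ Lv g /\ esat (Lv g) (scons (v 0) e') c' (noceq p))).
  - apply df_and; [apply df_cls; auto; apply df_var; auto|].
    apply df_esat_cst; auto.
    + intros z Hz; exact (Tr _ Lgh z Hz).
    + intros j z Hz; exact (Tr _ (Ch j) z Hz).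
    + intro i; assert (e' i ∈ Lv h) by (eapply Lv_mono; [| |apply He']; auto); apply df_cst; auto.
  - intros z Hz; apply mem_isect in Hz; eapply Lv_mono; [| |apply Hz]; auto.
  - intros y Hy; rewrite mem_isect, mem_sep; split.
    + intros [[_ H] K]; split; auto; apply Eq'; auto.
    + intros [K H]; repeat split; auto; apply Eq'; auto.
Qed.

Lemma LA_defclass p e c : elementary p = true -> inN LA e -> (forall i, sub (c i) LA /\ Y (c i)) ->
  Y (sep LA (fun x => esat LA (scons x e) c p)).
Proof.
  intros Ep He Hc; pose proof (LA_class (N:=N) (Y:=Y)) as YL; pose proof (LA_sub (N:=N) (Y:=Y)) as SL.
  replace (sep LA (fun x => esat LA (scons x e) c p)) with (sep N (fun x => x ∈ LA /\ esat LA (scons x e) c p)).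
  - apply gb_class1; apply df_and; [dfn|]; apply df_esat_cst; auto.
    + intro j; apply Hc.
    + intros j z Hz; apply SL, (Hc j); auto.
    + intro i; apply df_gcst; auto.
  - apply set_ext; intro z; rewrite !mem_sep; split; [tauto|]; intros []; repeat split; auto.
Qed.

(** Isolates what makes a family of classes a model of GB over [LA]. It is satisfied by [Xs],
    without and with recursion, and by the family of all amenable classes. *)
Definition Afam (X : set -> Prop) : Prop :=
  (forall C, X C -> sub C LA /\ Y C /\ Am C) /\
  (forall p e c, elementary p = true -> inN LA e -> (forall i, X (c i)) ->
     X (sep LA (fun x => esat LA (scons x e) c p))) /\ exists A, X A.

Lemma Afam_bounded X C g : Afam X -> X C -> g ∈ al -> sub C (Lv g) -> C ∈ LA.
Proof.
  intros (H & _) XC Hg S1; rewrite <- (isect_eq C (Lv g)) by auto; apply Am_all; auto; apply H; auto.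
Qed.

(** Union, power set and replacement all reduce to showing that a class of the family bounded by a
    set of [N] is an element of [LA]. *)
Lemma GBm_L X : Afam X -> GBm LA X.
Proof.
  intro H; pose proof H as (H1 & H2 & A0 & XA0).
  assert (Tr : trans LA) by (apply Lv_trans; auto).
  (* Such a class is a set in [N] by separation, hence included in some level by collection in [N],
     and amenability turns its trace on that level into an element of [LA]. *)
  assert (Bd : forall C, X C -> forall b, b ∈ N -> sub C b -> C ∈ LA).
  { intros C XC b Hb Sb; destruct (H1 C XC) as (S1 & YC & _).
    assert (NC : isect b C ∈ N) by (apply gb_sep; auto).
    rewrite isect_comm, isect_eq in NC by auto.
    destruct (gb_bounded C NC S1) as (g & Hg & Sg); eapply Afam_bounded; eauto. }
  assert (Cst : forall a, a ∈ LA -> inN LA (fun _ => a)) by auto.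
  split; auto.
  - apply Lv_emp; auto.
  - intros; apply Lv_upair; auto.
  - intros a Ha.
    pose proof (H2 (fEx (fAnd (fMem 0 2) (fMem 1 0))) (fun _ => a) (fun _ => A0) eq_refl (Cst a Ha) (fun _ => XA0)) as K.
    unfold esat in K; simpl in K.
    replace (union a) with (sep LA (fun x => exists y, y ∈ LA /\ y ∈ a /\ x ∈ y)).
    + apply (Bd _ K (union a)); [apply gb_union, LA_sub; auto|].
      intros z Hz; apply mem_sep in Hz; destruct Hz as (_ & y & _ & Hy & Hz); apply mem_union; eauto.
    + apply set_ext; intro z; rewrite mem_sep, mem_union; split.
      * intros (_ & y & _ & K'); eauto.
      * intros (y & Hy & Hz); assert (y ∈ LA) by exact (Tr a Ha y Hy); split; [exact (Tr y H0 z Hz)|eauto].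
  - intros a Ha.
    pose proof (H2 (fSub 0 1) (fun _ => a) (fun _ => A0) eq_refl (Cst a Ha) (fun _ => XA0)) as K.
    unfold esat in K; simpl in K.
    replace (isect (pow a) LA) with (sep LA (fun x => forall z, z ∈ LA -> z ∈ x -> z ∈ a)).
    + apply (Bd _ K (isect (pow a) N)); [apply gb_pow, LA_sub; auto|].
      intros z Hz; apply mem_sep in Hz; destruct Hz as [Hz Kz]; apply mem_isect; split; [|apply LA_sub; auto].
      apply mem_pow; intros w Hw; apply Kz; auto; exact (Tr z Hz w Hw).
    + apply set_ext; intro z; rewrite mem_sep, mem_isect, mem_pow; split.
      * intros [Hz Kz]; split; auto; intros w Hw; apply Kz; auto; exact (Tr z Hz w Hw).
      * intros [Kz Hz]; split; auto.
  - apply Lv_ord_in; auto; apply mem_al; split; [apply gb_omega|apply ord_omega].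
  - intros A XA; apply H1; auto.
  - intros F a XF Ha Fun; destruct (H1 F XF) as (SF & YF & _).
    pose proof (H2 (fEx (fAnd (fMem 0 2) (fPairIn 0 1 0))) (fun _ => a) (fun _ => F) eq_refl (Cst a Ha) (fun _ => XF)) as K.
    assert (E : sep LA (fun y => exists x, x ∈ a /\ opair x y ∈ F) =
      sep LA (fun y => esat LA (scons y (fun _ => a)) (fun _ => F) (fEx (fAnd (fMem 0 2) (fPairIn 0 1 0))))).
    { apply sep_ext; intros y Hy; unfold esat; split.
      - intros (x & Hx & Fx); assert (x ∈ LA) by exact (Tr a Ha x Hx); exists x; split; auto; split; [exact Hx|].
        apply Sat_fPairIn; auto using scons_in.
      - intros (x & Hx & Hx' & Fx); exists x; split; [exact Hx'|].
        apply Sat_fPairIn in Fx; auto using scons_in. }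
    rewrite E; apply (Bd _ K (sep N (fun y => exists x, x ∈ a /\ opair x y ∈ F))).
    + apply gb_repl; auto; apply LA_sub; auto.
    + rewrite <- E; intros z Hz; apply mem_sep in Hz; destruct Hz as [Hz Kz]; apply mem_sep; split; auto.
      apply LA_sub; auto.
  - eauto.
Qed.

Variable gam : set -> set -> Prop.
Hypothesis gam_wf : well_founded gam.
Hypothesis etr : forall R A F p, sub R LA -> sub A LA -> sub F LA -> Y R -> Y A -> Y F -> ranked LA gam R F ->
  elementary p = true -> bounded 1 2 p = true ->
  exists S0, Y S0 /\ sol LA (domset LA R) (tcs LA R) A p S0.

(** The solution in [Xs_etr] is just some set satisfying [sol]; uniqueness along a well-founded
    relation identifies it with the class that the ambient model provides. *)
Lemma Xs_Y b C : Xs b LA gam C -> sub C LA /\ Y C.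
Proof.
  induction 1 as [|p e c E He Hc IH|R A F p S0 Hb HR [SR YR] HA [SA YA] HF [SF YF] Rk E Bd Sol].
  - split; [intros z Hz; destruct (mem_emp _ Hz)|apply gb_set, gb_emp].
  - split; [intros z Hz; apply mem_sep in Hz; tauto|].
    apply LA_defclass; auto.
  - destruct (etr R A F p) as (S1 & YS & Sol1); auto.
    assert (W : well_founded (rel R)) by exact (ranked_wf LA gam R F (Lv_trans _ Oal) SR gam_wf Rk).
    rewrite (sol_uniq LA (domset LA R) (tcs LA R) A p S0 S1); auto.
    + split; auto; destruct Sol1 as [P _]; intros w Hw; destruct (P w Hw) as (r & x & Hr & Hx & ->).
      apply mem_sep in Hr; apply Lv_opair; tauto.
    + intro x; assert (Wt := tc_wf R W x); induction Wt as [x _ IHx]; constructor; intros y Hy; apply IHx.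
      apply rel_tcs in Hy; auto; [apply Lv_trans; auto|intros; apply Lv_opair; auto].
Qed.

Lemma Am_emp : Am emp.
Proof.
  apply (big_imp (fun g => emp ∈ g)); [|apply big_gt; apply Lal].
  intros g _ _ _; replace (isect emp (Lv g)) with emp; [apply Lv_emp; auto|].
  symmetry; apply isect_eq; intros z Hz; destruct (mem_emp _ Hz).
Qed.

(** For a solution [S0], reflection of [p] shows that its trace on [Lv g] solves the same recursion
    cut down to [Lv g]. The data of that recursion are elements of [LA], so [set_sol] applied inside
    [LA] yields an element of [LA]. *)
Lemma Xs_Am (b : Prop) C : (b -> GBm LA (Xs False LA gam)) -> Xs b LA gam C -> Am C.
Proof.
  intros Hb0 H; induction H as [|p e c E He Hc IH|R A F p S0 Hb HR IR HA IA HF _ Rk E Bd Sol].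
  - apply Am_emp.
  - apply Am_def; auto; intro i; destruct (Xs_Y b (c i)); auto.
  - assert (HS : Xs b LA gam S0) by exact (Xs_etr b LA gam R A F p S0 Hb HR HA HF Rk E Bd Sol).
    destruct (Xs_Y b _ HS) as [SS YS], (Xs_Y b _ HR) as [SR YR], (Xs_Y b _ HA) as [SA YA].
    pose proof (Hb0 Hb) as G0.
    assert (Tr : trans LA) by (apply Lv_trans; auto).
    assert (Op : forall x y, x ∈ LA -> y ∈ LA -> opair x y ∈ LA) by (intros; apply Lv_opair; auto).
    assert (W : well_founded (rel R)) by exact (ranked_wf LA gam R F Tr SR gam_wf Rk).
    (* All amenable classes of the ambient model: closed under elementary definability, hence a
       model of GB over [LA]. It contains [R], and with it the domain and the transitive closure of
       [R]. *)
    pose (X1 := fun C => sub C LA /\ Y C /\ Am C).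
    assert (A1 : Afam X1).
    { split; [auto|split].
      - intros q e c Eq He Hc; split; [intros z Hz; apply mem_sep in Hz; tauto|]; split.
        + apply LA_defclass; auto; intro i; split; apply (Hc i).
        + apply Am_def; auto.
      - exists R; repeat split; auto. }
    assert (G1 : GBm LA X1) by (apply GBm_L; auto).
    assert (XR : X1 R) by (repeat split; auto).
    destruct (domset_class (M:=LA) (Y:=X1) R XR) as (_ & YD & AD).
    destruct (tcs_class (M:=LA) (Y:=X1) R XR W) as (ST & YT & AT).
    set (T := tcs LA R) in *; set (D := domset LA R) in *.
    assert (RT : forall x y, rel T x y <-> tc R x y) by (intros; apply rel_tcs; auto).
    assert (Eq : elementary (noceq p) = true) by (apply elementary_noceq; auto).
    assert (Srs : forall r, sub (restr S0 T r) S0) by (intros r z Hz; apply mem_sep in Hz; tauto).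
    (* The class parameter [S0 ↾ r] varies with [r] in the level, so reflection is needed uniformly
       in [r]. *)
    assert (B1 := reflect (N:=N) (Y:=Y) (noceq p) (fun r => cenv2 (restr S0 T r) A) Eq).
    refine (big_imp _ _ _ (big_and _ _ (B1 _ _) (big_and _ _ AD (big_and _ _ AT IA)))).
    2: { intros [|j]; simpl; unfold restr.
         - apply (df_ext _ _ (fun e => e 0 ∈ S0 /\ opair (fst (e 0)) (e 1) ∈ T)).
           + intros e0 _; rewrite mem_sep; tauto.
           + dfn.
         - dfn. }
    2: { intros r [|j] _ z Hz; simpl in Hz; apply LA_sub; [apply SS, (Srs r)|apply SA]; auto. }
    clear B1; intros g Hg Lg (Rf & Ag1 & Ag2 & Ag3); cbn beta in *.
    assert (Og : ord g) by exact (ord_mem _ _ Oal Hg).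
    assert (Trg : trans (Lv g)) by (apply Lv_trans; auto).
    assert (Wt : well_founded (rel (isect T (Lv g)))).
    { intro x; assert (Wt := tc_wf R W x); induction Wt as [x _ IHx]; constructor; intros y Hy; apply IHx.
      apply mem_isect in Hy; apply RT, Hy. }
    assert (Fst : forall a y, opair a y ∈ Lv g -> a ∈ Lv g /\ y ∈ Lv g).
    { intros a y Hw; assert (K : upair a y ∈ Lv g) by (apply (Trg _ Hw); apply mem_upair; auto).
      split; apply (Trg _ K); apply mem_upair; auto. }
    apply (set_sol (M:=LA) (Y:=X1) (Lv g) (isect D (Lv g)) (isect T (Lv g)) (isect A (Lv g)) (noceq p)); auto.
    + apply Lv_Lv; auto.
    + intros x y z Hx Hy; apply mem_isect in Hx; apply mem_isect in Hy; apply mem_isect; split.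
      * apply RT; eapply tc_trans; apply RT; [apply Hx|apply Hy].
      * destruct Hx as [_ Hx], Hy as [_ Hy]; apply Fst in Hx; apply Fst in Hy; apply Lv_opair; tauto.
    + destruct Sol as [PS QS]; split.
      * intros w Hw; apply mem_isect in Hw; destruct Hw as [Hw Lw'].
        destruct (PS w Hw) as (r & x & Hr & Hx & ->); exists r, x; apply Fst in Lw'.
        repeat split; try tauto; apply mem_isect; tauto.
      * intros r x Hr Hx; apply mem_isect in Hr; destruct Hr as [Hr Lr].
        assert (LSx : x ∈ LA) by (eapply Lv_mono; [| |exact Hx]; auto).
        transitivity (opair r x ∈ S0); [rewrite mem_isect; split; [tauto|]; split; auto; apply Lv_opair; auto|].
        rewrite QS by auto; rewrite <- esat_noceq by (auto; intros [|j]; simpl; auto; intros z Hz; apply SS, (Srs r); auto).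
        transitivity (esat LA (unpack (opair x emp)) (cenv2 (restr S0 T r) A) (noceq p)).
        { unfold esat; apply Sat_bounded with (n := 1) (m := 2); auto using bounded_noceq.
          intros [|i] Hi; [|lia]; rewrite unpack_cons; auto. }
        rewrite (Rf (opair x emp) r) by (auto; apply Lv_opair; auto; apply Lv_emp; auto).
        transitivity (esat (Lv g) (fun _ => x) (cenv2 (restr S0 T r) A) (noceq p)).
        { unfold esat; apply Sat_bounded with (n := 1) (m := 2); auto using bounded_noceq.
          intros [|i] Hi; [|lia]; rewrite unpack_cons; auto. }
        (* Restricting the trace of [S0] and tracing its restriction agree on [Lv g]: the first
           component of a pair in the transitive level is in it, and the level is closed under
           pairing. *)
        apply esat_trace; auto; intros [|j] z Hz; simpl.
        -- unfold restr; rewrite !mem_sep, !mem_isect; split; [|tauto]; intros [Hz' Kz]; repeat split; auto.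
           destruct (PS z Hz') as (a & y & _ & _ & ->); rewrite fst_opair; apply Fst in Hz; apply Lv_opair; tauto.
        -- rewrite mem_isect; tauto.
Qed.

Lemma Afam_False : Afam (Xs False LA gam).
Proof.
  split; [|split].
  - intros C HC; destruct (Xs_Y _ _ HC); repeat split; auto; apply (Xs_Am False); auto; tauto.
  - apply Xs_def.
  - exists emp; apply Xs_emp.
Qed.

Lemma Afam_Xs : Afam (Xs True LA gam).
Proof.
  split; [|split].
  - intros C HC; destruct (Xs_Y _ _ HC); repeat split; auto; apply (Xs_Am True); auto.
    intros _; apply GBm_L, Afam_False.
  - apply Xs_def.
  - exists emp; apply Xs_emp.
Qed.

End Amenable.


(** * Reading the axioms in a transitive model *)

Lemma trans_emp M : trans M -> (exists x, x ∈ M) -> emp ∈ M.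
Proof.
  intros T [x Hx]; destruct (wf_min mem (fun m => m ∈ M) x (mem_wf x) Hx) as (m & Hm & K).
  replace emp with m; auto; apply set_ext; intro z; split; intro Hz; [|destruct (mem_emp _ Hz)].
  destruct (K z Hz); apply (T m); auto.
Qed.

Lemma Sat_fSucc M X e c y x : trans M -> inN M e -> (Sat M X e c (fSucc y x) <-> e y = succ (e x)).
Proof.
  intros T He; simpl; split.
  - intro H; apply set_ext; intro z; rewrite mem_succ; split.
    + intro Hz; apply (H z); auto; apply (T (e y)); auto.
    + intro Hz; apply H; auto; destruct Hz; subst; auto; apply (T (e x)); auto.
  - intros -> z Hz; rewrite mem_succ; tauto.
Qed.

Lemma Sat_fEmpty M X e c x : trans M -> inN M e -> (Sat M X e c (fEmpty x) <-> e x = emp).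
Proof.
  intros T He; simpl; split.
  - intro H; apply set_ext; intro z; split; intro Hz; [|destruct (mem_emp _ Hz)].
    destruct (H z); auto; apply (T (e x)); auto.
  - intros -> z Hz H; apply (mem_emp _ H).
Qed.

Definition fIsnat : form :=
  fAnd (fOrd 0) (fAll (fImp (fOr (fMem 0 1) (fEq 0 1))
    (fOr (fEmpty 0) (fEx (fAnd (fMem 0 1) (fSucc 1 0)))))).

Lemma Sat_fIsnat M X e c : trans M -> inN M e -> (Sat M X e c fIsnat <-> isnat (e 0)).
Proof.
  intros T He; unfold fIsnat, isnat; cbn [Sat].
  rewrite (Sat_esat M X (fOrd 0)), esat_fOrd by auto.
  assert (K : (forall u, u ∈ M -> u ∈ e 0 \/ u = e 0 -> Sat M X (scons u e) c (fEmpty 0) \/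
     (exists v, v ∈ M /\ v ∈ u /\ Sat M X (scons v (scons u e)) c (fSucc 1 0))) <->
     (forall u, u ∈ succ (e 0) -> u = emp \/ exists v, v ∈ u /\ u = succ v)).
  { assert (U : forall u, u ∈ M -> (Sat M X (scons u e) c (fEmpty 0) \/
     (exists v, v ∈ M /\ v ∈ u /\ Sat M X (scons v (scons u e)) c (fSucc 1 0)) <->
       u = emp \/ exists v, v ∈ u /\ u = succ v)).
    { intros u Hu; rewrite Sat_fEmpty by auto using scons_in; simpl scons.
      split; (intros [H|H]; [left; exact H|right]).
      - destruct H as (v & Hv & Hvu & H); apply Sat_fSucc in H; auto using scons_in; eauto.
      - destruct H as (v & Hv & H); assert (v ∈ M) by (apply (T u); auto); exists v; split; [auto|split; [auto|]].
        apply (proj2 (Sat_fSucc M X (scons v (scons u e)) c 1 0 T ltac:(auto using scons_in))); exact H. }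
    split; intros H u Hu.
    - apply mem_succ in Hu; assert (Mu : u ∈ M) by (destruct Hu; subst; auto; apply (T (e 0)); auto).
      apply U; auto.
    - intro K; apply U; auto; apply H, mem_succ; auto. }
  exact (and_iff_compat_l _ K).
Qed.

(** Transitivity makes the axioms mean what they say. Only two points need work: [omega] is
    separated from an inductive set by [isnat], and replacement has to be derived for relations that
    are functional on [a] only. *)
Lemma GBm_of M X : trans M -> (exists x, x ∈ M) -> (exists A, A ∈ X) -> (forall A, A ∈ X -> sub A M) ->
  (forall p, GB p -> holds M X p) -> GBm M (fun A => A ∈ X).
Proof.
  intros T NM [A0 HA0] SX H.
  assert (E0 : emp ∈ M) by (apply trans_emp; auto).
  assert (Ax : forall p, GB p -> Sat M X (fun _ => emp) (fun _ => A0) p) by (intros; apply H; auto).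
  assert (Cst : forall a, a ∈ M -> inN M (fun _ => a)) by auto.
  assert (Compr : forall p e c, elementary p = true -> inN M e -> (forall i, c i ∈ X) ->
    sep M (fun x => Sat M X (scons x e) c p) ∈ X).
  { intros p e c E He Hc; destruct (H _ (GB_comprehension p E) e c He Hc) as (A & HA & K).
    replace (sep M (fun x => Sat M X (scons x e) c p)) with A; auto.
    apply set_ext; intro x; rewrite mem_sep; split.
    - intro Hx; assert (Mx : x ∈ M) by (apply (SX A); auto); split; auto.
      apply (Sat_cshift M X (scons x e) c A); apply (K x Mx); auto.
    - intros [Mx Hx]; apply (K x Mx); apply Sat_cshift; auto. }
  split; auto.
  - intros a b Ha Hb; destruct (Ax _ GB_pairing a Ha b Hb) as (p & Hp & K).
    apply Sat_fUpair in K; auto using scons_in; simpl in K; rewrite <- K; auto.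
  - intros a Ha; destruct (Ax _ GB_union a Ha) as (u & Hu & K); simpl in K.
    replace (union a) with u; auto; apply set_ext; intro z; rewrite mem_union; split.
    + intro Hz; assert (Mz : z ∈ M) by (apply (T u); auto); destruct (proj1 (K z Mz) Hz) as (y & _ & K'); eauto.
    + intros (y & Hy & Hz); assert (My : y ∈ M) by (apply (T a); auto); assert (Mz : z ∈ M) by (apply (T y); auto).
      apply (K z Mz); eauto.
  - intros a Ha; destruct (Ax _ GB_power a Ha) as (u & Hu & K); simpl in K.
    replace (isect (pow a) M) with u; auto; apply set_ext; intro z; rewrite mem_isect, mem_pow; split.
    + intro Hz; assert (Mz : z ∈ M) by (apply (T u); auto); split; auto; intros w Hw.
      apply (proj1 (K z Mz) Hz); auto; apply (T z); auto.
    + intros [Sz Mz]; apply (K z Mz); auto.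
  - destruct (Ax _ GB_infinity) as (w & Hw & [(z & Hz & Ez & Wz) K]).
    apply Sat_fEmpty in Ez; auto using scons_in; simpl in Ez, Wz; subst z.
    assert (K' : forall x, x ∈ M -> x ∈ w -> exists y, y ∈ M /\
      Sat M X (scons y (scons x (scons w (fun _ => emp)))) (fun _ => A0) (fSucc 0 1) /\ y ∈ w) by exact K.
    assert (Nw : forall n, num n ∈ w).
    { induction n; simpl; auto; assert (Mn : num n ∈ M) by (apply (T w); auto).
      destruct (K' _ Mn IHn) as (y & Hy & Sy & Wy); apply Sat_fSucc in Sy; auto using scons_in.
      simpl in Sy, Wy; rewrite <- Sy; auto. }
    destruct (Ax _ (GB_separation 1 fIsnat eq_refl eq_refl) w Hw) as (o & Ho & Ko).
    replace omega with o; auto; apply set_ext; intro x; rewrite <- isnat_omega.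
    assert (Q : forall x, x ∈ M -> (x ∈ o <-> x ∈ w /\ isnat x)).
    { intros y My; pose (e1 := scons y (scons o (scons w (fun _ => emp)))).
      assert (S1 : Sat M X e1 (fun _ => A0) (ren (scons 0 (fun k => k + 3)) idn fIsnat) <-> isnat y).
      { rewrite Sat_ren, Sat_fIsnat; [reflexivity|auto|]; intros [|i]; simpl; auto.
        replace (i + 3) with (S (S (S i))) by lia; simpl; auto. }
      assert (Ko' : y ∈ o <-> y ∈ w /\ Sat M X e1 (fun _ => A0) (ren (scons 0 (fun k => k + 3)) idn fIsnat))
        by exact (Ko y My).
      rewrite Ko', S1; tauto. }
    split.
    + intro Hx; assert (Mx : x ∈ M) by (apply (T o); auto); apply Q; auto.
    + intro Hx; pose proof Hx as Hn; apply isnat_omega, mem_omega in Hn; destruct Hn as [n ->].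
      assert (Mx : num n ∈ M) by (apply (T w); auto); apply Q; auto.
  - intros p e c E He Hc; erewrite sep_ext; [apply (Compr p e c); auto|].
    intros x Hx; symmetry; apply Sat_esat; auto.
  - intros F a HF Ha Fun.
    (* The axiom wants a relation functional everywhere, so [F] is first restricted to pairs with
       first component in [a]. *)
    assert (HF' := Compr (fAnd (fCMem 0 0) (fEx (fEx (fAnd (fOpair 2 1 0) (fMem 1 3))))) (fun _ => a) (fun _ => F)
      eq_refl (Cst a Ha) (fun _ => HF)).
    set (F' := sep M _) in HF'.
    assert (MF' : forall x y, opair x y ∈ F' <-> x ∈ a /\ opair x y ∈ F).
    { intros x y; unfold F'; rewrite mem_sep; split.
      - intros (Hw & Fw & u & Hu & v & Hv & Kw & Ku); apply Sat_fOpair in Kw; auto using scons_in.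
        simpl in Kw, Ku, Fw; apply opair_inj in Kw; destruct Kw; subst; auto.
      - intros [Hx Fx]; assert (Mw : opair x y ∈ M) by (apply (SX F); auto); split; auto.
        destruct (rel_in M F x y T (SX F HF) Fx) as [Mx My].
        split; [exact Fx|]; exists x; split; auto; exists y; split; auto; split; [|exact Hx].
        apply Sat_fOpair; auto 6 using scons_in. }
    assert (Fn : Sat M X (fun _ => emp) (scons F' (fun _ => A0)) (fFunctional 0)).
    { intros x Hx y Hy z Hz H1 H2; apply Sat_fPairIn in H1; apply Sat_fPairIn in H2; auto 6 using scons_in;
        try (apply SX; exact HF').
      simpl in H1, H2 |- *; apply MF' in H1; apply MF' in H2; apply (Fun x); tauto. }
    destruct (Ax _ GB_class_replacement F' HF' Fn a Ha) as (b & Hb & K).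
    replace (sep M (fun y => exists x, x ∈ a /\ opair x y ∈ F)) with b; auto.
    assert (Q : forall y, y ∈ M -> (y ∈ b <-> exists x, x ∈ a /\ opair x y ∈ F)).
    { intros y My; transitivity (exists x, x ∈ M /\ x ∈ a /\
        Sat M X (scons x (scons y (scons b (scons a (fun _ => emp))))) (scons F' (fun _ => A0)) (fPairIn 0 1 0)).
      - exact (K y My).
      - split.
        + intros (x & Hx & Hxa & Fx); apply Sat_fPairIn in Fx; auto 6 using scons_in; try (apply SX; exact HF').
          simpl in Fx; apply MF' in Fx; eauto; tauto.
        + intros (x & Hx & Fx); assert (Mx : x ∈ M) by (apply (T a); auto); exists x; split; [auto|split; [auto|]].
          apply Sat_fPairIn; auto 6 using scons_in; try (apply SX; exact HF'); simpl; apply MF'; auto. }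
    apply set_ext; intro y; rewrite mem_sep; split.
    + intro Hy; assert (My : y ∈ M) by (apply (T b); auto); split; auto; apply Q; auto.
    + intros [My Hy]; apply Q; auto.
  - eauto.
Qed.

Definition gam (g : form) (M x y : set) : Prop :=
  x ∈ M /\ y ∈ M /\ esat M (scons x (scons y (fun _ => emp))) (fun _ => emp) g.

(** * Elementary transfinite recursion read semantically *)

Section ReadETR.
Variables (M X : set) (g : form).
Context {G : GBm M (fun A => A ∈ X)}.
Hypothesis (g_elem : elementary g = true) (g_bd : bounded 2 0 g = true).
Let T : trans M := gb_trans.
Let SX : forall A, A ∈ X -> sub A M := gb_sub.

Lemma Sat_gLt e c x y : inN M e -> (Sat M X e c (gLt g x y) <-> gam g M (e x) (e y)).
Proof.
  intro He; unfold gLt, inst2; rewrite Sat_ren, Sat_esat by auto; unfold gam.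
  transitivity (esat M (scons (e x) (scons (e y) (fun _ => emp))) (fun _ => emp) g).
  - apply Sat_bounded with (n := 2) (m := 0); auto; intros [|[|i]] Hi; simpl; auto; lia.
  - split; [|tauto]; intro; repeat split; auto.
Qed.

Lemma df_gam : DfP M (fun A => A ∈ X) (fun e => gam g M (e 0) (e 1)).
Proof.
  destruct (gb_inh (N:=M) (Y:=fun A => A ∈ X)) as [A0 HA0].
  exists g, (fun _ => A0); split; auto; split; auto; intros e He.
  rewrite <- (Sat_esat M X), <- (Sat_gLt e (fun _ => A0) 0 1) by auto.
  unfold gLt, inst2; rewrite Sat_ren; apply Sat_bounded with (n := 2) (m := 0); auto;
    intros [|[|i]] Hi; simpl; auto; lia.
Qed.

Lemma Sat_fDom e c x R : inN M e -> c R ∈ X -> (Sat M X e c (fDom x R) <-> dom (c R) (e x)).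
Proof.
  intros He HR; unfold fDom, dom.
  assert (Q : forall y, y ∈ M -> (Sat M X (scons y e) c (fOr (fPairIn (S x) 0 R) (fPairIn 0 (S x) R)) <->
    rel (c R) (e x) y \/ rel (c R) y (e x))).
  { intros y Hy; cbn [Sat]; pose proof (Sat_fPairIn M X (scons y e) c (S x) 0 R T (scons_in M y e Hy He) (SX _ HR)) as K1.
    pose proof (Sat_fPairIn M X (scons y e) c 0 (S x) R T (scons_in M y e Hy He) (SX _ HR)) as K2.
    simpl scons in K1, K2; unfold rel; tauto. }
  split.
  - intros (y & Hy & K); exists y; apply Q; auto.
  - intros (y & K); assert (Hy : y ∈ M) by (destruct K as [K|K]; apply (rel_in M _ _ _ T (SX _ HR)) in K; tauto).
    exists y; split; auto; apply Q; auto.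
Qed.

Lemma Sat_fFunctional e c F : inN M e -> c F ∈ X -> (Sat M X e c (fFunctional F) <->
  forall x y z, x ∈ M -> y ∈ M -> z ∈ M -> opair x y ∈ c F -> opair x z ∈ c F -> y = z).
Proof.
  intros He HF; assert (SF : sub (c F) M) by (apply SX; auto); split.
  - intros H x y z Hx Hy Hz H1 H2; apply (H x Hx y Hy z Hz); apply Sat_fPairIn; auto 6 using scons_in.
  - intros H x Hx y Hy z Hz H1 H2; apply Sat_fPairIn in H1; apply Sat_fPairIn in H2; auto 6 using scons_in.
    simpl in *; apply (H x y z); auto.
Qed.

Lemma Sat_fRankLe e c R : inN M e -> c R ∈ X ->
  (Sat M X e c (fRankLe g R) <-> exists F, F ∈ X /\ ranked M (gam g M) (c R) F).
Proof.
  intros He HR; unfold fRankLe.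
  assert (Q : forall F, F ∈ X -> (Sat M X e (scons F c)
    (maps_into g (fun x => fDom x (S R)) (fun x y => fPairIn x y (S R))) <-> ranked M (gam g M) (c R) F)).
  { intros F HF; unfold maps_into, ranked; cbn [Sat].
    assert (HR' : scons F c (S R) ∈ X) by exact HR.
    assert (SR : sub (scons F c (S R)) M) by (apply SX; auto).
    assert (SF : sub (scons F c 0) M) by (apply SX; auto).
    rewrite Sat_fFunctional by auto; simpl scons.
    apply and_iff_compat_l.
    assert (Q1 : (forall x, x ∈ M -> Sat M X (scons x e) (scons F c) (fDom 0 (S R)) ->
        exists y, y ∈ M /\ Sat M X (scons y (scons x e)) (scons F c) (gFld g 0) /\
          Sat M X (scons y (scons x e)) (scons F c) (fPairIn 1 0 0)) <->
      (forall x, x ∈ M -> dom (c R) x ->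
        exists y, y ∈ M /\ ((exists z, z ∈ M /\ (gam g M y z \/ gam g M z y)) /\ opair x y ∈ F))).
    { assert (U : forall x y, x ∈ M -> y ∈ M -> (Sat M X (scons y (scons x e)) (scons F c) (gFld g 0) /\
          Sat M X (scons y (scons x e)) (scons F c) (fPairIn 1 0 0) <->
          (exists z, z ∈ M /\ (gam g M y z \/ gam g M z y)) /\ opair x y ∈ F)).
      { intros x y Hx Hy; rewrite Sat_fPairIn by auto using scons_in; simpl scons.
        apply and_iff_compat_r; unfold gFld; cbn [Sat]; split; intros (z & Hz & K); exists z; split; auto;
          rewrite !Sat_gLt in * by auto using scons_in; auto. }
      split; intros H x Hx Dx.
      - destruct (H x Hx) as (y & Hy & K); [apply Sat_fDom; auto using scons_in|]; exists y; split; auto; apply U; auto.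
      - apply Sat_fDom in Dx; auto using scons_in; destruct (H x Hx Dx) as (y & Hy & K).
        exists y; split; auto; apply U; auto. }
    assert (Q2 : (forall x, x ∈ M -> forall x', x' ∈ M -> forall y, y ∈ M -> forall y', y' ∈ M ->
       let e' := scons y' (scons y (scons x' (scons x e))) in
       Sat M X e' (scons F c) (fDom 3 (S R)) -> Sat M X e' (scons F c) (fDom 2 (S R)) ->
       Sat M X e' (scons F c) (fPairIn 3 2 (S R)) -> Sat M X e' (scons F c) (fPairIn 3 1 0) ->
       Sat M X e' (scons F c) (fPairIn 2 0 0) -> Sat M X e' (scons F c) (gLt g 1 0)) <->
      (forall x x' y y', x ∈ M -> x' ∈ M -> y ∈ M -> y' ∈ M -> dom (c R) x -> dom (c R) x' -> rel (c R) x x' ->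
         opair x y ∈ F -> opair x' y' ∈ F -> gam g M y y')).
    { split.
      - intros H x x' y y' Hx Hx' Hy Hy' D1 D2 Rx F1 F2.
        assert (He' : inN M (scons y' (scons y (scons x' (scons x e))))) by auto 8 using scons_in.
        specialize (H x Hx x' Hx' y Hy y' Hy'); cbn zeta in H.
        rewrite !Sat_fDom, !Sat_fPairIn, Sat_gLt in H by auto; simpl in H; auto.
      - intros H x Hx x' Hx' y Hy y' Hy' e' D1 D2 Rx F1 F2.
        assert (He' : inN M e') by (unfold e'; auto 8 using scons_in).
        apply Sat_fDom in D1; auto; apply Sat_fDom in D2; auto; apply Sat_fPairIn in Rx; auto.
        apply Sat_fPairIn in F1; auto; apply Sat_fPairIn in F2; auto; apply Sat_gLt; auto.
        unfold e' in *; simpl in *; apply (H x x'); auto. }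
    split; intros [K1 K2]; split; [apply Q1|apply Q2|apply Q1|apply Q2]; auto. }
  split; intros (F & HF & K); exists F; split; auto; apply Q; auto.
Qed.

(** The true transitive closure is itself a class, by well-foundedness, so it is among the relations
    quantified over. Every other transitive class containing [R] includes it, by induction along
    chains. *)
Lemma Sat_fTransClos e c a b R : inN M e -> c R ∈ X -> well_founded (rel (c R)) ->
  (Sat M X e c (fTransClos a b R) <-> tc (c R) (e a) (e b)).
Proof.
  intros He HR W; unfold fTransClos.
  assert (HT : tcs M (c R) ∈ X) by exact (tcs_class (c R) HR W).
  assert (Op : forall x y, x ∈ M -> y ∈ M -> opair x y ∈ M) by (intros; repeat apply gb_pair; auto).
  assert (RT : forall x y, rel (tcs M (c R)) x y <-> tc (c R) x y) by (intros; apply rel_tcs; auto).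
  assert (Q : forall C, C ∈ X -> (Sat M X e (scons C c)
     (fImp (fAll (fAll (fImp (fPairIn 1 0 (S R)) (fPairIn 1 0 0))))
       (fImp (fAll (fAll (fAll (fImp (fPairIn 2 1 0) (fImp (fPairIn 1 0 0) (fPairIn 2 0 0)))))) (fPairIn a b 0))) <->
     ((forall x y, rel (c R) x y -> rel C x y) -> (forall x y z, rel C x y -> rel C y z -> rel C x z) ->
      rel C (e a) (e b)))).
  { intros C HC; assert (HR' : scons C c (S R) ∈ X) by exact HR; assert (HC' : scons C c 0 ∈ X) by exact HC.
    assert (SR : sub (scons C c (S R)) M) by (apply SX; auto).
    assert (SC : sub (scons C c 0) M) by (apply SX; auto).
    cbn [Sat]; rewrite (Sat_fPairIn M X e) by auto; unfold rel at 4; simpl scons at 3.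
    assert (Q1 : (forall x, x ∈ M -> forall y, y ∈ M ->
        Sat M X (scons y (scons x e)) (scons C c) (fPairIn 1 0 (S R)) ->
        Sat M X (scons y (scons x e)) (scons C c) (fPairIn 1 0 0)) <->
        (forall x y, rel (c R) x y -> rel C x y)).
    { split.
      - intros H x y K; destruct (rel_in M (c R) x y T (SX _ HR) K) as [Hx Hy]; specialize (H x Hx y Hy).
        rewrite !Sat_fPairIn in H by auto 6 using scons_in; apply H, K.
      - intros H x Hx y Hy; rewrite !Sat_fPairIn by auto 6 using scons_in; apply H. }
    assert (Q2 : (forall x, x ∈ M -> forall y, y ∈ M -> forall z, z ∈ M ->
        Sat M X (scons z (scons y (scons x e))) (scons C c) (fPairIn 2 1 0) ->
        Sat M X (scons z (scons y (scons x e))) (scons C c) (fPairIn 1 0 0) ->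
        Sat M X (scons z (scons y (scons x e))) (scons C c) (fPairIn 2 0 0)) <->
        (forall x y z, rel C x y -> rel C y z -> rel C x z)).
    { split.
      - intros H x y z K L; destruct (rel_in M C x y T (SX _ HC) K) as [Hx Hy].
        destruct (rel_in M C y z T (SX _ HC) L) as [_ Hz]; specialize (H x Hx y Hy z Hz).
        rewrite !Sat_fPairIn in H by auto 8 using scons_in; apply H; auto.
      - intros H x Hx y Hy z Hz; rewrite !Sat_fPairIn by auto 8 using scons_in; apply H. }
    split; intros H K1 K2; (apply H; [apply Q1; exact K1|apply Q2; exact K2]). }
  split.
  - intro H; specialize (H _ HT); apply Q in H; auto.
    + apply RT; auto.
    + intros x y K; apply RT, tc1; auto.
    + intros x y z K L; apply RT; eapply tc_trans; apply RT; eauto.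
  - intros H C HC; apply Q; auto; intros K1 K2; clear Q; induction H as [b' H|u b' H IH K]; auto.
    eapply K2; [exact IH|]; auto.
Qed.

Lemma Sat_fRestr e c y s r R : inN M e -> c R ∈ X -> c y ∈ X -> well_founded (rel (c R)) ->
  (forall w, w ∈ c s -> w ∈ M /\ exists a x, w = opair a x) ->
  (Sat M X e c (fRestr y s r R) <-> c y = restr (c s) (tcs M (c R)) (e r)).
Proof.
  intros He HR Hy W Ps; unfold fRestr.
  assert (Op : forall x y, x ∈ M -> y ∈ M -> opair x y ∈ M) by (intros; repeat apply gb_pair; auto).
  assert (RT : forall x y, rel (tcs M (c R)) x y <-> tc (c R) x y) by (intros; apply rel_tcs; auto).
  assert (Q : forall w, w ∈ M -> (Sat M X (scons w e) c (fAnd (fCMem 0 s)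
       (fEx (fEx (fAnd (fOpair 2 1 0) (fTransClos 1 (S (S (S r))) R))))) <->
     w ∈ restr (c s) (tcs M (c R)) (e r))).
  { intros w Hw; unfold restr; rewrite mem_sep; cbn [Sat].
    split; intros [Sw K]; (split; [exact Sw|]).
    - destruct K as (a & Ha & x & Hx & K1 & K2); apply Sat_fOpair in K1; auto 6 using scons_in.
      simpl in K1; subst w; rewrite fst_opair; apply RT.
      apply Sat_fTransClos in K2; auto 6 using scons_in.
    - destruct (Ps w Sw) as (_ & a & x & ->); rewrite fst_opair in K.
      assert (H : a ∈ M /\ x ∈ M).
      { apply (rel_in M (sing (opair a x)) a x T); [intros z Hz; apply mem_sing in Hz; subst; auto|].
        apply mem_sing; auto. }
      exists a; split; [tauto|]; exists x; split; [tauto|]; destruct H; split.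
      + apply Sat_fOpair; auto 6 using scons_in.
      + apply Sat_fTransClos; auto 6 using scons_in; simpl; apply RT; auto. }
  split.
  - intro H; apply set_ext; intro w; split; intro Hw.
    + assert (Mw : w ∈ M) by (apply (SX _ Hy); auto); apply Q; auto; apply (proj1 (H w Mw)); exact Hw.
    + assert (Mw : w ∈ M) by (apply mem_sep in Hw; apply Ps; tauto).
      apply (proj2 (H w Mw)); apply Q; auto.
  - intros E w Hw; specialize (Q w Hw); rewrite <- E in Q; split; intro K; [apply Q; exact K|apply Q in K; exact K].
Qed.

Lemma restr_class S0 R r : S0 ∈ X -> R ∈ X -> well_founded (rel R) -> r ∈ M -> restr S0 (tcs M R) r ∈ X.
Proof.
  intros HS HR W Hr; assert (HT : tcs M R ∈ X) by exact (tcs_class R HR W).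
  assert (K : sep M (fun w => w ∈ S0 /\ opair (fst w) r ∈ tcs M R) ∈ X).
  { exact (gb_class1 (N:=M) (Y:=fun A => A ∈ X) (fun w => w ∈ S0 /\ opair (fst w) r ∈ tcs M R)
      ltac:(apply df_and; [apply (df_cls M (fun A => A ∈ X) S0); [exact HS|dfn]
        |apply (df_cls M (fun A => A ∈ X) (tcs M R)); [exact HT|dfn]])). }
  replace (restr S0 (tcs M R) r) with (sep M (fun w => w ∈ S0 /\ opair (fst w) r ∈ tcs M R)); auto.
  apply set_ext; intro w; unfold restr; rewrite !mem_sep; split; [tauto|]; intros []; split; auto.
  apply (SX S0); auto.
Qed.

Definition ETRsem (p : form) : Prop :=
  forall R A F, R ∈ X -> A ∈ X -> F ∈ X -> ranked M (gam g M) R F ->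
  exists S0, S0 ∈ X /\ sol M (domset M R) (tcs M R) A p S0.

Lemma truly_thinks e c R : inN M e -> c R ∈ X -> well_founded (rel (c R)) -> Sat M X e c (fWellFounded R).
Proof.
  intros He HR W C HC (x & Hx & Cx); simpl in Cx.
  destruct (wf_min (rel (c R)) (fun m => m ∈ C) x (W x) Cx) as (m & Cm & K).
  assert (Hm : m ∈ M) by (apply (SX C); auto); exists m; split; auto; split; [exact Cm|].
  intros (y & Hy & Cy & Ry); apply Sat_fPairIn in Ry; auto using scons_in; try (apply SX; exact HR).
  apply (K y); auto.
Qed.

(** True well-foundedness of Γ passes to every relation ranked into it. This yields the premise
    [fWellFounded] of the axiom and the correct reading of the transitive closures in it. *)
Lemma holds_ETR p : elementary p = true -> bounded 1 2 p = true -> well_founded (gam g M) ->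
  (holds M X (ax_ETR g p) <-> ETRsem p).
Proof.
  intros Ep Bp Wg.
  assert (Body : forall e c R A S0, inN M e -> R ∈ X -> A ∈ X -> S0 ∈ X -> well_founded (rel R) ->
    (Sat M X e (scons S0 (scons A (scons R c)))
      (fAnd (fAll (fImp (fCMem 0 0) (fEx (fEx (fAnd (fOpair 2 1 0) (fDom 1 2))))))
       (fAll (fImp (fDom 0 2) (fCEx (fAnd (fRestr 0 1 0 3)
          (fAll (fAnd (fImp (fPairIn 1 0 1) (ren idn (scons 0 (fun k => k + 2)) p))
                      (fImp (ren idn (scons 0 (fun k => k + 2)) p) (fPairIn 1 0 1)))))))))
     <-> sol M (domset M R) (tcs M R) A p S0)).
  { intros e c R A S0 He HR HA HS W; set (cc := scons S0 (scons A (scons R c))).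
    assert (Q1 : (forall w, w ∈ M -> w ∈ S0 -> exists a, a ∈ M /\ exists x, x ∈ M /\
        Sat M X (scons x (scons a (scons w e))) cc (fAnd (fOpair 2 1 0) (fDom 1 2))) <->
      (forall w, w ∈ S0 -> exists r x, r ∈ domset M R /\ x ∈ M /\ w = opair r x)).
    { assert (U : forall w a x, w ∈ M -> a ∈ M -> x ∈ M ->
        (Sat M X (scons x (scons a (scons w e))) cc (fAnd (fOpair 2 1 0) (fDom 1 2)) <->
         w = opair a x /\ dom R a)).
      { intros w a x Hw Ha Hx; cbn [Sat]; rewrite Sat_fOpair, Sat_fDom by auto 6 using scons_in.
        simpl; tauto. }
      split.
      - intros H w Hw; assert (Mw : w ∈ M) by (apply (SX S0); auto).
        destruct (H w Mw Hw) as (a & Ha & x & Hx & K); apply U in K; auto; destruct K as [-> K].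
        exists a, x; repeat split; auto; apply mem_sep; auto.
      - intros H w Mw Hw; destruct (H w Hw) as (a & x & Ha & Hx & ->); apply mem_sep in Ha; destruct Ha.
        exists a; split; auto; exists x; split; auto; apply U; auto. }
    assert (Q2 : (forall w, w ∈ S0 -> exists r x, r ∈ domset M R /\ x ∈ M /\ w = opair r x) ->
      ((forall r, r ∈ M -> Sat M X (scons r e) cc (fDom 0 2) ->
         exists P, P ∈ X /\ Sat M X (scons r e) (scons P cc) (fRestr 0 1 0 3) /\
         forall x, x ∈ M ->
          (Sat M X (scons x (scons r e)) (scons P cc) (fPairIn 1 0 1) ->
           Sat M X (scons x (scons r e)) (scons P cc) (ren idn (scons 0 (fun k => k + 2)) p)) /\
          (Sat M X (scons x (scons r e)) (scons P cc) (ren idn (scons 0 (fun k => k + 2)) p) ->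
           Sat M X (scons x (scons r e)) (scons P cc) (fPairIn 1 0 1))) <->
       (forall r x, r ∈ domset M R -> x ∈ M ->
         (opair r x ∈ S0 <-> esat M (fun _ => x) (cenv2 (restr S0 (tcs M R) r) A) p)))).
    { intro Ps.
      assert (Ps' : forall w, w ∈ S0 -> w ∈ M /\ exists a x, w = opair a x).
      { intros w Hw; split; [apply (SX S0); auto|]; destruct (Ps w Hw) as (a & x & _ & _ & E); eauto. }
      assert (U1 : forall P r x, P ∈ X -> r ∈ M -> x ∈ M ->
        (Sat M X (scons x (scons r e)) (scons P cc) (fPairIn 1 0 1) <-> opair r x ∈ S0)).
      { intros; rewrite Sat_fPairIn by (auto 6 using scons_in; apply SX; exact HS); reflexivity. }
      assert (U2 : forall P r x, P ∈ X -> r ∈ M -> x ∈ M ->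
        (Sat M X (scons x (scons r e)) (scons P cc) (ren idn (scons 0 (fun k => k + 2)) p) <->
         esat M (fun _ => x) (cenv2 P A) p)).
      { intros P r x HP Hr Hx; rewrite Sat_ren, Sat_esat by auto.
        apply Sat_bounded with (n := 1) (m := 2); auto; intros [|[|i]] Hi; simpl; auto; lia. }
      assert (U3 : forall P r, P ∈ X -> r ∈ M ->
        (Sat M X (scons r e) (scons P cc) (fRestr 0 1 0 3) <-> P = restr S0 (tcs M R) r)).
      { intros P r HP Hr; exact (Sat_fRestr (scons r e) (scons P cc) 0 1 0 3 (scons_in M r e Hr He) HR HP W Ps'). }
      assert (U4 : forall r, r ∈ M -> (Sat M X (scons r e) cc (fDom 0 2) <-> dom R r)).
      { intros r Hr; exact (Sat_fDom (scons r e) cc 0 2 (scons_in M r e Hr He) HR). }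
      split.
      - intros H r x Hr Hx; apply mem_sep in Hr; destruct Hr as [Hr Dr].
        destruct (H r Hr) as (P & HP & K1 & K2); [apply U4; auto|]; apply U3 in K1; auto; subst P.
        specialize (K2 x Hx); rewrite U1, U2 in K2 by auto; tauto.
      - intros H r Hr Dr; apply U4 in Dr; auto; exists (restr S0 (tcs M R) r).
        assert (HP : restr S0 (tcs M R) r ∈ X) by (apply restr_class; auto).
        split; auto; split; [apply U3; auto|]; intros x Hx; rewrite U1, U2 by auto.
        assert (K := H r x (proj2 (mem_sep _ _ _) (conj Hr Dr)) Hx); tauto. }
    split.
    - intros [K1 K2]; assert (P1 := proj1 Q1 K1); split; auto; apply (proj1 (Q2 P1)); exact K2.
    - intros [K1 K2]; split; [exact (proj2 Q1 K1)|exact (proj2 (Q2 K1) K2)]. }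
  split.
  - intros H R A F HR HA HF Rk.
    assert (W : well_founded (rel R)) by exact (ranked_wf M (gam g M) R F T (SX _ HR) Wg Rk).
    assert (E0 : inN M (fun _ => emp)) by (intro; apply gb_emp).
    destruct (H (fun _ => emp) (fun _ => R) E0 (fun _ => HR) R HR A HA) as (S0 & HS & K).
    + apply truly_thinks; auto.
    + apply Sat_fRankLe; auto; exists F; auto.
    + exists S0; split; auto; apply (Body (fun _ => emp) (fun _ => R) R A S0); auto.
  - intros H e c He Hc R HR A HA _ Rk; apply Sat_fRankLe in Rk; auto; destruct Rk as (F & HF & Rk).
    assert (W : well_founded (rel R)) by exact (ranked_wf M (gam g M) R F T (SX _ HR) Wg Rk).
    destruct (H R A F HR HA HF Rk) as (S0 & HS & K); exists S0; split; auto; apply Body; auto.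
Qed.

End ReadETR.


(** * Transfer from the universe of trees *)

Lemma mk_upairV x y : mk (upairV x y) = upair (mk x) (mk y).
Proof.
  apply set_ext; intro z; rewrite mem_upair, mem_mk_ex; split.
  - intros (w & [[|] Hb] & ->); simpl in Hb; [left|right]; apply mk_eq; auto.
  - intros [->| ->]; eexists; (split; [|reflexivity]); [exists true|exists false]; apply eqV_refl.
Qed.

Lemma mk_opairV x y : mk (opairV x y) = opair (mk x) (mk y).
Proof. unfold opairV; rewrite !mk_upairV; reflexivity. Qed.

Lemma truly_wf_iff R : truly_well_founded R <-> well_founded (rel (mk R)).
Proof.
  assert (E : forall x y, memV (opairV x y) R <-> rel (mk R) (mk x) (mk y)).
  { intros; unfold rel; rewrite <- mk_opairV, mem_mk; tauto. }
  unfold truly_well_founded; split; intros H x.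
  - rewrite <- (mk_val x); generalize (val x); clear x; intro x; induction (H x) as [x _ IH].
    constructor; intros y Hy; rewrite <- (mk_val y) in Hy |- *; apply IH; apply E; auto.
  - remember (mk x) as u eqn:Eu; revert x Eu; induction (H u) as [u _ IH]; intros x ->.
    constructor; intros y Hy; apply (IH (mk y)); auto; apply E; auto.
Qed.

Definition bm (Th : form -> Prop) (M X : set) : Prop :=
  (exists x, x ∈ M) /\ (exists A, A ∈ X) /\ (forall A, A ∈ X -> sub A M) /\
  (forall p, Th p -> holds M X p) /\ trans M /\
  forall R, R ∈ X -> Sat M X (fun _ => emp) (fun _ => R) (fWellFounded 0) -> well_founded (rel R).

Lemma valid_holds M X p : valid M X p <-> holds (mk M) (mk X) p.
Proof.
  split; intros H e c He Hc.
  - assert (K : sat M X (fun i => val (e i)) (fun i => val (c i)) p)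
      by (apply H; intro i; apply mem_mkr; auto).
    apply sat_Sat in K; replace (fun i => mk (val (e i))) with e in K
      by (apply functional_extensionality; intro; rewrite mk_val; auto).
    replace (fun i => mk (val (c i))) with c in K
      by (apply functional_extensionality; intro; rewrite mk_val; auto).
    exact K.
  - apply sat_Sat, H; intro i; apply mem_mk; auto.
Qed.

Lemma subV_sub x y : subV x y <-> sub (mk x) (mk y).
Proof.
  split; intros H z Hz.
  - apply mem_mk_ex in Hz; destruct Hz as (w & Hw & ->); apply mem_mk; auto.
  - apply mem_mk, H, mem_mk; auto.
Qed.

Lemma transV_trans x : transV x <-> trans (mk x).
Proof.
  split.
  - intros H y Hy z Hz; apply mem_mk_ex in Hy; destruct Hy as (w & Hw & ->).
    apply (proj1 (subV_sub _ _) (H w Hw)); auto.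
  - intros H y Hy; apply subV_sub; intros z Hz; apply (H (mk y)); auto; apply mem_mk; auto.
Qed.

Lemma ordV_ord x : ordV x <-> ord (mk x).
Proof.
  unfold ordV, ord; rewrite transV_trans; split; intros [H K]; split; auto.
  - intros y Hy; apply mem_mk_ex in Hy; destruct Hy as (w & Hw & ->); apply transV_trans; auto.
  - intros y Hy; apply transV_trans, K, mem_mk; auto.
Qed.

Lemma nonempty_mk x : nonempty x <-> exists z, z ∈ mk x.
Proof.
  split.
  - intros [z Hz]; exists (mk z); apply mem_mk; auto.
  - intros [z Hz]; apply mem_mk_ex in Hz; destruct Hz as (w & Hw & _); exists w; auto.
Qed.

Lemma mk_emptyV : mk emptyV = emp.
Proof.
  apply set_ext; intro z; split; intro H; [|destruct (mem_emp _ H)].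
  apply mem_mk_ex in H; destruct H as (w & [[] _] & _).
Qed.

Lemma beta_bm Th M X : beta_model Th M X <-> bm Th (mk M) (mk X).
Proof.
  unfold beta_model, so_structure, bm, models; rewrite !nonempty_mk, transV_trans.
  assert (E1 : (forall A, memV A X -> subV A M) <-> (forall A, A ∈ mk X -> sub A (mk M))).
  { split; intros H A HA.
    - apply mem_mk_ex in HA; destruct HA as (w & Hw & ->); apply subV_sub; auto.
    - apply subV_sub, H, mem_mk; auto. }
  assert (E2 : (forall p, Th p -> valid M X p) <-> (forall p, Th p -> holds (mk M) (mk X) p)).
  { split; intros H p Hp; apply valid_holds; auto. }
  assert (E3 : (forall R, memV R X -> thinks_well_founded M X R -> truly_well_founded R) <->
    (forall R, R ∈ mk X -> Sat (mk M) (mk X) (fun _ => emp) (fun _ => R) (fWellFounded 0) ->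
       well_founded (rel R))).
  { assert (E : forall R, thinks_well_founded M X R <->
      Sat (mk M) (mk X) (fun _ => emp) (fun _ => mk R) (fWellFounded 0)).
    { intro R; unfold thinks_well_founded; rewrite sat_Sat, mk_emptyV; tauto. }
    split; intros H R HR K.
    - apply mem_mk_ex in HR; destruct HR as (w & Hw & ->); apply truly_wf_iff, H; auto; apply E; auto.
    - apply truly_wf_iff, H; [apply mem_mk; auto|apply E; auto]. }
  rewrite E1, E2, E3; tauto.
Qed.

Lemma mk_sepV x P Q : (forall y, P y <-> Q (mk y)) -> mk (sepV x P) = sep (mk x) Q.
Proof.
  intro H; apply set_ext; intro z; rewrite mem_sep, !mem_mk_ex; split.
  - intros (w & [[a Pa] Ha] & ->); simpl in Ha; split.
    + exists w; split; auto; exists a; auto.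
    + apply mk_eq in Ha; rewrite Ha; apply H; auto.
  - intros [(w & [a Ha] & ->) K]; exists w; split; auto.
    assert (Pa : P (elt x a)) by (apply H; apply mk_eq in Ha; rewrite <- Ha; auto).
    exists (exist _ a Pa); exact Ha.
Qed.

Lemma mk_powV x : mk (powV x) = pow (mk x).
Proof.
  apply set_ext; intro z; rewrite mem_pow; split.
  - intros Hz w Hw; apply mem_mk_ex in Hz; destruct Hz as (y & [P HP] & ->); simpl in HP.
    apply mk_eq in HP; rewrite HP in Hw; apply mem_mk_ex in Hw; destruct Hw as (v & [[a Pa] Ha] & ->).
    simpl in Ha; apply mem_mk; exists a; auto.
  - intro H; apply mem_mkr; exists (fun a => mk (elt x a) ∈ z); simpl.
    apply mk_eq; rewrite mk_val; apply set_ext; intro w; split.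
    + intro Hw; pose proof (H w Hw) as K; apply mem_mk_ex in K; destruct K as (y & [a Ha] & ->).
      apply mem_mk; apply mk_eq in Ha; rewrite Ha in Hw; exists (exist _ a Hw); simpl; apply mk_eq; auto.
    + intro Hw; apply mem_mk_ex in Hw; destruct Hw as (v & [[a Pa] Ha] & ->); simpl in Ha.
      apply mk_eq in Ha; rewrite Ha; auto.
Qed.

Lemma definable_mk A x : definable_over A x <-> definable (mk A) (mk x).
Proof.
  split.
  - intros (n & p & e & E & Bd & He & H); exists n, p, (fun i => mk (e i)); split; [auto|split; [auto|split]].
    + intros i Hi; apply mem_mk; auto.
    + intros y Hy; apply mem_mk_ex in Hy; destruct Hy as (w & Hw & ->); rewrite mem_mk, (H w Hw), sat_Sat.
      rewrite scons_map, mk_emptyV; unfold esat; reflexivity.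
  - intros (n & p & e & E & Bd & He & H); exists n, p, (fun i => val (e i)); split; [auto|split; [auto|split]].
    + intros i Hi; apply mem_mkr; auto.
    + intros y Hy; rewrite <- mem_mk, (H (mk y)) by (apply mem_mk; auto); rewrite sat_Sat, scons_map, mk_emptyV.
      replace (fun i => mk (val (e i))) with e by (apply functional_extensionality; intro; rewrite mk_val; auto).
      reflexivity.
Qed.

Lemma mk_Def A : mk (Def A) = Dfb (mk A).
Proof.
  unfold Def, Dfb; rewrite <- mk_powV; apply mk_sepV; intro; apply definable_mk.
Qed.

Lemma mk_Lset a : ord (mk a) -> mk (Lset a) = Lv (mk a).
Proof.
  induction a as [A f IH]; intro O; apply set_ext; intro z.
  rewrite mem_Lv, mem_mk_ex by auto; simpl Lset; split.
  - intros (w & [[i j] Hw] & ->); simpl in Hw; exists (mk (f i)).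
    assert (Hi : mk (f i) ∈ mk (sup A f)) by (apply mem_mk; exists i; apply eqV_refl).
    split; auto; rewrite <- IH by exact (ord_mem _ _ O Hi).
    rewrite <- mk_Def; apply mem_mk; exists j; auto.
  - intros (u & Hu & K); apply mem_mk_ex in Hu; destruct Hu as (v & [i Hi] & ->); simpl in Hi.
    apply mk_eq in Hi; rewrite Hi in K.
    assert (Hi' : mk (f i) ∈ mk (sup A f)) by (apply mem_mk; exists i; apply eqV_refl).
    rewrite <- IH, <- mk_Def in K by exact (ord_mem _ _ O Hi'); apply mem_mk_ex in K.
    destruct K as (w & [j Hj] & ->); exists w; split; auto; exists (existT _ i j); exact Hj.
Qed.

Lemma mk_height M : mk (sepV M ordV) = height (mk M).
Proof. apply mk_sepV; intro; apply ordV_ord. Qed.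

Lemma named_gam g M x y : named_rel g M x y <-> gam g (mk M) (mk x) (mk y).
Proof.
  unfold named_rel, gam, esat; rewrite !mem_mk, sat_Sat, !scons_map, mk_emptyV; tauto.
Qed.

Lemma absolute_gam g M : ord (height (mk M)) -> absolute_to_L g M ->
  forall x y, gam g (mk M) x y <-> gam g (Lv (height (mk M))) x y.
Proof.
  intros O H x y; specialize (H (val x) (val y)); unfold L_of in H.
  rewrite !named_gam, !mk_val, mk_Lset, mk_height in H by (rewrite mk_height; auto); exact H.
Qed.

(** * Γ and its recursions in a β-model *)

Lemma bm_GBm g M X : bm (GB_ETR g) M X -> GBm M (fun A => A ∈ X).
Proof.
  intros (NM & NX & SX & H & T & _); apply GBm_of; auto; intros p Hp; apply H, GB_ETR_GB; auto.
Qed.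

(** Soundness makes Γ a well-order in the sense of the model. Its graph is a class there, and the
    β-property turns well-foundedness in the model into true well-foundedness. *)
Lemma gam_wf_bm g M X : elementary g = true -> bounded 2 0 g = true -> proves GB nil (well_order g) ->
  bm (GB_ETR g) M X -> well_founded (gam g M).
Proof.
  intros Eg Bg Pg B; pose proof (bm_GBm g M X B) as G; destruct B as (NM & (A0 & HA0) & SX & H & T & Beta).
  assert (E0 : inN M (fun _ => emp)) by (intro; apply (gb_emp (N:=M) (Y:=fun A => A ∈ X))).
  assert (WO4 : Sat M X (fun _ => emp) (fun _ => A0) (well_order g)).
  { eapply soundness; [exact Pg| | | |]; auto; [intros q Hq; apply H, GB_ETR_GB; auto|intros q []]. }
  destruct WO4 as (_ & _ & _ & W).
  pose (R := sep M (fun w => exists x, x ∈ M /\ exists y, y ∈ M /\ (w = opair x y /\ gam g M x y))).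
  assert (HR : R ∈ X).
  { refine (gb_class1 (N:=M) (Y:=fun A => A ∈ X) (fun w => exists x, x ∈ M /\ exists y, y ∈ M /\ (w = opair x y /\ gam g M x y)) _).
    apply df_ex, df_ex, df_and; [dfn|].
    exact (df_ren _ _ _ (fun i => match i with 0 => 1 | _ => 0 end) (df_gam M X g Eg Bg)). }
  assert (RR : forall x y, rel R x y <-> gam g M x y).
  { intros x y; unfold rel, R; rewrite mem_sep; split.
    - intros (_ & u & _ & v & _ & E & K); apply opair_inj in E; destruct E; subst; auto.
    - intro K; destruct K as (Hx & Hy & K); split; [repeat apply (gb_pair (Y:=fun A => A ∈ X)); auto|].
      exists x; split; auto; exists y; split; auto; split; [reflexivity|repeat split; auto]. }
  assert (WR : well_founded (rel R)).
  { apply Beta; auto; intros C HC (x & Hx & Cx); simpl in Cx.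
    assert (Fld : forall y, y ∈ M -> (Sat M X (scons y (fun _ => emp)) (scons C (fun _ => A0)) (gFld g 0) <->
        exists z, z ∈ M /\ (gam g M y z \/ gam g M z y))).
    { intros y Hy; unfold gFld; cbn [Sat]; split; intros (z & Hz & K); exists z; split; auto;
        rewrite !(Sat_gLt M X g Eg Bg) in * by auto using scons_in; auto. }
    (* The least elements given by [well_order] are for classes meeting the field of Γ; in a class
       disjoint from the field every element is minimal. *)
    destruct (classic (exists y, y ∈ M /\ (y ∈ C /\ exists z, z ∈ M /\ (gam g M y z \/ gam g M z y)))) as [(y & Hy & Cy & K)|K].
    - destruct (W C HC) as (m & Hm & Cm & Fm & Km).
      + exists y; split; auto; split; [exact Cy|apply Fld; auto].
      + exists m; split; auto; split; [exact Cm|]; intros (u & Hu & Cu & Ru); apply Km; exists u; split; auto.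
        split; [exact Cu|]; apply (Sat_gLt M X g Eg Bg); auto using scons_in.
        apply Sat_fPairIn in Ru; auto 6 using scons_in; try (apply SX; exact HR); apply RR; exact Ru.
    - exists x; split; auto; split; [exact Cx|]; intros (u & Hu & Cu & Ru); apply K.
      apply Sat_fPairIn in Ru; auto 6 using scons_in; try (apply SX; exact HR).
      exists x; split; auto; split; auto; exists u; split; auto; right; apply RR; exact Ru. }
  intro x; induction (WR x) as [x _ IH]; constructor; intros y Hy; apply IH, RR, Hy.
Qed.

(* The pair of classes [L], [A] with [A ⊆ L] is coded by the single class
   {(x, x) : x ∈ L} ∪ {(x, {x}) : x ∈ A}. *)
Definition inL (x : nat) : form := fPairIn x x 1.
Definition inA (x : nat) : form := fEx (fAnd (fUpair 0 (S x) (S x)) (fPairIn (S x) 0 1)).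
Definition inC (x X : nat) : form := match X with 0 => fCMem x 0 | S _ => inA x end.
Fixpoint relz (p : form) : form :=
  match p with
  | fCEq X Y => fAll (fAnd (fImp (inC 0 X) (inC 0 Y)) (fImp (inC 0 Y) (inC 0 X)))
  | fCMem x X => inC x X
  | fAnd p q => fAnd (relz p) (relz q)
  | fOr p q => fOr (relz p) (relz q)
  | fImp p q => fImp (relz p) (relz q)
  | fAll p => fAll (fImp (inL 0) (relz p))
  | fEx p => fEx (fAnd (inL 0) (relz p))
  | _ => p
  end.

Lemma elementary_relz p : elementary p = true -> elementary (relz p) = true.
Proof.
  assert (K : forall x Z, elementary (inC x Z) = true) by (intros x [|Z]; reflexivity).
  induction p; simpl; auto; intro E;
    try (apply andb_prop in E; destruct E; apply andb_true_intro; split; auto; fail).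
  rewrite !K; reflexivity.
Qed.

Lemma esat_relz M L A A' : trans M -> (forall x y, x ∈ M -> y ∈ M -> upair x y ∈ M) -> sub A' M -> sub A L -> sub L M ->
  (forall x, x ∈ M -> (opair x x ∈ A' <-> x ∈ L)) -> (forall x, x ∈ M -> (opair x (sing x) ∈ A' <-> x ∈ A)) ->
  forall p, elementary p = true -> forall e P, inN M e -> sub P L ->
  (esat M e (cenv2 P A') (relz p) <-> esat L e (cenv2 P A) p).
Proof.
  intros T Op SA' SA SL HL HA.
  assert (UL : forall e P x, inN M e -> (Sat M emp e (cenv2 P A') (inL x) <-> e x ∈ L)).
  { intros e P x He; unfold inL; rewrite Sat_fPairIn by auto; apply HL; auto. }
  assert (UA : forall e P x, inN M e -> (Sat M emp e (cenv2 P A') (inA x) <-> e x ∈ A)).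
  { intros e P x He; unfold inA; rewrite <- HA by auto; split.
    - intros (y & Hy & E & K); apply Sat_fUpair in E; auto using scons_in; simpl in E; subst y.
      apply Sat_fPairIn in K; auto using scons_in.
    - intro K; assert (Hs : sing (e x) ∈ M) by (apply Op; auto); exists (sing (e x)); split; auto; split.
      + apply Sat_fUpair; auto using scons_in.
      + apply Sat_fPairIn; auto using scons_in. }
  assert (UC : forall e P x Z, inN M e -> (Sat M emp e (cenv2 P A') (inC x Z) <-> e x ∈ cenv2 P A Z)).
  { intros e P x [|Z] He; [reflexivity|]; apply UA; auto. }
  unfold esat; induction p; simpl relz; intros E e P He SP; simpl in E; try discriminate;
    try (apply andb_prop in E; destruct E as [E1 E2]); try (simpl; tauto);
    try (cbn [Sat]; rewrite IHp1, IHp2 by auto; tauto).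
  - cbn [Sat]; split.
    + intro H; apply set_ext; intro z.
      assert (SC : forall Z, sub (cenv2 P A Z) M) by (intros [|Z] w Hw; simpl in Hw; apply SL; auto).
      split; intro Hz; assert (Mz : z ∈ M) by (eapply SC; exact Hz); specialize (H z Mz); rewrite !UC in H by auto using scons_in; apply H; auto.
    + intros K x Hx; rewrite !UC by auto using scons_in; simpl scons; rewrite K; tauto.
  - apply UC; auto.
  - cbn [Sat]; split; intros H x Hx.
    + assert (Mx : x ∈ M) by auto; apply IHp; auto using scons_in; apply H; auto; apply UL; auto using scons_in.
    + intro K; apply UL in K; auto using scons_in; apply IHp; auto using scons_in.
  - cbn [Sat]; split; intros (x & Hx & H).
    + destruct H as [K H]; apply UL in K; auto using scons_in; exists x; split; auto; apply IHp; auto using scons_in.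
    + assert (Mx : x ∈ M) by auto; exists x; split; auto; split; [apply UL; auto using scons_in|].
      apply IHp; auto using scons_in.
Qed.

(** The recursion is performed in [M] with the formula relativized to [L]. The schema allows a
    single class parameter, so [L] and [A] are packed into one class, and the conjunct [inL 0] keeps
    the rows inside [L]. *)
Lemma etr_L g M X : elementary g = true -> bounded 2 0 g = true -> GBm M (fun A => A ∈ X) ->
  well_founded (gam g M) -> (forall p, GB_ETR g p -> holds M X p) ->
  let L := Lv (height M) in
  (forall x y, gam g M x y <-> gam g L x y) ->
  forall R A F p, sub R L -> sub A L -> sub F L -> R ∈ X -> A ∈ X -> F ∈ X -> ranked L (gam g L) R F ->
  elementary p = true -> bounded 1 2 p = true ->
  exists S0, S0 ∈ X /\ sol L (domset L R) (tcs L R) A p S0.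
Proof.
  intros Eg Bg G Wg H L Abs R A F p SR SA SF HR HA HF Rk Ep Bp.
  assert (SL : sub L M) by (apply LA_sub).
  assert (TL : trans L) by (apply Lv_trans, ord_al).
  assert (YL : L ∈ X) by exact (LA_class (N:=M) (Y:=fun A => A ∈ X)).
  assert (T : trans M) by exact (gb_trans (N:=M)).
  assert (Op : forall x y, x ∈ M -> y ∈ M -> upair x y ∈ M) by (intros; apply (gb_pair (Y:=fun A => A ∈ X)); auto).
  pose (A' := sep M (fun w => exists x, x ∈ M /\ ((x ∈ L /\ w = opair x x) \/ (x ∈ A /\ w = opair x (sing x))))).
  assert (HA' : A' ∈ X).
  { refine (gb_class1 (N:=M) (Y:=fun A => A ∈ X) (fun w => exists x, x ∈ M /\ ((x ∈ L /\ w = opair x x) \/ (x ∈ A /\ w = opair x (sing x)))) _).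
    dfn. }
  (* Distinguishes the two kinds of pairs in the code [A']. *)
  assert (N1 : forall x, x <> sing x).
  { intros x E; apply (mem_irrefl x); rewrite E at 2; apply mem_sing; auto. }
  assert (EL : forall x, x ∈ M -> (opair x x ∈ A' <-> x ∈ L)).
  { intros x Hx; unfold A'; rewrite mem_sep; split.
    - intros (_ & y & _ & [[Hy E]|[Hy E]]); apply opair_inj in E; destruct E as [<- E]; auto; destruct (N1 x E).
    - intro Lx; split; [repeat apply Op; auto|]; exists x; auto. }
  assert (EA : forall x, x ∈ M -> (opair x (sing x) ∈ A' <-> x ∈ A)).
  { intros x Hx; unfold A'; rewrite mem_sep; split.
    - intros (_ & y & _ & [[Hy E]|[Hy E]]); apply opair_inj in E; destruct E as [<- E]; auto.
      symmetry in E; destruct (N1 x E).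
    - intro Lx; split; [repeat apply Op; auto|]; exists x; auto. }
  assert (Rk' : ranked M (gam g M) R F).
  { destruct Rk as (K1 & K2 & K3); assert (FL : forall x y, opair x y ∈ F -> x ∈ L /\ y ∈ L)
      by (intros; apply (rel_in L F); auto).
    assert (RL : forall x, dom R x -> x ∈ L).
    { intros x [y [K|K]]; apply (rel_in L R _ _ TL SR) in K; tauto. }
    split; [|split].
    - intros x y z _ _ _ F1 F2; destruct (FL _ _ F1), (FL _ _ F2); apply (K1 x y z); auto.
    - intros x Hx D; destruct (K2 x (RL x D) D) as (y & Hy & (z & Hz & K) & Fy); exists y; split; auto; split; auto.
      exists z; split; auto; rewrite !Abs; auto.
    - intros x x' y y' _ _ _ _ D D' Rx F1 F2; destruct (FL _ _ F1), (FL _ _ F2).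
      apply Abs; apply (K3 x x' y y'); auto. }
  pose (q0 := fAnd (inL 0) (relz p)).
  (* Identifying all set variables, and all class variables other than 0, brings the formula within
     the bounds of the schema. Its meaning is unchanged, as the environments in question are
     constant there. *)
  pose (q := ren (fun _ => 0) (fun j => match j with 0 => 0 | S _ => 1 end) q0).
  assert (Eq0 : elementary q0 = true) by (simpl; apply elementary_relz; auto).
  assert (Eq : elementary q = true) by (unfold q; rewrite elementary_ren; auto).
  assert (Bq : bounded 1 2 q = true).
  { destruct (bounded_ex q0) as (n & m & K); apply (bounded_ren q0 n m); auto; intros [|j] _; lia. }
  destruct (proj1 (holds_ETR M X g Eg Bg q Eq Bq Wg) (H _ (GB_ETR_ETR g q Eq Bq)) R A' F HR HA' HF Rk') as (S0 & HS & Sol).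
  exists S0; split; auto.
  assert (ED : domset M R = domset L R).
  { apply set_ext; intro x; unfold domset; rewrite !mem_sep; split; intros [Hx D]; split; auto.
    destruct D as [y [K|K]]; apply (rel_in L R _ _ TL SR) in K; tauto. }
  assert (ET : tcs M R = tcs L R).
  { apply set_ext; intro w; unfold tcs; rewrite !mem_sep; split; intros (Hw & K & E); repeat split; auto.
    rewrite E; apply Lv_opair; try apply ord_al; try apply limit_al; apply (tc_in L R _ _ TL SR K). }
  rewrite ED, ET in Sol; destruct Sol as [PS QS].
  assert (SD : sub (domset L R) M) by (rewrite <- ED; intros x Hx; apply mem_sep in Hx; tauto).
  assert (Key : forall r x P, x ∈ M -> sub P L -> r ∈ domset L R ->
     (esat M (fun _ => x) (cenv2 P A') q <-> x ∈ L /\ esat L (fun _ => x) (cenv2 P A) p)).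
  { intros r x P Hx SP Hr; unfold q, esat; rewrite Sat_ren.
    replace (fun i => cenv2 P A' match i with 0 => 0 | S _ => 1 end) with (cenv2 P A')
      by (apply functional_extensionality; intros [|j]; reflexivity).
    unfold q0; cbn [Sat]; fold (esat M (fun _ => x) (cenv2 P A') (relz p)).
    rewrite (esat_relz M L A A' T Op (gb_sub (Y:=fun A => A ∈ X) _ HA') SA SL EL EA p Ep) by auto.
    apply and_iff_compat_r; unfold inL.
    rewrite Sat_fPairIn by (auto; exact (gb_sub (Y:=fun A => A ∈ X) _ HA')); apply EL; auto. }
  assert (W : well_founded (rel (tcs L R))).
  { assert (WR : well_founded (rel R)) by exact (ranked_wf M (gam g M) R F T (gb_sub (Y:=fun A => A ∈ X) _ HR) Wg Rk').
    intro x; assert (Wt := tc_wf R WR x); induction Wt as [x _ IHx]; constructor; intros y Hy; apply IHx.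
    apply mem_sep in Hy; rewrite fst_opair, snd_opair in Hy; tauto. }
  (* Rows stay inside [L], by induction along the relation: [Key] applies at [r] once the earlier
     rows are known to be contained in [L]. *)
  assert (In : forall r, r ∈ domset L R -> forall x, x ∈ M -> opair r x ∈ S0 -> x ∈ L).
  { intro r; induction (W r) as [r _ IH]; intros Hr x Hx K; apply QS in K; auto.
    apply (Key r) in K; auto; [tauto|]; intros w Hw; apply mem_sep in Hw; destruct Hw as [Hw Tw].
    destruct (PS w Hw) as (a & y & Ha & Hy & ->); rewrite fst_opair in Tw.
    apply Lv_opair; try apply ord_al; try apply limit_al; [apply mem_sep in Ha; tauto|apply (IH a); auto]. }
  split.
  - intros w Hw; destruct (PS w Hw) as (a & y & Ha & Hy & ->); exists a, y; repeat split; auto; eapply In; eauto.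
  - intros r x Hr Hx; rewrite QS by auto; rewrite (Key r); auto; [tauto|].
    intros w Hw; apply mem_sep in Hw; destruct Hw as [Hw _]; destruct (PS w Hw) as (a & y & Ha & Hy & ->).
    apply Lv_opair; try apply ord_al; try apply limit_al; [apply mem_sep in Ha; tauto|eapply In; eauto].
Qed.


(** * Well-foundedness in L *)

Section IllFounded.
Context {M : set} {Y : set -> Prop} {G : GBm M Y}.
Notation dfP := (DfP M Y).
Notation dfF := (DfF M Y).

(** The recursion clause for stage [xi], which holds the points in the well-founded part of [r] of
    rank at most [xi]. *)
Definition rkF (r xi h : set) : set :=
  sep (union (union r)) (fun x => forall y, y ∈ union (union r) -> opair y x ∈ r ->
    exists z, z ∈ xi /\ y ∈ app h z).
Definition rk : set -> set -> set := orec rkF.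

Lemma df_rk t u : dfF t -> dfF u -> dfF (fun e => rk (t e) (u e)).
Proof. apply df_orec; unfold rkF; dfn. Qed.

Lemma mem_rk r xi x : ord xi -> (x ∈ rk r xi <-> x ∈ union (union r) /\
  forall y, rel r y x -> exists z, z ∈ xi /\ y ∈ rk r z).
Proof.
  intro O; unfold rk, orec; rewrite ite_T by auto; rewrite mrec_eq; unfold rkF at 1; rewrite mem_sep.
  assert (E : forall z, z ∈ xi -> app (graph xi (mrec (rkF r))) z = ite (ord z) (mrec (rkF r) z) emp).
  { intros z Hz; rewrite app_graph, ite_T; auto; exact (ord_mem _ _ O Hz). }
  split; intros [H K]; (split; [exact H|]); intros y Hy.
  - destruct (K y) as (z & Hz & Kz); [eapply mem_UU_l; eauto|exact Hy|].
    exists z; split; auto; rewrite <- E; auto.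
  - intro Ry; destruct (K y Ry) as (z & Hz & Kz); exists z; split; auto; rewrite E; auto.
Qed.

Lemma rk_Acc r xi : ord xi -> forall x, x ∈ rk r xi -> Acc (rel r) x.
Proof.
  induction xi as [xi IH] using mem_ind; intros O x Hx; apply mem_rk in Hx; auto; destruct Hx as [_ Hx].
  constructor; intros y Hy; destruct (Hx y Hy) as (z & Hz & Kz); apply (IH z Hz); auto; exact (ord_mem _ _ O Hz).
Qed.

(* The transfinite rank stages exhaust the well-founded part of [r]. *)
Lemma ill_founded_set r : r ∈ M -> ~ well_founded (rel r) ->
  exists b, b ∈ M /\ (exists x, x ∈ b) /\ forall x, x ∈ b -> exists y, y ∈ b /\ rel r y x.
Proof.
  intros Hr NW.
  (* The points that receive no rank below the height of the model. *)
  pose (b := sep (union (union r)) (fun x => forall xi, xi ∈ M -> ord xi -> ~ x ∈ rk r xi)).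
  assert (Hb : b ∈ M).
  { assert (D : dfF (fun _ => sep (union (union r)) (fun x => forall xi, xi ∈ M -> ord xi -> ~ x ∈ rk r xi)))
      by (dfn; apply df_rk; dfn).
    exact (proj1 D (fun _ => r) (fun _ => Hr)). }
  exists b; split; auto; split.
  - apply NNPP; intro K; apply NW.
    assert (U : forall x, x ∈ union (union r) -> Acc (rel r) x).
    { intros x Hx; apply NNPP; intro L; apply K; exists x; apply mem_sep; split; auto.
      intros xi Mxi Oxi Rx; apply L; eapply rk_Acc; eauto. }
    intro x; constructor; intros y Hy; apply U; eapply mem_UU_l; eauto.
  - intros x Hx; apply NNPP; intro K; apply mem_sep in Hx; destruct Hx as [Ux Hx].
    assert (P : forall y, rel r y x -> exists xi, xi ∈ M /\ ord xi /\ y ∈ rk r xi).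
    { intros y Ry; apply NNPP; intro L; apply K; exists y; split; auto; apply mem_sep; split;
        [eapply mem_UU_l; eauto|]; intros xi Mxi Oxi Ryx; apply L; eauto. }
    (* If all predecessors of [x] were ranked, replacement would bound their least stages, and [x]
       would enter at the stage after that bound. *)
    pose (least := fun y u => ord u /\ y ∈ rk r u /\ forall v, v ∈ u -> ~ y ∈ rk r v).
    pose (F := sep M (fun w => exists y, y ∈ M /\ exists u, u ∈ M /\ (w = opair y u /\ least y u))).
    assert (HF : Y F).
    { apply gb_class1; unfold least; dfn; apply df_rk; dfn. }
    assert (Mx : x ∈ M) by (apply (gb_trans (union (union r))); auto; repeat apply gb_union; auto).
    pose (pr := sep (union (union r)) (fun y => opair y x ∈ r)).
    assert (Hpr : pr ∈ M).
    { assert (D : dfF (fun _ => sep (union (union r)) (fun y => opair y x ∈ r))) by dfn.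
      exact (proj1 D (fun _ => r) (fun _ => Hr)). }
    assert (Lu : forall y u u', least y u -> least y u' -> u = u').
    { intros y u u' (O1 & H1 & K1) (O2 & H2 & K2); destruct (ord_total u u' O1 O2) as [E|[E|E]]; auto.
      - destruct (K2 u E H1).
      - destruct (K1 u' E H2). }
    assert (MF : forall y u, opair y u ∈ F -> least y u).
    { intros y u H; apply mem_sep in H; destruct H as (_ & y' & _ & u' & _ & E & H).
      apply opair_inj in E; destruct E; subst; auto. }
    assert (HU := gb_repl F pr HF Hpr ltac:(intros y u u' _ H1 H2; eapply Lu; eauto)).
    set (U := sep M _) in HU.
    assert (OU : ord (union U)).
    { apply ord_union; intros u Hu; apply mem_sep in Hu; destruct Hu as (_ & y & _ & Fy); apply MF in Fy; apply Fy. }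
    apply (Hx (succ (union U))).
    + apply gb_succ; apply gb_union; auto.
    + apply ord_succ; auto.
    + apply mem_rk; [apply ord_succ; auto|]; split; auto; intros y Ry.
      destruct (P y Ry) as (xi & Mxi & Oxi & Rxi).
      destruct (ord_least (fun u => y ∈ rk r u) xi Oxi Rxi) as (m & Om & Rm & Lm & Km).
      assert (Mm : m ∈ M) by (destruct Lm; subst; auto; exact (gb_trans _ Mxi m H)).
      assert (My : y ∈ M) by (apply (gb_trans (union (union r))); [repeat apply gb_union; auto|eapply mem_UU_l; eauto]).
      assert (Um : m ∈ U).
      { apply mem_sep; split; auto; exists y; split; [apply mem_sep; split; auto; eapply mem_UU_l; eauto|].
        apply mem_sep; split; [repeat apply gb_pair; auto|]; exists y; split; auto; exists m; split; auto.
        split; [reflexivity|split; auto]. }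
      exists m; split; auto; apply mem_succ.
      destruct (ord_sub m (union U)) as [E|E]; auto; intros z Hz; apply mem_union; eauto.
Qed.

End IllFounded.

(** [C] is a class of the ambient model and may be missing from [X]. At a level closed under descent
    in [C] the trace of [R] is an ill-founded element of [LA], and [LA], as a model of GB, finds a
    set witness by its own ranking. *)
Lemma ill_founded_L N Y (G : GBm N Y) X R C : Afam (N:=N) (Y:=Y) X -> X R -> Y C ->
  (exists x, x ∈ C) -> (forall x, x ∈ C -> exists y, y ∈ C /\ rel R y x) ->
  exists b, b ∈ Lv (height N) /\ (exists x, x ∈ b) /\ forall x, x ∈ b -> exists y, y ∈ b /\ rel R y x.
Proof.
  intros Af XR YC [c0 Hc0] HC; pose proof (GBm_L X Af) as GL; destruct Af as (A1 & _).
  destruct (A1 R XR) as (SR & YR & AR).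
  assert (O : ord (height N)) by apply ord_al; assert (Lm : limit (height N)) by apply limit_al.
  assert (TL : trans (Lv (height N))) by (apply Lv_trans; auto).
  assert (SC : sub C (Lv (height N))).
  { intros x Hx; destruct (HC x Hx) as (y & _ & K); apply (rel_in _ R _ _ TL SR) in K; tauto. }
  pose proof (SC c0 Hc0) as L0; apply mem_Lv_limit in L0; auto; destruct L0 as (d & Hd & L0).
  assert (BC := big_collect (N:=N) (Y:=Y) (fun x y => x ∈ C -> y ∈ C /\ opair y x ∈ R) ltac:(dfn)).
  destruct (big_unbounded _ d BC Hd) as (g & Hg & Lg & Dg & K).
  assert (Og : ord g) by exact (ord_mem _ _ O Hg).
  assert (c0 ∈ Lv g) by (eapply Lv_mono; eauto).
  destruct (ill_founded_set (isect R (Lv g))) as (b & Hb & Nb & Kb).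
  - apply (Am_all (Y:=Y)); auto.
  - intro W; destruct (wf_min _ (fun x => x ∈ C /\ x ∈ Lv g) c0 (W c0)) as (m & [Cm Lgm] & Km); auto.
    destruct (K m Lgm) as (y & Hy & Ky).
    + destruct (HC m Cm) as (y & Cy & Ry); exists y; split; auto.
    + destruct (Ky Cm) as [Cy Ry]; apply (Km y); auto; apply mem_isect; split; auto; apply Lv_opair; auto.
  - exists b; split; auto; split; auto; intros x Hx; destruct (Kb x Hx) as (y & Hy & Ry); exists y; split; auto.
    apply mem_isect in Ry; apply Ry.
Qed.

(** * The axioms of GB from the semantic ones *)

Lemma holds_GB M X : GBm M (fun A => A ∈ X) -> forall p, GB p -> holds M X p.
Proof.
  intros G p Hp; assert (T : trans M) by exact (gb_trans (N:=M)).
  assert (SX : forall A, A ∈ X -> sub A M) by exact (gb_sub (N:=M)).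
  assert (E0 : emp ∈ M) by apply (gb_emp (Y:=fun A => A ∈ X)).
  assert (Pr : forall x y, x ∈ M -> y ∈ M -> upair x y ∈ M) by apply (gb_pair (Y:=fun A => A ∈ X)).
  destruct Hp; intros e c He Hc.
  - intros x Hx y Hy H; apply set_ext; intro z; split; intro Hz; apply (H z); auto;
      [apply (T x)|apply (T y)]; auto.
  - intros x Hx (y & Hy & K); destruct (wf_min mem (fun m => m ∈ x) y (mem_wf y) K) as (m & Hm & Km).
    exists m; split; [apply (T x); auto|]; split; [exact Hm|]; intros (z & Hz & K1 & K2); apply (Km z); auto.
  - intros a Ha b Hb; exists (upair a b); split; auto; apply Sat_fUpair; auto using scons_in.
  - intros a Ha; exists (union a); split; [apply (gb_union (Y:=fun A => A ∈ X)); auto|]; intros z Hz.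
    cbn [Sat]; simpl scons; rewrite mem_union; split.
    + intros (y & Hy & K); exists y; split; auto; apply (T a); auto.
    + intros (y & _ & Hy & K); eauto.
  - intros a Ha; exists (isect (pow a) M); split; [apply (gb_pow (Y:=fun A => A ∈ X)); auto|]; intros z Hz.
    cbn [Sat fSub]; simpl scons; rewrite mem_isect, mem_pow; split.
    + intros [K _] w Hw; apply K.
    + intro K; split; auto; intros w Hw; apply K; auto; apply (T z); auto.
  - exists omega; assert (Mo : omega ∈ M) by apply (gb_omega (Y:=fun A => A ∈ X)); split; auto; split.
    + exists emp; split; auto; split; [apply Sat_fEmpty; auto using scons_in|apply (num_omega 0)].
    + intros x Hx K; simpl in K; assert (S1 : succ x ∈ omega) by (apply succ_omega; auto).
      assert (Ms : succ x ∈ M) by (apply (T omega); auto).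
      exists (succ x); split; auto; split; [apply Sat_fSucc; auto 6 using scons_in|exact S1].
  - intros a Ha; assert (K := gb_compr (Y:=fun A => A ∈ X) p e c H He Hc).
    assert (Ms := gb_sep (Y:=fun A => A ∈ X) a _ Ha K).
    exists (isect a (sep M (fun x => esat M (scons x e) c p))); split; auto; intros z Hz.
    assert (E : Sat M X (scons z (scons (isect a (sep M (fun x => esat M (scons x e) c p))) (scons a e))) c
      (ren (scons 0 (fun k => k + 3)) idn p) <-> esat M (scons z e) c p).
    { rewrite Sat_ren, Sat_esat by auto; match goal with |- esat _ ?f _ _ <-> _ => replace f with (scons z e) end;
        [reflexivity|]; apply functional_extensionality; intros [|i]; simpl; auto.
      replace (i + 3) with (S (S (S i))) by lia; reflexivity. }
    change (z ∈ isect a (sep M (fun x => esat M (scons x e) c p)) <-> z ∈ a /\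
      Sat M X (scons z (scons (isect a (sep M (fun x => esat M (scons x e) c p))) (scons a e))) c
        (ren (scons 0 (fun k => k + 3)) idn p)).
    rewrite E, mem_isect, mem_sep; tauto.
  - intros a Ha Fun.
    pose (P := fun x y => esat M (scons x (scons y e)) c p).
    assert (E : forall e' x y, (forall k, e' (k + 4) = e k) -> forall i j, e' i = x -> e' j = y ->
       (Sat M X e' c (inst2 i j 4 p) <-> P x y)).
    { intros e' x y Ee i j Hi Hj; unfold inst2, P; rewrite Sat_ren, Sat_esat by auto.
      match goal with |- esat _ ?f _ _ <-> _ => replace f with (scons x (scons y e)) end; [reflexivity|].
      apply functional_extensionality; intros [|[|k]]; simpl; auto. }
    assert (E4 : forall x y z w k, scons x (scons y (scons z (scons w e))) (k + 4) = e k).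
    { intros; replace (k + 4) with (S (S (S (S k)))) by lia; reflexivity. }
    pose (F := sep M (fun w => exists x, x ∈ M /\ exists y, y ∈ M /\ (w = opair x y /\ P x y))).
    assert (HF : F ∈ X).
    { refine (gb_class (Y:=fun A => A ∈ X) (fun v => exists x, x ∈ M /\ exists y, y ∈ M /\ (v 0 = opair x y /\
        esat M (scons x (scons y (fun i => v (S i)))) c p)) e _ He).
      apply df_ex, df_ex, df_and; [dfn|].
      (* Under the two quantifiers [y] is variable 0, [x] is variable 1, and the pair occupies
         variable 2, which [p] skips. *)
      apply (df_ext _ _ (fun v => esat M (fun i => v (match i with 0 => 1 | 1 => 0 | S (S i) => S (S (S i)) end)) c p)).
      - intros v _; match goal with |- esat _ ?f _ _ <-> esat _ ?h _ _ => replace h with f end; [reflexivity|].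
        apply functional_extensionality; intros [|[|i]]; reflexivity.
      - apply (df_ren _ _ (fun v => esat M v c p)); exists p, c; split; [auto|split; [auto|reflexivity]]. }
    assert (MF : forall x y, opair x y ∈ F <-> x ∈ M /\ y ∈ M /\ P x y).
    { intros x y; unfold F; rewrite mem_sep; split.
      - intros (_ & u & Hu & v & Hv & E1 & K); apply opair_inj in E1; destruct E1; subst; auto.
      - intros (Hx & Hy & K); split; [repeat apply Pr; auto|]; exists x; split; auto; exists y; auto. }
    assert (Mb : sep M (fun y => exists x, x ∈ a /\ opair x y ∈ F) ∈ M).
    { apply (gb_repl (Y:=fun A => A ∈ X)); auto; intros x y y' Hx H1 H2; apply MF in H1; apply MF in H2.
      destruct H1 as (Mx & My & H1), H2 as (_ & My' & H2).
      apply (Fun x Mx y My y' My' Hx); [apply (E _ x y (E4 y' y x a))|apply (E _ x y' (E4 y' y x a))]; auto. }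
    exists (sep M (fun y => exists x, x ∈ a /\ opair x y ∈ F)); split; auto; intros y Hy.
    change (y ∈ sep M (fun y => exists x, x ∈ a /\ opair x y ∈ F) <->
      exists x, x ∈ M /\ x ∈ a /\ Sat M X (scons x (scons y (scons (sep M (fun y => exists x, x ∈ a /\ opair x y ∈ F)) (scons a e)))) c (inst2 0 1 4 p)).
    rewrite mem_sep; split.
    + intros (_ & x & Hx & K); apply MF in K; exists x; split; [tauto|split; auto].
      apply (E _ x y (E4 x y (sep M (fun y => exists x, x ∈ a /\ opair x y ∈ F)) a)); auto; tauto.
    + intros (x & Mx & Hx & K); split; auto; exists x; split; auto; apply MF.
      apply (E _ x y (E4 x y (sep M (fun y => exists x, x ∈ a /\ opair x y ∈ F)) a)) in K; auto.
  - intros A HA B HB K; apply set_ext; intro z; split; intro Hz; apply (K z); auto;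
      [apply (SX A)|apply (SX B)]; auto.
  - intros F HF Fn0 a Ha; pose proof (proj1 (Sat_fFunctional M X e (scons F c) 0 He HF) Fn0) as Fn; simpl scons in Fn.
    assert (FM : forall x y, opair x y ∈ F -> x ∈ M /\ y ∈ M) by (intros; apply (rel_in M F); auto).
    assert (Mb : sep M (fun y => exists x, x ∈ a /\ opair x y ∈ F) ∈ M).
    { apply (gb_repl (Y:=fun A => A ∈ X)); auto; intros x y y' Hx H1 H2.
      destruct (FM _ _ H1), (FM _ _ H2); apply (Fn x y y'); auto. }
    exists (sep M (fun y => exists x, x ∈ a /\ opair x y ∈ F)); split; auto; intros y Hy.
    assert (E : forall x, x ∈ M -> (Sat M X (scons x (scons y (scons (sep M (fun y => exists x, x ∈ a /\ opair x y ∈ F)) (scons a e))))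
      (scons F c) (fPairIn 0 1 0) <-> opair x y ∈ F)).
    { intros x Hx; rewrite Sat_fPairIn; [reflexivity|auto|auto 6 using scons_in|apply SX; exact HF]. }
    change (y ∈ sep M (fun y => exists x, x ∈ a /\ opair x y ∈ F) <->
      exists x, x ∈ M /\ x ∈ a /\ Sat M X (scons x (scons y (scons (sep M (fun y => exists x, x ∈ a /\ opair x y ∈ F)) (scons a e)))) (scons F c) (fPairIn 0 1 0)).
    rewrite mem_sep; split.
    + intros (_ & x & Hx & K); assert (Mx : x ∈ M) by (apply (T a); auto); exists x; split; auto; split; auto; apply E; auto.
    + intros (x & Mx & Hx & K); split; auto; exists x; split; auto; apply E; auto.
  - assert (K := gb_compr (Y:=fun A => A ∈ X) p e c H He Hc).
    exists (sep M (fun x => esat M (scons x e) c p)); split; auto; intros x Hx.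
    assert (E : Sat M X (scons x e) (scons (sep M (fun x => esat M (scons x e) c p)) c) (cshift p) <->
      esat M (scons x e) c p) by (rewrite Sat_cshift, Sat_esat by auto; reflexivity).
    change (x ∈ sep M (fun x => esat M (scons x e) c p) <->
      Sat M X (scons x e) (scons (sep M (fun x => esat M (scons x e) c p)) c) (cshift p)).
    rewrite E, mem_sep; tauto.
Qed.

(** * Global choice *)

Section GlobalChoice.
Context {N : set} {Y : set -> Prop} {G : GBm N Y}.
Notation al := (height N).
Notation L := (Lv (height N)).
Variable X : set.
Hypothesis GL : GBm L (fun A => A ∈ X).
Let Oal : ord al := ord_al.
Let Lal : limit al := limit_al.
Let TL : trans L := gb_trans.

Lemma height_L x : x ∈ al <-> x ∈ L /\ ord x.
Proof.
  split.
  - intro H; split; [apply Lv_ord_in; auto|exact (ord_mem _ _ Oal H)].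
  - intros [H O]; apply Lv_ord; auto.
Qed.

Lemma WO_L : WO L (Lw al).
Proof. apply WO_BL; auto; intros; apply WO_StepO; auto. Qed.

(** The order of [L] is a class of [L]: a comparison is settled at the level after the one where the
    larger element appears, and no later level changes it. *)
Lemma rel_Lw x y : rel (Lw al) x y <-> exists xi, xi ∈ L /\ (ord xi /\ opair x y ∈ Lw xi).
Proof.
  split.
  - unfold Lw at 1; rewrite BL_eq by auto; rewrite rel_RU; intros (_ & _ & z & Hz & Ny & K).
    exists (succ z); assert (Sz : succ z ∈ al) by (apply Lal; auto); apply height_L in Sz.
    destruct Sz as [Lz Oz]; split; auto; split; auto.
    change (rel (Lw (succ z)) x y); unfold Lw; rewrite BL_eq by auto; apply rel_RU.
    assert (Szz : z ∈ succ z) by (apply mem_succ; auto).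
    assert (Oz' : ord z) by exact (ord_mem _ _ Oz Szz).
    repeat split; [| |exists z; auto]; unfold RU; rewrite fst_opair, mem_bigU.
    + destruct K as [(u & Hu & K)|[[K _] _]]; [exists u|exists z]; split; auto; apply mem_succ; auto.
    + exists z; split; auto; apply Ny.
  - intros (xi & Lxi & Oxi & K); change (rel (Lw xi) x y) in K; unfold Lw in K; rewrite BL_eq in K by auto.
    apply rel_RU in K; destruct K as (Dx & Dy & z & Hz & K).
    assert (Axi : xi ∈ al) by (apply height_L; auto).
    unfold Lw; rewrite BL_eq by auto; apply rel_RU.
    unfold RU in Dx, Dy |- *; rewrite fst_opair, mem_bigU in Dx, Dy |- *; rewrite mem_bigU.
    destruct Dx as (u & Hu & Dx), Dy as (v & Hv & Dy).
    repeat split; [exists u|exists v|exists z]; split; auto; eapply ord_trans; eauto.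
Qed.

(** Levels are initial segments, since elements are compared first by the stage at which they
    appear. *)
Lemma Lw_below x y g : g ∈ al -> y ∈ Lv g -> rel (Lw al) x y -> x ∈ Lv g.
Proof.
  intros Hg Hy K; assert (Og : ord g) by exact (ord_mem _ _ Oal Hg).
  unfold Lw in K; rewrite BL_eq in K by auto; apply rel_RU in K; destruct K as (_ & _ & z & Hz & [_ Ny] & K).
  apply mem_Lv0 in Hy; auto; destruct Hy as (u & Hu & Hy).
  assert (Au : u ∈ al) by exact (ord_trans _ _ _ Oal Hu Hg).
  assert (Hzg : z ∈ g).
  { destruct (ord_total z u (ord_mem _ _ Oal Hz) (ord_mem _ _ Oal Au)) as [E|[E|E]]; subst; auto.
    - exact (ord_trans _ _ _ Og E Hu).
    - destruct (Ny u E Hy). }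
  apply mem_Lv0; auto; destruct K as [(v & Hv & K)|[[K _] _]]; [exists v|exists z]; split; auto.
  exact (ord_trans _ _ _ Og Hv Hzg).
Qed.

(** The least element of [L] outside [s], extracted as the union of a one-element set. For [s] in
    [L] there is one, because [s] itself is not in [s]. *)
Definition mu (s : set) : set :=
  union (sep L (fun z => ~ z ∈ s /\ forall y, y ∈ L -> ~ y ∈ s -> y = z \/ rel (Lw al) z y)).

Lemma mu_uniq s z z' : z ∈ L -> z' ∈ L ->
  ~ z ∈ s /\ (forall y, y ∈ L -> ~ y ∈ s -> y = z \/ rel (Lw al) z y) ->
  ~ z' ∈ s /\ (forall y, y ∈ L -> ~ y ∈ s -> y = z' \/ rel (Lw al) z' y) -> z = z'.
Proof.
  intros Hz Hz' [H1 K1] [H2 K2]; destruct (K1 z' Hz' H2) as [E|E]; auto; destruct (K2 z Hz H1) as [E'|E']; auto.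
  destruct WO_L as (_ & W & _); destruct (wf_asym _ W _ _ E E').
Qed.

Lemma mu_spec s : s ∈ L -> mu s ∈ L /\ ~ mu s ∈ s /\ forall y, y ∈ L -> ~ y ∈ s -> y = mu s \/ rel (Lw al) (mu s) y.
Proof.
  intro Hs.
  destruct (wo_least L (Lw al) (fun z => ~ z ∈ s) s WO_L Hs (mem_irrefl s)) as (m & Hm & Pm & K).
  replace (mu s) with m; auto.
  apply set_ext; intro w; unfold mu; rewrite mem_union; split.
  - intro Hw; exists m; split; auto; apply mem_sep; auto.
  - intros (z & Hz & Hw); apply mem_sep in Hz; destruct Hz as [Hz Kz]; rewrite (mu_uniq s m z); auto.
Qed.

Lemma df_mu t : DfF L (fun A => A ∈ X) t -> DfF L (fun A => A ∈ X) (fun e => mu (t e)).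
Proof.
  apply (df_fun1 _ _ mu); split; [intros e He; apply mu_spec; auto|].
  apply (df_ext _ _ (fun e => ~ e 0 ∈ e 1 /\ forall y, y ∈ L -> ~ y ∈ e 1 -> y = e 0 \/
     exists xi, xi ∈ L /\ (ord xi /\ opair (e 0) y ∈ Lw xi))).
  - intros e He; destruct (mu_spec (e 1) (He 1)) as (H1 & H2 & H3); split.
    + intros [K1 K2]; apply (mu_uniq (e 1)); auto; split; auto.
      intros y Hy Ny; rewrite rel_Lw; auto.
    + intros ->; split; auto; intros y Hy Ny; rewrite <- rel_Lw; auto.
  - dfn; apply df_Lw; dfn.
Qed.

(** Each ordinal receives the least constructible set not yet listed, so the enumeration never stops
    and cannot repeat. *)
Definition enumF (p xi h : set) : set := mu (img xi (app h)).
Definition enum : set -> set := orec enumF emp.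

Lemma df_enum t : DfF L (fun A => A ∈ X) t -> DfF L (fun A => A ∈ X) (fun e => enum (t e)).
Proof.
  intro H; unfold enum; apply df_orec; dfn; unfold enumF; apply df_mu; dfn.
Qed.

Lemma enum_in xi : xi ∈ L -> enum xi ∈ L.
Proof.
  intro H; refine (proj1 (df_enum (fun e => e 0) _) (fun _ => xi) (fun _ => H)); dfn.
Qed.

Lemma enum_spec xi : xi ∈ al -> (forall z, z ∈ xi -> enum z <> enum xi) /\
  forall y, y ∈ L -> (forall z, z ∈ xi -> enum z <> y) -> y = enum xi \/ rel (Lw al) (enum xi) y.
Proof.
  intro H; assert (O : ord xi) by exact (ord_mem _ _ Oal H); assert (Lxi : xi ∈ L) by (apply height_L; auto).
  assert (E : enum xi = mu (img xi enum)).
  { unfold enum at 1, orec; rewrite ite_T by auto; rewrite mrec_eq; unfold enumF at 1; f_equal.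
    apply img_ext; intros z Hz; rewrite app_graph by auto; unfold enum, orec; rewrite ite_T; auto.
    exact (ord_mem _ _ O Hz). }
  assert (Is : img xi enum ∈ L).
  { assert (D : DfF L (fun A => A ∈ X) (fun e => img (e 0) enum)) by (dfn; apply df_enum; dfn).
    exact (proj1 D (fun _ => xi) (fun _ => Lxi)). }
  destruct (mu_spec _ Is) as (_ & K1 & K2); rewrite <- E in K1, K2; split.
  - intros z Hz Ez; apply K1; apply mem_img; exists z; auto.
  - intros y Hy Ny; apply K2; auto; intro K; apply mem_img in K; destruct K as (z & Hz & ->); apply (Ny z); auto.
Qed.

Lemma enum_inj xi xi' : xi ∈ al -> xi' ∈ al -> enum xi = enum xi' -> xi = xi'.
Proof.
  intros H H' E; destruct (ord_total xi xi' (ord_mem _ _ Oal H) (ord_mem _ _ Oal H')) as [K|[K|K]]; auto.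
  - destruct (proj1 (enum_spec xi' H') xi K E).
  - destruct (proj1 (enum_spec xi H) xi' K (eq_sym E)).
Qed.

Definition enumC : set := sep L (fun w => exists xi, xi ∈ L /\ (ord xi /\ w = opair (enum xi) xi)).

Lemma enumC_class : enumC ∈ X.
Proof.
  refine (gb_class1 (N:=L) (Y:=fun A => A ∈ X) (fun w => exists xi, xi ∈ L /\ (ord xi /\ w = opair (enum xi) xi)) _).
  dfn; apply df_enum; dfn.
Qed.

Lemma mem_enumC y xi : opair y xi ∈ enumC <-> xi ∈ al /\ y = enum xi.
Proof.
  unfold enumC; rewrite mem_sep; split.
  - intros (_ & u & Lu & Ou & E); apply opair_inj in E; destruct E; subst; split; auto; apply height_L; auto.
  - intros [H ->]; apply height_L in H; destruct H; split; [apply Lv_opair; auto using enum_in|eauto].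
Qed.

(** If [x] were missed, all values would precede [x] and hence lie in one level. Replacement along
    the inverse of the enumeration would then make the class of ordinals an element of [L]. *)
Lemma enum_surj x : x ∈ L -> exists xi, xi ∈ al /\ enum xi = x.
Proof.
  intro Hx; apply NNPP; intro NE.
  assert (Bel : forall xi, xi ∈ al -> rel (Lw al) (enum xi) x).
  { intros xi Hxi; destruct (proj2 (enum_spec xi Hxi) x Hx) as [E|E]; auto.
    - intros z Hz E; apply NE; exists z; split; auto; exact (ord_trans _ _ _ Oal Hz Hxi).
    - destruct NE; exists xi; auto. }
  pose proof Hx as Hg; apply mem_Lv_limit in Hg; auto; destruct Hg as (g & Hg & Hxg).
  assert (Lg : Lv g ∈ L) by (apply Lv_Lv; auto).
  pose proof enumC_class as HF; pose proof mem_enumC as MF; set (F := enumC) in *.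
  assert (Hal : al ∈ L).
  { assert (E : sep L (fun xi => exists y, y ∈ Lv g /\ opair y xi ∈ F) = al).
    { apply set_ext; intro xi; rewrite mem_sep; split.
      - intros (_ & y & _ & K); apply MF in K; tauto.
      - intro H; split; [apply height_L; auto|]; exists (enum xi); split; [|apply MF; auto].
        apply (Lw_below _ x); auto. }
    assert (K : sep L (fun xi => exists y, y ∈ Lv g /\ opair y xi ∈ F) ∈ L).
    { apply (gb_repl (Y:=fun A => A ∈ X)); auto; intros y u u' _ H1 H2; apply MF in H1; apply MF in H2.
      destruct H1 as [H1 ->], H2 as [H2 E2]; apply enum_inj; auto. }
    rewrite E in K; exact K. }
  apply (mem_irrefl al); apply height_L; auto.
Qed.

Lemma holds_global_choice : holds L X global_choice.
Proof.
  intros e c He Hc.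
  pose proof enumC_class as HF; pose proof mem_enumC as MF; set (F := enumC) in *.
  assert (SF : sub (scons F c 0) L) by (intros z Hz; apply mem_sep in Hz; tauto).
  assert (UO : forall e' i, inN L e' -> (Sat L X e' (scons F c) (fOrd i) <-> e' i ∈ al)).
  { intros e' i He'; rewrite Sat_esat, esat_fOrd, height_L by auto; specialize (He' i); tauto. }
  exists F; split; auto; split; [|split; [|split; [|split]]].
  - apply (proj2 (Sat_fFunctional L X e (scons F c) 0 He HF)); intros x y z _ _ _ H1 H2; apply MF in H1; apply MF in H2.
    apply enum_inj; try tauto; destruct H1, H2; congruence.
  - intros x Hx y Hy K; apply Sat_fPairIn in K; auto 6 using scons_in; apply MF in K.
    apply UO; auto using scons_in; apply K.
  - intros x Hx; destruct (enum_surj x Hx) as (xi & Hxi & E); assert (Lxi : xi ∈ L) by (apply height_L; auto).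
    exists xi; split; auto; apply Sat_fPairIn; auto 6 using scons_in; apply MF; simpl; auto.
  - intros x Hx y Hy z Hz H1 H2; apply Sat_fPairIn in H1; auto 6 using scons_in; apply Sat_fPairIn in H2; auto 6 using scons_in.
    apply MF in H1; apply MF in H2; simpl in *; destruct H1, H2; congruence.
  - intros x Hx K; apply UO in K; auto using scons_in; simpl in K.
    assert (Le : enum x ∈ L) by (apply enum_in; auto).
    exists (enum x); split; auto; apply Sat_fPairIn; auto 6 using scons_in; apply MF; simpl; auto.
Qed.

End GlobalChoice.

(** * The minimum model *)

Lemma Xs_sub b D g C : Xs b D g C -> trans D -> (forall x y, x ∈ D -> y ∈ D -> opair x y ∈ D) -> sub C D.
Proof.
  intros H T Op; destruct H as [|p e c _ _ _|R A F p S0 _ _ _ _ _ _ _ [P _]]; intros w Hw.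
  - destruct (mem_emp _ Hw).
  - apply mem_sep in Hw; tauto.
  - destruct (P w Hw) as (r & x & Hr & Hx & ->); apply mem_sep in Hr; apply Op; tauto.
Qed.

(** Once [D] is a set of [N], the whole generation of [Xs] takes place among sets: definability is
    separation in [N], and a recursion falls under [set_sol]. *)
Lemma Xs_in_set N Y (G : GBm N Y) b D g C : D ∈ N -> trans D ->
  (forall x y, x ∈ D -> y ∈ D -> opair x y ∈ D) -> well_founded g -> Xs b D g C -> C ∈ N.
Proof.
  intros HD T Op W H.
  induction H as [|p e c E He Hc IH|R A F p S0 Hb HR IR HA IA HF IF Rk E Bd Sol].
  - apply gb_emp.
  - assert (SD : sub D N) by (intros z Hz; exact (gb_trans _ HD z Hz)).
    assert (YD : Y D) by (apply gb_set; auto).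
    assert (K : DfF N Y (fun _ => sep D (fun x => esat D (scons x e) c p))).
    { apply df_sep; [dfn|].
      apply df_esat_cst; auto.
      - intro j; apply gb_set; auto.
      - intros j z Hz; exact (gb_trans _ (IH j) z Hz).
      - intro i; apply df_gcst; auto. }
    exact (proj1 K (fun _ => D) (fun _ => HD)).
  - assert (SR : sub R D) by exact (Xs_sub b D g R HR T Op).
    assert (WR : well_founded (rel R)) by exact (ranked_wf D g R F T SR W Rk).
    assert (YR : Y R) by (apply gb_set; auto).
    assert (RT : forall x y, rel (tcs D R) x y <-> tc R x y) by (intros; apply rel_tcs; auto).
    apply (set_sol (M:=N) (Y:=Y) D (domset D R) (tcs D R) A p S0); auto.
    + replace (domset D R) with (isect D (domset N R)); [apply gb_sep; auto; apply domset_class; auto|].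
      apply set_ext; intro x; unfold domset; rewrite mem_isect, !mem_sep; split; [tauto|]; intros []; repeat split; auto.
      exact (gb_trans _ HD x H).
    + replace (tcs D R) with (isect D (tcs N R)); [apply gb_sep; auto; apply tcs_class; auto|].
      apply set_ext; intro x; unfold tcs; rewrite mem_isect, !mem_sep; split; [tauto|]; intros (H1 & H2); repeat split; try tauto.
      exact (gb_trans _ HD x H1).
    + intro x; assert (Wt := tc_wf R WR x); induction Wt as [x _ IHx]; constructor; intros y Hy; apply IHx, RT, Hy.
    + intros x y z H1 H2; apply RT; eapply tc_trans; apply RT; eauto.
Qed.


Section Minimum.
Variable g : form.
Hypothesis (g_elem : elementary g = true) (g_bd : bounded 2 0 g = true).
Hypothesis g_wo : proves GB nil (well_order g).
Hypothesis g_abs : forall N X, bm (GB_ETR g) N X -> forall x y, gam g N x y <-> gam g (Lv (height N)) x y.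

Lemma Xs_sub_classes N X : bm (GB_ETR g) N X ->
  forall b C, Xs b (Lv (height N)) (gam g (Lv (height N))) C -> sub C (Lv (height N)) /\ C ∈ X.
Proof.
  intros B b C HC; pose proof (bm_GBm g N X B) as G.
  pose proof (gam_wf_bm g N X g_elem g_bd g_wo B) as W.
  assert (E : gam g (Lv (height N)) = gam g N).
  { apply functional_extensionality; intro x; apply functional_extensionality; intro y.
    apply propositional_extensionality; symmetry; apply (g_abs N X B). }
  apply (Xs_Y (N:=N) (Y:=fun A => A ∈ X) (gam g (Lv (height N)))) with (b := b); auto.
  - rewrite E; auto.
  - apply etr_L; auto; [apply B|apply (g_abs N X B)].
Qed.

(** Separation from the power set turns the inductive family into a set. *)
Definition Xmin (L : set) : set := sep (pow L) (Xs True L (gam g L)).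

Lemma bm_Xmin N X : bm (GB_ETR g) N X ->
  bm (GB_ETR g) (Lv (height N)) (Xmin (Lv (height N))) /\
  holds (Lv (height N)) (Xmin (Lv (height N))) global_choice.
Proof.
  intros B; pose proof (bm_GBm g N X B) as G.
  pose proof (gam_wf_bm g N X g_elem g_bd g_wo B) as W.
  set (L := Lv (height N)).
  assert (E : gam g L = gam g N).
  { apply functional_extensionality; intro x; apply functional_extensionality; intro y.
    apply propositional_extensionality; symmetry; apply (g_abs N X B). }
  assert (WL : well_founded (gam g L)) by (rewrite E; auto).
  assert (MX : forall C, C ∈ Xmin L <-> Xs True L (gam g L) C).
  { intro C; unfold Xmin; rewrite mem_sep, mem_pow; split; [tauto|]; intro HC; split; auto.
    apply (Xs_sub_classes N X B True C HC). }
  assert (Etr := etr_L g N X g_elem g_bd G W (proj1 (proj2 (proj2 (proj2 B)))) (g_abs N X B)).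
  assert (Af : Afam (N:=N) (Y:=fun A => A ∈ X) (fun C => C ∈ Xmin L)).
  { replace (fun C => C ∈ Xmin L) with (Xs True L (gam g L)).
    - apply Afam_Xs; auto.
    - apply functional_extensionality; intro C; apply propositional_extensionality; symmetry; apply MX. }
  assert (GL : GBm L (fun C => C ∈ Xmin L)) by (apply GBm_L; auto).
  split; [|apply holds_global_choice; auto].
  assert (TL : trans L) by exact (gb_trans (N:=L)).
  assert (Sb : forall A, A ∈ Xmin L -> sub A L) by exact (gb_sub (N:=L)).
  split; [exists emp; apply (gb_emp (Y:=fun C => C ∈ Xmin L))|].
  split; [exists emp; apply MX, Xs_emp|].
  split; [exact Sb|split; [|split; [exact TL|]]].
  - intros p [q Hq|q Eq Bq]; [apply holds_GB; auto|].
    apply (holds_ETR L (Xmin L) g g_elem g_bd q Eq Bq WL).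
    intros R A F HR HA HF Rk.
    assert (K : forall C, C ∈ Xmin L -> sub C L /\ C ∈ X) by (intros C HC; apply (Xs_sub_classes N X B True), MX; auto).
    destruct (K R HR), (K A HA), (K F HF).
    destruct (Etr R A F q) as (S0 & HS & Sol); auto.
    exists S0; split; auto; apply MX in HR; apply MX in HA; apply MX in HF; apply MX.
    apply (Xs_etr True L (gam g L) R A F q S0); auto.
  - intros R HR Th; apply NNPP; intro NW.
    assert (XR : R ∈ X) by (apply (Xs_sub_classes N X B True), MX; auto).
    destruct B as (_ & _ & SX & _ & TN & Beta).
    assert (E0 : inN N (fun _ => emp)) by (intro; apply (gb_emp (Y:=fun A => A ∈ X))).
    (* Since [(N, X)] is a β-model, an ill-founded [R] has in [X] a class without minimal element;
       [ill_founded_L] trades it for a set in [L], which contradicts the opinion of [L] that [R] is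
       well-founded. *)
    assert (Bad : exists C, C ∈ X /\ (exists x, x ∈ C) /\ forall x, x ∈ C -> exists y, y ∈ C /\ rel R y x).
    { apply NNPP; intro K; apply NW, Beta; auto; intros C HC (x & Hx & Cx); simpl in Cx.
      apply NNPP; intro K'; apply K; exists C; split; auto; split; [exists x; auto|].
      intros y Cy; apply NNPP; intro K2; apply K'; exists y; split; [apply (SX C); auto|].
      split; [exact Cy|]; intros (z & Hz & Cz & Rz); apply K2; exists z; split; auto.
      assert (Ny : y ∈ N) by (apply (SX C); auto).
      apply Sat_fPairIn in Rz; auto using scons_in; try exact (SX R XR). }
    destruct Bad as (C & HC & Ne & Cd).
    destruct (ill_founded_L N (fun A => A ∈ X) G (fun C => C ∈ Xmin L) R C Af HR HC Ne Cd) as (b & Hb & [x Hx] & Kb).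
    assert (Xb : b ∈ Xmin L) by exact (gb_set (N:=L) (Y:=fun C => C ∈ Xmin L) b Hb).
    assert (E1 : inN L (fun _ => emp)) by (intro; apply (gb_emp (Y:=fun C => C ∈ Xmin L))).
    assert (Lb : forall y, y ∈ b -> y ∈ L) by (intros y Hy; exact (TL b Hb y Hy)).
    destruct (Th b Xb) as (m & Hm & Bm & Km).
    + exists x; split; auto.
    + apply Km; simpl in Bm; destruct (Kb m Bm) as (y & Hy & Ry); exists y; split; auto; split; [exact Hy|].
      apply Sat_fPairIn; auto using scons_in; exact (Sb R HR).
Qed.

Lemma Xmin_least N0 X0 N X : bm (GB_ETR g) N0 X0 -> bm (GB_ETR g) N X -> ~ height N ∈ height N0 ->
  sub (Lv (height N0)) N /\ sub (Xmin (Lv (height N0))) X.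
Proof.
  intros B0 B Hh; pose proof (bm_GBm g N0 X0 B0) as G0; pose proof (bm_GBm g N X B) as G.
  assert (O0 : ord (height N0)) by apply ord_al; assert (O : ord (height N)) by apply ord_al.
  destruct (ord_total _ _ O0 O) as [H|[H|H]]; [| |tauto].
  - apply mem_al in H; destruct H as [H _].
    assert (HL : Lv (height N0) ∈ N) by (apply (gb_Lv (Y:=fun A => A ∈ X)); auto).
    split; [intros x Hx; exact (gb_trans (Y:=fun A => A ∈ X) _ HL x Hx)|].
    intros C HC; apply mem_sep in HC; destruct HC as [_ HC].
    apply (gb_set (N:=N) (Y:=fun A => A ∈ X)); apply (Xs_in_set N _ G) in HC; auto.
    + apply Lv_trans; auto.
    + intros; apply Lv_opair; auto; apply limit_al.
    (* Here Γ is evaluated in the smaller [L]; its well-foundedness comes from the β-model just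
       built over that [L], as Γ in [N] may be a different order. *)
    + apply (bm_Xmin N0 X0) in B0; destruct B0 as [B0 _]; apply (gam_wf_bm g _ _ g_elem g_bd g_wo B0).
  - rewrite H; split; [apply LA_sub|].
    intros C HC; apply mem_sep in HC; apply (Xs_sub_classes N X B True); tauto.
Qed.

End Minimum.

Theorem theorem5p5 (gamma : form)
  (gamma_first_order : elementary gamma = true)
  (gamma_no_parameters : bounded 2 0 gamma = true)
  (gamma_well_order : proves GB nil (well_order gamma))
  (gamma_ge_omega_omega : proves GB nil (ge_omega_omega gamma))
  (gamma_absolute : forall M X : V,
     beta_model (GB_ETR gamma) M X -> absolute_to_L gamma M)
  (beta_model_exists : exists M X : V, beta_model (GB_ETR gamma) M X) :
  exists M X : V,
    minimum_beta_model (GB_ETR gamma) M X /\ valid M X global_choice.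
Proof.
  assert (Abs : forall N X, bm (GB_ETR gamma) N X ->
    forall x y, gam gamma N x y <-> gam gamma (Lv (height N)) x y).
  { intros N X B; pose proof (bm_GBm gamma N X B) as G; rewrite <- (mk_val N), <- (mk_val X) in B.
    apply beta_bm, gamma_absolute in B.
    assert (O : ord (height (mk (val N)))) by (rewrite mk_val; apply ord_al).
    pose proof (absolute_gam gamma (val N) O B) as K; rewrite mk_val in K; exact K. }
  destruct beta_model_exists as (M0 & X0 & B0); apply beta_bm in B0.
  destruct (wf_min mem (fun h => exists N X, bm (GB_ETR gamma) N X /\ height N = h) (height (mk M0)) (mem_wf _))
    as (h & (N & X & B & <-) & Hmin); [eauto|].
  destruct (bm_Xmin gamma gamma_first_order gamma_no_parameters gamma_well_order Abs N X B) as [BL GC].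
  set (L := Lv (height N)) in *.
  exists (val L), (val (Xmin gamma L)); split; [split|].
  - apply beta_bm; rewrite !mk_val; auto.
  - intros N' Y' B'; apply beta_bm in B'; rewrite !subV_sub, !mk_val.
    apply (Xmin_least gamma gamma_first_order gamma_no_parameters gamma_well_order Abs N X); auto.
    intro H; apply (Hmin _ H); eauto.
  - apply valid_holds; rewrite !mk_val; auto.
Qed.
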